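(* Let $a,b>0$ be constants with $a+b<\tfrac12$. There exists $\varepsilon_0>0$ such that for every fixed $0<\varepsilon<\varepsilon_0$ the following holds. Consider data $m,n,\boldsymbol{s},\boldsymbol{t},H$ with $m,n\to\infty$ such that, uniformly over $j,k$: $s_j-s$, $x_j$, $t_k-t$, $y_k$ are $O(n^{1/2+\varepsilon})$; $X=O(n^{1+2\varepsilon})$; $n=o(m^{1+\varepsilon})$, $m=o(n^{1+\varepsilon})$; and $\frac{(1-2\lambda)^2}{8A}\bigl(1+\frac{5m}{6n}+\frac{5n}{6m}\bigr)\le a\log n$. Let $G$ be a uniformly random element of $\mathcal{B}(\boldsymbol{s},\boldsymbol{t})$. Then (i) the probability that $G$ is edge-disjoint from $H$ is $(1-\lambda)^X\operatorname{miss}(m,n)$, and (ii) the probability that $G$ contains $H$ as a subgraph (i.e. $E(H)\subseteq E(G)$) is $\lambda^X\operatorname{hit}(m,n)$, where \begin{align*} \operatorname{miss}(m,n)=\exp\Bigl(&\frac{\lambda X}{2(1-\lambda)}\Bigl(\frac1n+\frac1m\Bigr)+\frac{\lambda X^2}{2(1-\lambda)mn}-\frac{1}{1-\lambda}\Bigl(\frac{R_{1,1}}{n}+\frac{C_{1,1}}{m}\Bigr)-\frac{Y}{\lambda(1-\lambda)mn}\\ &+\frac{\lambda}{2(1-\lambda)}\Bigl(\frac{R_{0,2}}{n}+\frac{C_{0,2}}{m}\Bigr)+\frac{\lambda(1-2\lambda)}{6(1-\lambda)^2}\Bigl(\frac{R_{0,3}}{n^2}+\frac{C_{0,3}}{m^2}\Bigr)\\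 &-\frac{1-2\lambda}{2(1-\lambda)^2}\Bigl(\frac{R_{1,2}}{n^2}+\frac{C_{1,2}}{m^2}\Bigr)-\frac{1}{2(1-\lambda)^2}\Bigl(\frac{R_{2,1}}{n^2}+\frac{C_{2,1}}{m^2}\Bigr)+O(n^{-b})\Bigr) \end{align*} and \begin{align*} \operatorname{hit}(m,n)=\exp\Bigl(&\frac{(1-\lambda)X}{2\lambda}\Bigl(\frac1n+\frac1m\Bigr)+\frac{(1-\lambda)X^2}{2\lambda mn}+\frac1\lambda\Bigl(\frac{R_{1,1}}{n}+\frac{C_{1,1}}{m}\Bigr)-\frac{1}{2\lambda^2}\Bigl(\frac{R_{2,1}}{n^2}+\frac{C_{2,1}}{m^2}\Bigr)\\ &-\frac{1+\lambda}{2\lambda}\Bigl(\frac{R_{0,2}}{n}+\frac{C_{0,2}}{m}\Bigr)+\frac{1+2\lambda}{2\lambda^2}\Bigl(\frac{R_{1,2}}{n^2}+\frac{C_{1,2}}{m^2}\Bigr)\\ &-\frac{(1+\lambda)(1+2\lambda)}{6\lambda^2}\Bigl(\frac{R_{0,3}}{n^2}+\frac{C_{0,3}}{m^2}\Bigr)-\frac{Y-Y_{0,1}-Y_{1,0}+Y_{1,1}}{\lambda(1-\lambda)mn}+O(n^{-b})\Bigr). \end{align*}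
   Context: Let $\boldsymbol{s}=(s_1,\dots,s_m)$, $\boldsymbol{t}=(t_1,\dots,t_n)$ be vectors of positive integers with equal sums. $\mathcal{B}(\boldsymbol{s},\boldsymbol{t})$ is the set of simple bipartite graphs on $\{u_1,\dots,u_m\}\cup\{v_1,\dots,v_n\}$ (edges only between $u$'s and $v$'s) with $\deg u_j=s_j$, $\deg v_k=t_k$. $H$ is a fixed bipartite graph on the same vertex set, with degrees $x_j$ of $u_j$ and $y_k$ of $v_k$. Define $s=m^{-1}\sum_j s_j$, $t=n^{-1}\sum_k t_k$, $\lambda=s/n=t/m$, $A=\tfrac12\lambda(1-\lambda)$, $\delta_j=s_j-s+\lambda x_j$, $\eta_k=t_k-t+\lambda y_k$, $X=\sum_j x_j$ (the number of edges of $H$), $Y=\sum_{u_jv_k\in E(H)}\delta_j\eta_k$. For nonnegative integers $h,\ell$: $R_{h,\ell}=\sum_{j=1}^m\delta_j^hx_j^\ell$, $C_{h,\ell}=\sum_{k=1}^n\eta_k^hy_k^\ell$. Also $Y_{1,1}=\sum_{u_jv_k\in E(H)}x_jy_k$, $Y_{0,1}=\sum_{u_jv_k\in E(H)}\delta_jy_k$, $Y_{1,0}=\sum_{u_jv_k\in E(H)}x_j\eta_k$. Asymptotic notation refers to $m,n\to\infty$. *)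

(* Defs.v *)
From HB Require Import structures.
From mathcomp Require Import all_boot all_order all_algebra.
From mathcomp Require Import all_classical all_reals all_analysis.
Set Implicit Arguments. Unset Strict Implicit. Unset Printing Implicit Defensive.
Import Order.TTheory GRing.Theory Num.Theory.
Local Open Scope ring_scope.

(* A simple bipartite graph on {u_1..u_m} u {v_1..v_n} (edges only between
   u's and v's) is identified with its edge set, a subset of 'I_m * 'I_n. *)

Definition degu (m n : nat) (G : {set 'I_m * 'I_n}) (j : 'I_m) : nat :=
  #|[set k : 'I_n | (j, k) \in G]|.
Definition degv (m n : nat) (G : {set 'I_m * 'I_n}) (k : 'I_n) : nat :=
  #|[set j : 'I_m | (j, k) \in G]|.

Definition bclass (m n : nat) (s : 'I_m -> nat) (t : 'I_n -> nat)
  : {set {set 'I_m * 'I_n}} :=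
  [set G : {set 'I_m * 'I_n} |
     [forall j, degu G j == s j] && [forall k, degv G k == t k]].

Definition prob_disjoint (R : realType) (m n : nat) (s : 'I_m -> nat)
  (t : 'I_n -> nat) (H : {set 'I_m * 'I_n}) : R :=
  #|[set G in bclass s t | [disjoint G & H]]|%:R / #|bclass s t|%:R.

Definition prob_contains (R : realType) (m n : nat) (s : 'I_m -> nat)
  (t : 'I_n -> nat) (H : {set 'I_m * 'I_n}) : R :=
  #|[set G in bclass s t | H \subset G]|%:R / #|bclass s t|%:R.

Section Params.
Variables (R : realType) (m n : nat) (s : 'I_m -> nat) (t : 'I_n -> nat)
  (H : {set 'I_m * 'I_n}).

Definition savg : R := (\sum_(j < m) (s j)%:R) / m%:R.
Definition tavg : R := (\sum_(k < n) (t k)%:R) / n%:R.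
Definition lam : R := savg / n%:R.
Definition Aconst : R := 2^-1 * lam * (1 - lam).
Definition xd (j : 'I_m) : nat := degu H j.
Definition yd (k : 'I_n) : nat := degv H k.
Definition dlt (j : 'I_m) : R := (s j)%:R - savg + lam * (xd j)%:R.
Definition eta (k : 'I_n) : R := (t k)%:R - tavg + lam * (yd k)%:R.
Definition Xn : nat := (\sum_(j < m) xd j)%N.
Definition Xr : R := Xn%:R.
Definition Ysum : R := \sum_(e in H) dlt e.1 * eta e.2.
Definition Rhl (h l : nat) : R := \sum_(j < m) dlt j ^+ h * (xd j)%:R ^+ l.
Definition Chl (h l : nat) : R := \sum_(k < n) eta k ^+ h * (yd k)%:R ^+ l.
Definition Y11 : R := \sum_(e in H) (xd e.1)%:R * (yd e.2)%:R.
Definition Y01 : R := \sum_(e in H) dlt e.1 * (yd e.2)%:R.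
Definition Y10 : R := \sum_(e in H) (xd e.1)%:R * eta e.2.

Let mr : R := m%:R.
Let nr : R := n%:R.
Let l := lam.

Definition miss_main : R :=
  l * Xr / (2 * (1 - l)) * (1 / nr + 1 / mr)
  + l * Xr ^+ 2 / (2 * (1 - l) * mr * nr)
  - 1 / (1 - l) * (Rhl 1 1 / nr + Chl 1 1 / mr)
  - Ysum / (l * (1 - l) * mr * nr)
  + l / (2 * (1 - l)) * (Rhl 0 2 / nr + Chl 0 2 / mr)
  + l * (1 - 2 * l) / (6 * (1 - l) ^+ 2) * (Rhl 0 3 / nr ^+ 2 + Chl 0 3 / mr ^+ 2)
  - (1 - 2 * l) / (2 * (1 - l) ^+ 2) * (Rhl 1 2 / nr ^+ 2 + Chl 1 2 / mr ^+ 2)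
  - 1 / (2 * (1 - l) ^+ 2) * (Rhl 2 1 / nr ^+ 2 + Chl 2 1 / mr ^+ 2).

Definition hit_main : R :=
  (1 - l) * Xr / (2 * l) * (1 / nr + 1 / mr)
  + (1 - l) * Xr ^+ 2 / (2 * l * mr * nr)
  + 1 / l * (Rhl 1 1 / nr + Chl 1 1 / mr)
  - 1 / (2 * l ^+ 2) * (Rhl 2 1 / nr ^+ 2 + Chl 2 1 / mr ^+ 2)
  - (1 + l) / (2 * l) * (Rhl 0 2 / nr + Chl 0 2 / mr)
  + (1 + 2 * l) / (2 * l ^+ 2) * (Rhl 1 2 / nr ^+ 2 + Chl 1 2 / mr ^+ 2)
  - (1 + l) * (1 + 2 * l) / (6 * l ^+ 2) * (Rhl 0 3 / nr ^+ 2 + Chl 0 3 / mr ^+ 2)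
  - (Ysum - Y01 - Y10 + Y11) / (l * (1 - l) * mr * nr).

End Params.

(* Main.v *)
(** The probability of avoiding (containing) H is a product of conditional probabilities of single edges, so it suffices to know, up to third order terms, the probability that jk is an edge of a random graph conditioned to contain a set I and to avoid a set O of pairs. Switching two edges between the columns k and k' compares the probabilities of jk and jk'; their difference is governed by expected codegrees of the two columns, and these are sums of differences of probabilities of the same kind with one more pair revealed. If all such differences agree with those of an explicit approximation phi up to D, this yields agreement up to D/2 plus third order terms. Iterating this contraction, and using that probabilities and phi have the same row sums, shows that phi is correct to third order. Taking logarithms, the increments of the exponent telescope; the exponent for containing H is the one for avoiding H with lambda replaced by 1 - lambda and the deviations of the degrees negated. The bound on (1-2 lambda)^2/A makes 1/(lambda(1-lambda)) at most O(log n), so all errors are n^(-1/2+O(eps)). *)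

Require Import Defs.
From HB Require Import structures.
From mathcomp Require Import all_boot all_order all_fingroup all_algebra.
From mathcomp Require Import zify ring lra.
Set Implicit Arguments. Unset Strict Implicit. Unset Printing Implicit Defensive.
Import Order.TTheory GRing.Theory Num.Theory.
Local Open Scope ring_scope.

(** * Switchings *)

Section Switch.
Variables (m n : nat).
Implicit Types (G I O H : {set 'I_m * 'I_n}).

(** H has up to n^(1+2 eps) edges, so each single-edge probability is needed up to about n^(-3/2).
    The first order quantities have size w, about n^(-1/2), so the error must be of third order and
    [phi] has to contain all second order terms. The sets I and O are arbitrary because comparing jk
    with jk' leads to states with further revealed pairs. Each of these changes the parameters by at
    most h, which is of order w^2. A round of the contraction reveals four pairs, and of order 1/o
    rounds are made, with o = w / (lambda (1 - lambda))^2; hence all parameters stay below twice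
    their initial bound. The contraction must start from a bound that is already small. This comes
    from mapping graphs with jk but not jk' to graphs with jk' but not jk by switchings. The
    obstacle is a pair of almost equal columns, which admits few switchings; the share of such
    graphs is bounded by an inverse moment, itself estimated by switchings with a third column. All
    probabilities are quotients by the number of graphs, so the class must also be shown to be
    nonempty; this is done by moving edges along short alternating paths. *)

Lemma degu_sum G j : degu G j = (\sum_(k < n) ((j, k) \in G))%N.
Proof. by rewrite /degu -sum1_card big_mkcond /=; apply: eq_bigr => k _; rewrite inE; case: (_ \in _). Qed.

Lemma degv_sum G k : degv G k = (\sum_(j < m) ((j, k) \in G))%N.
Proof. by rewrite /degv -sum1_card big_mkcond /=; apply: eq_bigr => j _; rewrite inE; case: (_ \in _). Qed.

(* The switch at rows j1, j2 exchanges columns k1 and k2 within both rows. On a checkerboard it also exchanges the two rows within both columns, hence preserves all degrees. *)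
Definition swe (j1 j2 : 'I_m) (k1 k2 : 'I_n) (e : 'I_m * 'I_n) :=
  (e.1, if e.1 \in pred2 j1 j2 then tperm k1 k2 e.2 else e.2).
Definition sw j1 j2 k1 k2 G := [set e | swe j1 j2 k1 k2 e \in G].

Definition chk (j1 j2 : 'I_m) (k1 k2 : 'I_n) G :=
  [&& (j1, k1) \in G, (j2, k2) \in G, (j1, k2) \notin G & (j2, k1) \notin G].

Lemma sweK j1 j2 k1 k2 : involutive (swe j1 j2 k1 k2).
Proof. by case=> j k; rewrite /swe /=; case: ifP => jP /=; rewrite jP ?tpermK. Qed.

Lemma swK j1 j2 k1 k2 : involutive (sw j1 j2 k1 k2).
Proof. by move=> G; apply/setP=> e; rewrite !inE sweK. Qed.

Lemma chk_sw j1 j2 k1 k2 G : chk j1 j2 k1 k2 (sw j1 j2 k1 k2 G) = chk j1 j2 k2 k1 G.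
Proof.
by rewrite /chk !inE /swe /= !inE !eqxx ?orbT /= !tpermL !tpermR.
Qed.

Lemma swC j1 j2 k1 k2 G : sw j1 j2 k1 k2 G = sw j1 j2 k2 k1 G.
Proof. by apply/setP=> e; rewrite !inE /swe tpermC. Qed.

Lemma sw_out j1 j2 k1 k2 G j k :
  (j \notin pred2 j1 j2) || (k \notin pred2 k1 k2) ->
  ((j, k) \in sw j1 j2 k1 k2 G) = ((j, k) \in G).
Proof.
rewrite [LHS]inE /swe; case: (j \in pred2 j1 j2) => //=.
by rewrite !inE negb_or => /andP[/negPf a /negPf b]; rewrite tpermD 1?eq_sym ?a ?b.
Qed.

Lemma chk_neq j1 j2 k1 k2 G : chk j1 j2 k1 k2 G -> (j1 != j2) && (k1 != k2).
Proof.
case/and4P=> a b c d; apply/andP; split.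
  by apply: contraNneq d => <-.
by apply: contraNneq c => <-.
Qed.

Lemma degu_sw j1 j2 k1 k2 G j : degu (sw j1 j2 k1 k2 G) j = degu G j.
Proof.
rewrite !degu_sum; case: (boolP (j \in pred2 j1 j2)) => jP.
  rewrite [RHS](reindex_inj (@perm_inj _ (tperm k1 k2))).
  by apply: eq_bigr => k _; rewrite inE /swe /= jP.
by apply: eq_bigr => k _; rewrite sw_out ?jP.
Qed.

Lemma sw_col j1 j2 k1 k2 G j k : chk j1 j2 k1 k2 G -> k \in pred2 k1 k2 ->
  ((j, k) \in sw j1 j2 k1 k2 G) = ((tperm j1 j2 j, k) \in G).
Proof.
case/and4P=> a b c d; rewrite !inE /swe /=.
case/orP=> /eqP ->; case: (tpermP j1 j2 j) => [->|->|/eqP/negPf N1 /eqP/negPf N2]; rewrite !inE ?eqxx ?orbT ?N1 ?N2 //= ?tpermL ?tpermR ?a ?b ?(negPf c) ?(negPf d) //.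
Qed.

Lemma degv_sw j1 j2 k1 k2 G k : chk j1 j2 k1 k2 G ->
  degv (sw j1 j2 k1 k2 G) k = degv G k.
Proof.
move=> cG; rewrite !degv_sum; case: (boolP (k \in pred2 k1 k2)) => kP.
  rewrite [RHS](reindex_inj (@perm_inj _ (tperm j1 j2))).
  by apply: eq_bigr => j _; rewrite sw_col.
by apply: eq_bigr => j _; rewrite sw_out ?kP ?orbT.
Qed.

Lemma sw_on j1 j2 k1 k2 G :
  [/\ ((j1, k1) \in sw j1 j2 k1 k2 G) = ((j1, k2) \in G),
      ((j1, k2) \in sw j1 j2 k1 k2 G) = ((j1, k1) \in G),
      ((j2, k1) \in sw j1 j2 k1 k2 G) = ((j2, k2) \in G) &
      ((j2, k2) \in sw j1 j2 k1 k2 G) = ((j2, k1) \in G)].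
Proof. by split; rewrite inE /swe /= !inE eqxx ?orbT ?tpermL ?tpermR. Qed.

Variables (s : 'I_m -> nat) (t : 'I_n -> nat).

Definition Om I O := [set G in bclass s t | (I \subset G) && [disjoint G & O]].

Definition free j1 j2 k1 k2 H :=
  [&& (j1, k1) \notin H, (j1, k2) \notin H, (j2, k1) \notin H & (j2, k2) \notin H].

Lemma OmP I O G : reflect [/\ forall j, degu G j = s j, forall k, degv G k = t k,
  {subset I <= G} & forall e, e \in G -> e \notin O] (G \in Om I O).
Proof.
rewrite !inE; apply: (iffP idP).
  case/andP=> /andP[/forallP a /forallP b] /andP[/subsetP c].
  rewrite disjoint_subset => /subsetP d; split => // x; [exact/eqP/a|exact/eqP/b].
case=> a b c d; rewrite disjoint_subset; apply/and3P; split.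
- by apply/andP; split; apply/forallP => x; rewrite ?a ?b.
- exact/subsetP.
- by apply/subsetP => e /d.
Qed.

Lemma free_sw j1 j2 k1 k2 G H e : free j1 j2 k1 k2 H -> e \in H ->
  (e \in sw j1 j2 k1 k2 G) = (e \in G).
Proof.
case: e => j k /and4P[a b c d] eH; apply: sw_out; rewrite !inE -negb_and.
apply: contraL eH => /andP[/orP[/eqP->|/eqP->] /orP[/eqP->|/eqP->]] //.
Qed.

Lemma sw_Om j1 j2 k1 k2 I O G : free j1 j2 k1 k2 (I :|: O) -> chk j1 j2 k1 k2 G ->
  (sw j1 j2 k1 k2 G \in Om I O) = (G \in Om I O).
Proof.
move=> fH cG.
have imp G' : chk j1 j2 k1 k2 G' || chk j1 j2 k2 k1 G' -> G' \in Om I O -> sw j1 j2 k1 k2 G' \in Om I O.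
  move=> cG' /OmP[a b c d]; apply/OmP; split.
  - by move=> j; rewrite degu_sw.
  - by move=> k; case/orP: cG' => cG'; [|rewrite swC]; rewrite degv_sw.
  - by move=> e eI; rewrite (free_sw _ fH) ?c // inE eI.
  - move=> e eG'; apply/negP => eO; move: eG'; rewrite (free_sw _ fH) ?inE ?eO ?orbT //.
    by move/d; rewrite eO.
apply/idP/idP; last by apply: imp; rewrite cG.
by move/imp; rewrite swK; apply; rewrite swC chk_sw -swC cG orbT.
Qed.

(** Change of variables along the switch. It is an involution that exchanges the two orientations of
    a checkerboard, and it respects I and O because the four pairs concerned are unrevealed. All
    switching arguments below are instances. *)
Lemma sum_sw (V : nmodType) j1 j2 k1 k2 I O (P : pred {set 'I_m * 'I_n}) (f : {set 'I_m * 'I_n} -> V) :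
  free j1 j2 k1 k2 (I :|: O) ->
  \sum_(G in Om I O | chk j1 j2 k1 k2 G && P G) f G =
  \sum_(G in Om I O | chk j1 j2 k2 k1 G && P (sw j1 j2 k1 k2 G)) f (sw j1 j2 k1 k2 G).
Proof.
move=> fH; rewrite (reindex_inj (inv_inj (@swK j1 j2 k1 k2))) /=.
apply: eq_bigl => G; rewrite chk_sw.
case: (boolP (chk j1 j2 k2 k1 G)) => cG; last by rewrite !andbF.
by rewrite swC sw_Om // /free; move: fH; rewrite /free => /and4P[-> -> -> ->].
Qed.

End Switch.

(** * Averages over a state *)

Section Expectation.
Variables (R : realFieldType) (m n : nat) (s : 'I_m -> nat) (t : 'I_n -> nat).
Implicit Types (G I O H : {set 'I_m * 'I_n}) (e : 'I_m * 'I_n).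
Implicit Types (f g : {set 'I_m * 'I_n} -> R).
Local Notation Om := (Om s t).

(* A state (I, O) is the set of graphs that contain I and avoid O; [Ex] and [pr] are with respect to the uniform measure on it (and 0 if the state is empty). *)
Definition cnt I O : R := #|Om I O|%:R.
Definition Ex I O f : R := (\sum_(G in Om I O) f G) / cnt I O.
Definition pr I O e : R := Ex I O (fun G => (e \in G)%:R).

Lemma cnt_ge0 I O : 0 <= cnt I O. Proof. exact: ler0n. Qed.
Hint Resolve cnt_ge0 : core.

Lemma Om_in I O e : Om (e |: I) O = [set G in Om I O | e \in G].
Proof.
apply/setP => G; rewrite !inE subUset sub1set.
by case: (e \in G); rewrite ?andbT ?andbF.
Qed.

Lemma Om_out I O e : Om I (e |: O) = [set G in Om I O | e \notin G].
Proof.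
apply/setP => G; rewrite !inE !disjoints_subset setCU subsetI.
rewrite -[G \subset ~: [set e]]disjoints_subset disjoint_sym disjoints1.
by case: (e \in G); rewrite ?andbT ?andbF.
Qed.

Lemma sum_in (V : nmodType) I O e (f : _ -> V) :
  \sum_(G in Om (e |: I) O) f G = \sum_(G in Om I O | e \in G) f G.
Proof. by apply: eq_bigl => G; rewrite Om_in !inE. Qed.

Lemma sum_out (V : nmodType) I O e (f : _ -> V) :
  \sum_(G in Om I (e |: O)) f G = \sum_(G in Om I O | e \notin G) f G.
Proof. by apply: eq_bigl => G; rewrite Om_out !inE. Qed.

Lemma cnt_sum I O : cnt I O = \sum_(G in Om I O) 1.
Proof. by rewrite /cnt -sum1_card natr_sum. Qed.

Lemma cnt_split I O e : cnt I O = cnt (e |: I) O + cnt I (e |: O).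
Proof. by rewrite !cnt_sum (sum_in _ _ _ (fun=> 1)) (sum_out _ _ _ (fun=> 1)) (bigID (fun G => e \in G)). Qed.

Lemma prE I O e : pr I O e = cnt (e |: I) O / cnt I O.
Proof.
rewrite /pr /Ex [cnt (_ |: _) _]cnt_sum (sum_in _ _ _ (fun=> 1)) [in RHS]big_mkcondr /=; congr (_ / _).
by apply: eq_bigr => G _; case: (e \in G).
Qed.

Lemma pr_out I O e : 0 < cnt I O -> 1 - pr I O e = cnt I (e |: O) / cnt I O.
Proof.
move=> c0; have c1 := lt0r_neq0 c0.
rewrite prE -[1](divff c1) -mulrBl; congr (_ / _).
by rewrite (cnt_split I O e) addrC addKr.
Qed.

Lemma pr_ge0 I O e : 0 <= pr I O e.
Proof. by rewrite prE divr_ge0. Qed.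

Lemma pr_le1 I O e : pr I O e <= 1.
Proof.
have [c0|] := boolP (0 < cnt I O); first by rewrite -subr_ge0 pr_out // divr_ge0.
by rewrite lt_neqAle cnt_ge0 andbT negbK eq_sym => /eqP c0; rewrite prE c0 invr0 mulr0.
Qed.

Lemma ExD I O f g : Ex I O (fun G => f G + g G) = Ex I O f + Ex I O g.
Proof. by rewrite /Ex big_split mulrDl. Qed.

Lemma ExN I O f : Ex I O (fun G => - f G) = - Ex I O f.
Proof. by rewrite /Ex sumrN mulNr. Qed.

Lemma ExB I O f g : Ex I O (fun G => f G - g G) = Ex I O f - Ex I O g.
Proof. by rewrite ExD ExN. Qed.

Lemma ExZ I O c f : Ex I O (fun G => c * f G) = c * Ex I O f.
Proof. by rewrite /Ex -mulr_sumr mulrA. Qed.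

Lemma Ex_sum (T : finType) (P : pred T) I O (F : T -> _ -> R) :
  Ex I O (fun G => \sum_(i | P i) F i G) = \sum_(i | P i) Ex I O (F i).
Proof. by rewrite /Ex exchange_big mulr_suml. Qed.

Lemma eq_Ex I O f g : {in Om I O, f =1 g} -> Ex I O f = Ex I O g.
Proof. by move=> fg; rewrite /Ex; congr (_ / _); apply: eq_bigr. Qed.

Lemma le_Ex I O f g : (forall G, G \in Om I O -> f G <= g G) -> Ex I O f <= Ex I O g.
Proof. by move=> fg; rewrite /Ex ler_wpM2r ?invr_ge0 //; apply: ler_sum. Qed.

Lemma Ex_cst I O c : 0 < cnt I O -> Ex I O (fun _ => c) = c.
Proof.
move=> c0; rewrite /Ex big_const iter_addr_0 -(mulr_natr c) mulfK //.
exact: lt0r_neq0.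
Qed.

Lemma Ex_bound I O a b f : 0 < cnt I O -> (forall G, G \in Om I O -> a <= f G <= b) ->
  a <= Ex I O f <= b.
Proof.
move=> c0 ab; apply/andP; split; [rewrite -[leLHS](Ex_cst a c0)|rewrite -[leRHS](Ex_cst b c0)].
  by apply: le_Ex => G /ab /andP[].
by apply: le_Ex => G /ab /andP[].
Qed.

Lemma Ex_in I O e f :
  Ex I O (fun G => (e \in G)%:R * f G) = pr I O e * Ex (e |: I) O f.
Proof.
rewrite prE /Ex mulrACA [_^-1 * _]mulrC mulrA.
have -> : \sum_(G in Om I O) (e \in G)%:R * f G = \sum_(G in Om (e |: I) O) f G.
  rewrite sum_in big_mkcondr; apply: eq_bigr => G _.
  by case: (e \in G); rewrite ?mul1r ?mul0r.
(* If no graph of the state contains e, both sides are 0, since division by 0 gives 0. *)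
have [c0|c0] := eqVneq (cnt (e |: I) O) 0.
  rewrite c0 !mul0r big1 ?mul0r // => G GO; exfalso.
  by move/eqP: c0; rewrite pnatr_eq0 cards_eq0 => /eqP E; rewrite E inE in GO.
by rewrite [cnt _ _ * _]mulrC mulfK.
Qed.

Lemma Ex_out I O e f : 0 < cnt I O ->
  Ex I O (fun G => (e \notin G)%:R * f G) = (1 - pr I O e) * Ex I (e |: O) f.
Proof.
move=> cp; rewrite pr_out // /Ex mulrACA [_^-1 * _]mulrC mulrA.
have -> : \sum_(G in Om I O) (e \notin G)%:R * f G = \sum_(G in Om I (e |: O)) f G.
  rewrite sum_out big_mkcondr; apply: eq_bigr => G _.
  by case: (e \in G); rewrite ?mul1r ?mul0r.
have [c0|c0] := eqVneq (cnt I (e |: O)) 0.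
  rewrite c0 !mul0r big1 ?mul0r // => G GO; exfalso.
  by move/eqP: c0; rewrite pnatr_eq0 cards_eq0 => /eqP E; rewrite E inE in GO.
by rewrite [cnt _ _ * _]mulrC mulfK.
Qed.

End Expectation.

(** * The parameters of a state *)

Section StateParams.
Variables (R : realFieldType) (m n : nat) (s : 'I_m -> nat) (t : 'I_n -> nat) (l : R).
Implicit Types (G I O H : {set 'I_m * 'I_n}) (e : 'I_m * 'I_n).

(* With H = I :|: O the revealed pairs, [uu] and [vv] are the excesses over density [l] of the degrees still to be realised outside H, [xi] and [ze] the proportions of revealed pairs, all normalised to be of order [w]; [sg], [th], [ph] are of order [w ^+ 2]. [phi] is the value of [pr] correct up to third order terms. *)
Definition uu I O j : R :=
  ((s j)%:R - (degu I j)%:R - l * (n%:R - (degu (I :|: O) j)%:R)) / n%:R.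
Definition vv I O k : R :=
  ((t k)%:R - (degv I k)%:R - l * (m%:R - (degv (I :|: O) k)%:R)) / m%:R.
Definition xi I O j : R := (degu (I :|: O) j)%:R / n%:R.
Definition ze I O k : R := (degv (I :|: O) k)%:R / m%:R.
Definition sg I O : R := (\sum_j uu I O j) / m%:R.
Definition th I O k : R := (\sum_(j | (j, k) \in I :|: O) uu I O j) / m%:R.
Definition ph I O j : R := (\sum_(k | (j, k) \in I :|: O) vv I O k) / n%:R.
Definition kap : R := (1 - 2 * l) / (l * (1 - l)).
(** The product term is the mixed second order term of a logistic model, in which the log-odds of jk
    is a row part plus a column part. The other corrections are forced by the degrees: [uu * xi]
    spreads the excess of row j over its unrevealed pairs only, and [- sg + ph] cancels the sum of
    [vv] over these pairs; likewise for columns. *)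
Definition phi I O j k : R :=
  l + uu I O j + vv I O k - sg I O + uu I O j * xi I O j + vv I O k * ze I O k
  + kap * uu I O j * vv I O k + ph I O j + th I O k.

(** [g_sg] is a separate requirement because a mean of quantities of order w need not have order
    [w ^+ 2]. [g_H] says that revealed pairs are rare on the whole, which makes sums of [ze] over
    all columns small. *)
Record good (w : R) I O : Prop := Good {
  g_dis : [disjoint I & O];
  g_u : forall j, `|uu I O j| <= w;
  g_x : forall j, xi I O j <= w;
  g_v : forall k, `|vv I O k| <= w;
  g_z : forall k, ze I O k <= w;
  g_sg : `|sg I O| <= w ^+ 2;
  g_H : #|I :|: O|%:R <= w ^+ 2 * (m%:R * n%:R) }.

Lemma degu_add G e j : e \notin G -> degu (e |: G) j = (degu G j + (j == e.1))%N.
Proof.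
move=> eG; case: e eG => j0 k0 eG; rewrite !degu_sum /=.
case: (eqVneq j j0) => [->|jj].
  rewrite (bigD1 k0) //= [in RHS](bigD1 k0) //= (negPf eG) !inE eqxx /= add0n addnC; congr (_ + _)%N.
  by apply: eq_bigr => k kk; rewrite !inE xpair_eqE (negPf kk) andbF.
by rewrite addn0; apply: eq_bigr => k _; rewrite !inE xpair_eqE (negPf jj).
Qed.

Lemma degv_add G e k : e \notin G -> degv (e |: G) k = (degv G k + (k == e.2))%N.
Proof.
move=> eG; case: e eG => j0 k0 eG; rewrite !degv_sum /=.
case: (eqVneq k k0) => [->|jj].
  rewrite (bigD1 j0) //= [in RHS](bigD1 j0) //= (negPf eG) !inE eqxx /= add0n addnC; congr (_ + _)%N.
  by apply: eq_bigr => j kk; rewrite !inE xpair_eqE (negPf kk).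
by rewrite addn0; apply: eq_bigr => j _; rewrite !inE xpair_eqE (negPf jj) andbF.
Qed.

Lemma sum_degu G : (\sum_j degu G j)%N = #|G|.
Proof.
rewrite (eq_bigr _ (fun j _ => degu_sum G j)) pair_big /= -sum1_card [RHS]big_mkcond /=.
by apply: eq_bigr => -[j k] _ /=; case: (_ \in _).
Qed.

Lemma sum_degv G : (\sum_k degv G k)%N = #|G|.
Proof.
rewrite (eq_bigr _ (fun j _ => degv_sum G j)) exchange_big pair_big /= -sum1_card [RHS]big_mkcond /=.
by apply: eq_bigr => -[j k] _ /=; case: (_ \in _).
Qed.

Lemma UI e I O : (e |: I) :|: O = e |: (I :|: O). Proof. by rewrite setUA. Qed.
Lemma UO e I O : I :|: (e |: O) = e |: (I :|: O). Proof. by rewrite setUCA. Qed.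

Lemma notinU e I O : e \notin I :|: O -> e \notin I /\ e \notin O.
Proof. by rewrite inE negb_or => /andP. Qed.

Hypothesis (n0 : (0 < n)%N) (m0 : (0 < m)%N).
Let nR : n%:R != 0 :> R. Proof. by rewrite pnatr_eq0 -lt0n. Qed.
Let mR : m%:R != 0 :> R. Proof. by rewrite pnatr_eq0 -lt0n. Qed.

Lemma xi_in e I O j : e \notin I :|: O -> xi (e |: I) O j = xi I O j + (j == e.1)%:R / n%:R.
Proof. by move=> eH; rewrite /xi UI degu_add // natrD mulrDl. Qed.
Lemma xi_out e I O j : e \notin I :|: O -> xi I (e |: O) j = xi I O j + (j == e.1)%:R / n%:R.
Proof. by move=> eH; rewrite /xi UO degu_add // natrD mulrDl. Qed.
Lemma ze_in e I O k : e \notin I :|: O -> ze (e |: I) O k = ze I O k + (k == e.2)%:R / m%:R.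
Proof. by move=> eH; rewrite /ze UI degv_add // natrD mulrDl. Qed.
Lemma ze_out e I O k : e \notin I :|: O -> ze I (e |: O) k = ze I O k + (k == e.2)%:R / m%:R.
Proof. by move=> eH; rewrite /ze UO degv_add // natrD mulrDl. Qed.

Lemma uu_in e I O j : e \notin I :|: O ->
  uu (e |: I) O j = uu I O j - (j == e.1)%:R * (1 - l) / n%:R.
Proof.
move=> eH; have [eI _] := notinU eH.
by rewrite /uu UI !degu_add // !natrD; field.
Qed.
Lemma uu_out e I O j : e \notin I :|: O ->
  uu I (e |: O) j = uu I O j + (j == e.1)%:R * l / n%:R.
Proof. by move=> eH; rewrite /uu UO !degu_add // !natrD; field. Qed.
Lemma vv_in e I O k : e \notin I :|: O ->
  vv (e |: I) O k = vv I O k - (k == e.2)%:R * (1 - l) / m%:R.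
Proof.
move=> eH; have [eI _] := notinU eH.
by rewrite /vv UI !degv_add // !natrD; field.
Qed.
Lemma vv_out e I O k : e \notin I :|: O ->
  vv I (e |: O) k = vv I O k + (k == e.2)%:R * l / m%:R.
Proof. by move=> eH; rewrite /vv UO !degv_add // !natrD; field. Qed.

Lemma sgE I O : sg I O = ((\sum_j s j)%N%:R - #|I|%:R - l * (m%:R * n%:R - #|I :|: O|%:R)) / (m%:R * n%:R).
Proof.
rewrite /sg /uu -mulr_suml !sumrB -mulr_sumr sumrB sumr_const card_ord.
rewrite -!natr_sum !sum_degu -[n%:R *+ m]mulr_natl; field.
by rewrite nR mR.
Qed.

Hypothesis st : (\sum_j s j = \sum_k t k)%N.

(** Since the two degree sums agree, the mean row excess is also the mean column excess. This makes
    [phi] symmetric under exchange of rows and columns. *)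
Lemma sgE' I O : sg I O = (\sum_k vv I O k) / n%:R.
Proof.
rewrite sgE st /vv -mulr_suml !sumrB -mulr_sumr sumrB sumr_const card_ord.
rewrite -!natr_sum !sum_degv -[m%:R *+ n]mulr_natl; field.
by rewrite nR mR.
Qed.

Lemma sg_in e I O : e \notin I :|: O -> sg (e |: I) O = sg I O - (1 - l) / (m%:R * n%:R).
Proof.
move=> eH; have [eI _] := notinU eH.
by rewrite !sgE UI !cardsU1 eI eH !natrD /=; field; rewrite nR mR.
Qed.
Lemma sg_out e I O : e \notin I :|: O -> sg I (e |: O) = sg I O + l / (m%:R * n%:R).
Proof. by move=> eH; rewrite !sgE UO !cardsU1 eH !natrD /=; field; rewrite nR mR. Qed.

Variable (h : R).
Hypotheses (l01 : 0 < l < 1) (hm : 1 <= h * m%:R) (hn : 1 <= h * n%:R).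

Let n1 : 0 < n%:R :> R. Proof. by rewrite ltr0n. Qed.
Let m1 : 0 < m%:R :> R. Proof. by rewrite ltr0n. Qed.
Lemma h_n : n%:R^-1 <= h. Proof. by rewrite -(mul1r n%:R^-1) ler_pdivrMr. Qed.
Lemma h_m : m%:R^-1 <= h. Proof. by rewrite -(mul1r m%:R^-1) ler_pdivrMr. Qed.
Lemma h_mn : (m%:R * n%:R)^-1 <= h ^+ 2.
Proof. by rewrite invfM expr2 ler_pM ?invr_ge0 ?ler0n ?h_n ?h_m. Qed.
Lemma h_gt0 : 0 < h. Proof. by apply: lt_le_trans h_n; rewrite invr_gt0. Qed.

Let bnd (b : bool) (c y x w : R) : 0 <= c <= 1 -> 0 <= y <= h -> `|x| <= w -> `|x + b%:R * c * y| <= w + h.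
Proof. by move=> /andP[c0 c1] /andP[y0 yh]; rewrite !ler_norml; case: b => /=; nra. Qed.
Let bndN (b : bool) (c y x w : R) : 0 <= c <= 1 -> 0 <= y <= h -> `|x| <= w -> `|x - b%:R * c * y| <= w + h.
Proof. by move=> /andP[c0 c1] /andP[y0 yh]; rewrite !ler_norml; case: b => /=; nra. Qed.

Lemma gH_step (w a : R) : 0 <= w -> a <= w ^+ 2 * (m%:R * n%:R) -> 1 + a <= (w + h) ^+ 2 * (m%:R * n%:R).
Proof.
move=> w0 aw; rewrite sqrrD !mulrDl.
have h0 := h_gt0.
have : 1 <= h ^+ 2 * (m%:R * n%:R).
  by rewrite -ler_pdivrMr ?mulr_gt0 // mul1r h_mn.
have : 0 <= (w * h *+ 2) * (m%:R * n%:R) by rewrite !mulr_ge0 ?mulrn_wge0 ?mulr_ge0 // ltW.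
lra.
Qed.

Let l0 : 0 <= l <= 1. Proof. by move/andP: l01 => [a b]; rewrite !ltW. Qed.
Let l1 : 0 <= 1 - l <= 1. Proof. by move/andP: l0 => [a b]; apply/andP; split; lra. Qed.
Let nh : (0 : R) <= n%:R^-1 <= h. Proof. by rewrite h_n invr_ge0 ltW. Qed.
Let mh : (0 : R) <= m%:R^-1 <= h. Proof. by rewrite h_m invr_ge0 ltW. Qed.

Lemma gsg_step (w y c : R) : 0 <= w -> 0 <= c <= 1 -> `|y| <= w ^+ 2 ->
  `|y + c / (m%:R * n%:R)| <= (w + h) ^+ 2 /\ `|y - c / (m%:R * n%:R)| <= (w + h) ^+ 2.
Proof.
move=> w0 /andP[c0 c1]; have := h_mn; have h0 := h_gt0.
have : 0 <= (m%:R * n%:R)^-1 :> R by rewrite invr_ge0 mulr_ge0 ?ler0n.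
move: (_^-1) => z z0 zh; rewrite !ler_norml => /andP[a b].
have : 0 <= w * h by rewrite mulr_ge0 // ltW.
by split; nra.
Qed.

(** A revealed pair changes one row and one column, by at most 1/n and 1/m after normalisation, and
    [h] bounds both. So the size bound grows by [h] per revealed pair. *)
Lemma good_in w e I O : 0 <= w -> good w I O -> e \notin I :|: O -> good (w + h) (e |: I) O.
Proof.
move=> w0 [d gu gx gv gz gs gH] eH; have [eI eO] := notinU eH; split.
- by rewrite disjoint_sym disjoints_subset setCU subsetI -!disjoints_subset !(disjoint_sym O) d disjoints1 eO.
- by move=> j; rewrite uu_in //; apply: bndN.
- move=> j; rewrite xi_in // lerD //; have := h_n; have := h_gt0; case: eqP => _; rewrite ?mul1r ?mul0r //; lra.
- by move=> j; rewrite vv_in //; apply: bndN.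
- move=> j; rewrite ze_in // lerD //; have := h_m; have := h_gt0; case: eqP => _; rewrite ?mul1r ?mul0r //; lra.
- by rewrite sg_in //; case: (gsg_step w0 l1 gs).
- by rewrite UI cardsU1 eH natrD; exact: gH_step.
Qed.

Lemma good_out w e I O : 0 <= w -> good w I O -> e \notin I :|: O -> good (w + h) I (e |: O).
Proof.
move=> w0 [d gu gx gv gz gs gH] eH; have [eI eO] := notinU eH; split.
- by rewrite disjoints_subset setCU subsetI -!disjoints_subset d disjoint_sym disjoints1 eI.
- by move=> j; rewrite uu_out //; apply: bnd.
- move=> j; rewrite xi_out // lerD //; have := h_n; have := h_gt0; case: eqP => _; rewrite ?mul1r ?mul0r //; lra.
- by move=> j; rewrite vv_out //; apply: bnd.
- move=> j; rewrite ze_out // lerD //; have := h_m; have := h_gt0; case: eqP => _; rewrite ?mul1r ?mul0r //; lra.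
- by rewrite sg_out //; case: (gsg_step w0 l0 gs).
- by rewrite UO cardsU1 eH natrD; exact: gH_step.
Qed.

End StateParams.

(** * Exchange of rows and columns *)

Section Transposition.
Variables (R : realFieldType) (m n : nat).
Implicit Types (G I O H : {set 'I_m * 'I_n}).

Definition tr (m n : nat) (G : {set 'I_m * 'I_n}) : {set 'I_n * 'I_m} := [set e | (e.2, e.1) \in G].

Lemma in_tr G j k : ((k, j) \in tr G) = ((j, k) \in G). Proof. by rewrite inE. Qed.
Lemma trK : cancel (@tr m n) (@tr n m). Proof. by move=> G; apply/setP => -[j k]; rewrite !inE. Qed.
Lemma degu_tr G k : degu (tr G) k = degv G k.
Proof. by rewrite degu_sum degv_sum; apply: eq_bigr => j _; rewrite in_tr. Qed.
Lemma degv_tr G j : degv (tr G) j = degu G j.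
Proof. by rewrite degu_sum degv_sum; apply: eq_bigr => k _; rewrite in_tr. Qed.
Lemma trU I O : tr (I :|: O) = tr I :|: tr O. Proof. by apply/setP => e; rewrite !inE. Qed.
Lemma trU1 j k G : tr ((j, k) |: G) = (k, j) |: tr G.
Proof. by apply/setP => -[k' j']; rewrite !inE !xpair_eqE andbC. Qed.
Lemma card_tr G : #|tr G| = #|G|.
Proof. by rewrite -!sum_degu (eq_bigr _ (fun k _ => degu_tr G k)) sum_degv sum_degu. Qed.
End Transposition.

Section Transposition2.
Variables (R : realFieldType) (m n : nat) (s : 'I_m -> nat) (t : 'I_n -> nat) (l : R).
Implicit Types (G I O H : {set 'I_m * 'I_n}).

Lemma tr_Om I O G : (tr G \in Om t s (tr I) (tr O)) = (G \in Om s t I O).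
Proof.
apply/OmP/OmP => -[a b c d]; split.
- by move=> j; rewrite -degv_tr b.
- by move=> k; rewrite -degu_tr a.
- by move=> [j k] jI; rewrite -in_tr; apply: c; rewrite in_tr.
- by move=> [j k] jG; rewrite -in_tr; apply: d; rewrite in_tr.
- by move=> k; rewrite degu_tr b.
- by move=> j; rewrite degv_tr a.
- by move=> [k j]; rewrite in_tr => /c; rewrite in_tr.
- by move=> [k j]; rewrite !in_tr => /d.
Qed.

Lemma cnt_tr I O : cnt R t s (tr I) (tr O) = cnt R s t I O.
Proof.
rewrite /cnt; congr (_%:R); rewrite -(card_imset _ (can_inj (@trK n m))).
apply: eq_card => G; apply/imsetP/idP.
  by case=> G' GO ->; rewrite -tr_Om trK.
by move=> GO; exists (tr G); rewrite ?trK // tr_Om.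
Qed.

Lemma pr_tr I O j k : pr R t s (tr I) (tr O) (k, j) = pr R s t I O (j, k).
Proof. by rewrite !prE -trU1 !cnt_tr. Qed.

Lemma uu_tr I O k : uu t l (tr I) (tr O) k = vv t l I O k.
Proof. by rewrite /uu /vv -trU !degu_tr. Qed.
Lemma vv_tr I O j : vv s l (tr I) (tr O) j = uu s l I O j.
Proof. by rewrite /uu /vv -trU !degv_tr. Qed.
Lemma xi_tr I O k : xi R (tr I) (tr O) k = ze R I O k.
Proof. by rewrite /xi /ze -trU !degu_tr. Qed.
Lemma ze_tr I O k : ze R (tr I) (tr O) k = xi R I O k.
Proof. by rewrite /xi /ze -trU !degv_tr. Qed.

Hypothesis (n0 : (0 < n)%N) (m0 : (0 < m)%N) (st : (\sum_j s j = \sum_k t k)%N).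

Lemma sg_tr I O : sg t l (tr I) (tr O) = sg s l I O.
Proof. by rewrite (sgE' l _ _ st) // /sg; congr (_ / _); apply: eq_bigr => k _; rewrite uu_tr. Qed.

Lemma phi_tr I O j k : phi t s l (tr I) (tr O) k j = phi s t l I O j k.
Proof.
have E1 : ph s l (tr I) (tr O) k = th s l I O k.
  rewrite /ph /th -trU; congr (_ / _); apply: eq_big => x; first by rewrite in_tr.
  by rewrite vv_tr.
have E2 : th t l (tr I) (tr O) j = ph t l I O j.
  rewrite /ph /th -trU; congr (_ / _); apply: eq_big => x; first by rewrite in_tr.
  by rewrite uu_tr.
by rewrite /phi E1 E2 sg_tr uu_tr vv_tr xi_tr ze_tr; ring.
Qed.

Lemma good_tr w I O : good s t l w I O -> good t s l w (tr I) (tr O).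
Proof.
case=> d gu gx gv gz gs gH; split.
- rewrite disjoints_subset; apply/subsetP => -[k j]; rewrite !inE => jI.
  by rewrite (disjointFr d jI).
- by move=> k; rewrite uu_tr.
- by move=> k; rewrite xi_tr.
- by move=> k; rewrite vv_tr.
- by move=> k; rewrite ze_tr.
- by rewrite sg_tr.
- by rewrite -trU card_tr mulrC [m%:R * _]mulrC in gH *; rewrite mulrC.
Qed.
End Transposition2.

(** * Codegrees *)

Section Codegree.
Variables (R : realFieldType) (m n : nat) (s : 'I_m -> nat) (t : 'I_n -> nat) (l : R).
Implicit Types (G I O H : {set 'I_m * 'I_n}) (e : 'I_m * 'I_n).
Local Notation Om := (Om s t).
Local Notation cnt := (cnt R s t).
Hypothesis (n0 : (0 < n)%N) (m0 : (0 < m)%N).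

Let nR : n%:R != 0 :> R. Proof. by rewrite pnatr_eq0 -lt0n. Qed.
Let mR : m%:R != 0 :> R. Proof. by rewrite pnatr_eq0 -lt0n. Qed.
Let n1 : 0 < n%:R :> R. Proof. by rewrite ltr0n. Qed.
Let m1 : 0 < m%:R :> R. Proof. by rewrite ltr0n. Qed.

Lemma Om_H I O G e : G \in Om I O -> e \in I :|: O -> (e \in G) = (e \in I).
Proof.
move=> /OmP[_ _ c d]; rewrite inE; case: (boolP (e \in I)) => [/c -> //|_ /= eO].
by apply/negP => /d; rewrite eO.
Qed.

(** The degrees determine how many unrevealed pairs of a column are edges, so the sum is the same
    for all graphs of the state. *)
Lemma col_sum I O G k : G \in Om I O ->
  \sum_(j | (j, k) \notin I :|: O) ((j, k) \in G)%:R = m%:R * (vv t l I O k + l * (1 - ze R I O k)).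
Proof.
move=> GO; have /OmP[_ b _ _] := GO.
have E : (t k)%:R = (degv I k)%:R + \sum_(j | (j, k) \notin I :|: O) ((j, k) \in G)%:R :> R.
  rewrite -b !degv_sum !natr_sum (bigID (fun j => (j, k) \in I :|: O)) /=; congr (_ + _).
  rewrite [RHS](bigID (fun j => (j, k) \in I :|: O)) /= [X in _ = _ + X]big1 ?addr0.
    by apply: eq_bigr => j jH; rewrite (Om_H GO jH).
  by move=> j; rewrite inE negb_or => /andP[/negPf ->].
by rewrite /vv /ze E; field.
Qed.

Lemma row_sum I O G j : G \in Om I O ->
  \sum_(k | (j, k) \notin I :|: O) ((j, k) \in G)%:R = n%:R * (uu s l I O j + l * (1 - xi R I O j)).
Proof.
move=> GO; have /OmP[b _ _ _] := GO.
have E : (s j)%:R = (degu I j)%:R + \sum_(k | (j, k) \notin I :|: O) ((j, k) \in G)%:R :> R.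
  rewrite -b !degu_sum !natr_sum (bigID (fun k => (j, k) \in I :|: O)) /=; congr (_ + _).
  rewrite [RHS](bigID (fun k => (j, k) \in I :|: O)) /= [X in _ = _ + X]big1 ?addr0.
    by apply: eq_bigr => k jH; rewrite (Om_H GO jH).
  by move=> k; rewrite inE negb_or => /andP[/negPf ->].
by rewrite /uu /xi E; field.
Qed.

Lemma row_free I O j : \sum_(k | (j, k) \notin I :|: O) 1 = n%:R * (1 - xi R I O j).
Proof.
have : \sum_(k < n) 1 = n%:R :> R by rewrite sumr_const card_ord.
rewrite (bigID (fun k => (j, k) \in I :|: O)) /=.
have -> : \sum_(k | (j, k) \in I :|: O) 1 = (degu (I :|: O) j)%:R :> R.
  by rewrite /degu -sum1_card natr_sum; apply: eq_bigl => k; rewrite inE.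
by rewrite /xi => E; apply: (addrI (degu (I :|: O) j)%:R); rewrite E; field.
Qed.

Definition SJ H (a b : 'I_n) := [set j : 'I_m | ((j, a) \notin H) && ((j, b) \notin H)].
(** These rows are the possible partners in a switch between columns a and b. Apart from revealed
    rows their number is the degree of a minus the codegree of a and b, so it is small exactly when
    the columns almost coincide. *)
Definition hs H a b G := [set j in SJ H a b | ((j, a) \in G) && ((j, b) \notin G)].

Lemma in_hs H a b G j : (j \in hs H a b G) = (j \in SJ H a b) && (((j, a) \in G) && ((j, b) \notin G)).
Proof. by rewrite inE. Qed.

Lemma SJC H a b : SJ H a b = SJ H b a.
Proof. by apply/setP=> j; rewrite !inE andbC. Qed.

Section Pair.
Variables (I O : {set 'I_m * 'I_n}) (a b : 'I_n).
Hypothesis ab : a != b.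
Local Notation H := (I :|: O).
Local Notation J := (SJ H a b).
Local Notation S := (hs H a b).
Local Notation S' := (hs H b a).

(** The switch acts on columns b and k only and leaves a alone. Row j1, which contains a, gains b,
    and row j2, which does not, loses b: the codegree of a and b rises by one and each of the two
    sets loses one row. *)
Lemma hs_sw j1 j2 k G : k != a -> chk j1 j2 k b G -> (j1, a) \in G -> (j2, a) \notin G ->
  j1 \in J -> j2 \in J ->
  [/\ j1 \in S G, j2 \in S' G, S (sw j1 j2 b k G) = S G :\ j1 & S' (sw j1 j2 b k G) = S' G :\ j2].
Proof.
move=> ka cG a1 a2 J1 J2; have /andP[j12 kb] := chk_neq cG; have /and4P[c1 c2 c3 c4] := cG.
have J1' : j1 \in SJ H b a by rewrite SJC.
have J2' : j2 \in SJ H b a by rewrite SJC.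
have swa j : ((j, a) \in sw j1 j2 b k G) = ((j, a) \in G).
  by apply: sw_out; rewrite !inE (negPf ab) (eq_sym a k) (negPf ka) orbT.
have [w1 _ w2 _] := sw_on j1 j2 b k G.
have swo j : j != j1 -> j != j2 -> ((j, b) \in sw j1 j2 b k G) = ((j, b) \in G).
  by move=> /negPf e1 /negPf e2; apply: sw_out; rewrite !inE e1 e2.
split.
- by rewrite in_hs J1 a1 c3.
- by rewrite in_hs J2' a2 c2.
- apply/setP => j; rewrite in_setD1 !in_hs swa.
  have [->|jj1] := eqVneq j j1; first by rewrite w1 c1 !andbF.
  have [->|jj2] := eqVneq j j2; first by rewrite (negPf a2) !andbF.
  by rewrite swo.
- apply/setP => j; rewrite in_setD1 !in_hs swa.
  have [->|jj2] := eqVneq j j2; first by rewrite w2 (negPf c4) !andbF.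
  have [->|jj1] := eqVneq j j1; first by rewrite a1 !andbF.
  by rewrite swo.
Qed.

(** A switch that lowers the codegree of a and b enlarges both sets by one row. Hence this weight is
    the inverse of the number of pairs of rows in the two sets of the switched graph. *)
Definition om G : R := (((#|S G|).+1)%:R * ((#|S' G|).+1)%:R)^-1.

Lemma triple_bound j1 j2 k : j1 \in J -> j2 \in J -> free j1 j2 b k H ->
  \sum_(G in Om I O | chk j1 j2 b k G && (((j1, a) \in G) && ((j2, a) \notin G))) om G
  <= \sum_(G in Om I O | (j1 \in S G) && (j2 \in S' G)) (#|S G|%:R * #|S' G|%:R)^-1.
Proof.
move=> J1 J2 fH; have [->|ka] := eqVneq k a.
  rewrite big1 ?sumr_ge0 // => [G _|G]; first by rewrite invr_ge0 mulr_ge0.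
  by case/andP=> _ /andP[/and4P[_ c _ _] /andP[_]]; rewrite c.
rewrite (sum_sw s t (fun G => ((j1, a) \in G) && ((j2, a) \notin G)) _ fH).
have swa G j : ((j, a) \in sw j1 j2 b k G) = ((j, a) \in G).
  by apply: sw_out; rewrite !inE (negPf ab) (eq_sym a k) (negPf ka) orbT.
rewrite [leRHS](bigID (fun G => chk j1 j2 k b G)) /= -[leLHS]addr0 lerD ?sumr_ge0 //; last first.
  by move=> G _; rewrite invr_ge0 mulr_ge0.
rewrite [leLHS](_ : _ = \sum_(G in Om I O | [&& chk j1 j2 k b G, (j1, a) \in G & (j2, a) \notin G])
   (#|S G|%:R * #|S' G|%:R)^-1).
  rewrite le_eqVlt; apply/orP; left; apply/eqP; apply: eq_bigl => G.
  case: (G \in _) => //=; case: (boolP (chk j1 j2 k b G)) => cG; rewrite ?andbF //= andbT.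
  rewrite !inE; move: J1 J2; rewrite !inE => /andP[-> ->] /andP[-> ->].
  by case/and4P: cG => _ -> -> _; rewrite /= !andbT.
apply: eq_big => [G|G]; first by rewrite !swa.
rewrite !swa => /andP[_ /andP[cG /andP[a1 a2]]].
have [s1 s2 e1 e2] := hs_sw ka cG a1 a2 J1 J2.
by rewrite /om e1 e2 (cardsD1 j1 (S G)) s1 (cardsD1 j2 (S' G)) s2.
Qed.

(** The product of the cardinalities of [al G k] and [be G k] is the number of switches between b
    and a third column k that lower the codegree of a and b. *)
Definition Ps G := [set j in J | ((j, a) \in G) && ((j, b) \in G)].
Definition Qs G := [set j in J | ((j, a) \notin G) && ((j, b) \notin G)].
Definition be G k := [set j in Ps G | ((j, k) \notin G) && ((j, k) \notin H)].
Definition al G k := [set j in Qs G | ((j, k) \in G) && ((j, k) \notin H)].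

(** After reversing the switches, for each column k a graph collects at most one term for each pair
    of rows in S and S', and each term is the inverse of the number of such pairs: at most 1 for
    each k. *)
Lemma sum_om_le : \sum_(G in Om I O) (\sum_k #|al G k|%:R * #|be G k|%:R) * om G <= n%:R * cnt I O.
Proof.
pose c k j1 j2 := [&& j1 \in J, j2 \in J & free j1 j2 b k H].
apply: (@le_trans _ _ (\sum_k \sum_j1 \sum_(j2 | c k j1 j2)
  \sum_(G in Om I O | (j1 \in S G) && (j2 \in S' G)) (#|S G|%:R * #|S' G|%:R)^-1)).
  apply: (@le_trans _ _ (\sum_k \sum_j1 \sum_(j2 | c k j1 j2)
    \sum_(G in Om I O | chk j1 j2 b k G && (((j1, a) \in G) && ((j2, a) \notin G))) om G)); last first.
    by apply: ler_sum => k _; apply: ler_sum => j1 _; apply: ler_sum => j2 /and3P[]; apply: triple_bound.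
  rewrite le_eqVlt; apply/orP; left; apply/eqP.
  transitivity (\sum_(G in Om I O) \sum_k \sum_(j1 in be G k) \sum_(j2 in al G k) om G).
    apply: eq_bigr => G _; rewrite mulr_suml; apply: eq_bigr => k _.
    by rewrite !sumr_const -mulrnA -[RHS]mulr_natr natrM mulrC.
  rewrite exchange_big; apply: eq_bigr => k _.
  transitivity (\sum_(G in Om I O) \sum_j1 \sum_(j2 | c k j1 j2 && (chk j1 j2 b k G && (((j1, a) \in G) && ((j2, a) \notin G)))) om G).
    apply: eq_bigr => G _; rewrite big_mkcond; apply: eq_bigr => j1 _.
    case: ifPn => B1.
      apply: eq_bigl => j2; rewrite /c /chk /free; move: B1; rewrite !inE.
      case/andP=> /andP[/andP[-> ->] /andP[-> ->]] /andP[-> ->]; rewrite /=.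
      move: ((j2, a) \in G) ((j2, b) \in G) ((j2, k) \in G) ((j2, a) \in I) ((j2, a) \in O) ((j2, b) \in I) ((j2, b) \in O) ((j2, k) \in I) ((j2, k) \in O).
      by do 9!case.
    symmetry; apply: big_pred0 => j2; apply: contraNF B1.
    case/andP=> /and3P[J1 _ /and4P[f1 f2 f3 f4]] /andP[/and4P[g1 g2 g3 g4] /andP[g5 g6]].
    by rewrite inE f2 g3 inE J1 g5 g1.
  rewrite exchange_big; apply: eq_bigr => j1 _.
  under eq_bigr do rewrite big_mkcondr.
  rewrite exchange_big; apply: eq_bigr => j2 _.
  by rewrite -big_mkcondr.
apply: (@le_trans _ _ (\sum_(k : 'I_n) cnt I O)); last by rewrite sumr_const card_ord mulr_natl.
apply: ler_sum => k _.
apply: (@le_trans _ _ (\sum_j1 \sum_j2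
  \sum_(G in Om I O | (j1 \in S G) && (j2 \in S' G)) (#|S G|%:R * #|S' G|%:R)^-1)).
  apply: ler_sum => j1 _; rewrite [leRHS](bigID (c k j1)) /= lerDl.
  by do 2!(apply: sumr_ge0 => ? _); rewrite invr_ge0 mulr_ge0.
rewrite cnt_sum.
rewrite [leLHS](_ : _ = \sum_(G in Om I O) \sum_(j1 in S G) \sum_(j2 in S' G) (#|S G|%:R * #|S' G|%:R)^-1).
  apply: ler_sum => G _; rewrite !sumr_const -mulrnA mulnC -[leLHS]mulr_natr natrM.
  have [->|S0] := eqVneq (#|S G|%:R * #|S' G|%:R : R) 0; first by rewrite invr0 mul0r ler01.
  by rewrite mulVf.
under eq_bigr do under eq_bigr do rewrite big_mkcondr.
under eq_bigr do rewrite exchange_big.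
rewrite exchange_big; apply: eq_bigr => G _.
rewrite [RHS]big_mkcond; apply: eq_bigr => j1 _; case: ifP => j1S.
  by rewrite [RHS]big_mkcond.
by rewrite big1.
Qed.

End Pair.
End Codegree.

(** Convexity: the parabola lies above its tangent at the mean. *)
Lemma sum_sqr_ge (R : realFieldType) (n : nat) (b : 'I_n -> R) (c : R) : (0 < n)%N ->
  (\sum_k b k) * ((\sum_k b k) / n%:R - c) <= \sum_k (b k * (b k - c)).
Proof.
move=> n0; set B := \sum_k b k; have nR : n%:R != 0 :> R by rewrite pnatr_eq0 -lt0n.
apply: (@le_trans _ _ (\sum_k (2 * (B / n%:R) * b k - (B / n%:R) ^+ 2 - c * b k))).
  rewrite !sumrB -!mulr_sumr sumr_const card_ord -[_ *+ n]mulr_natr -/B.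
  by rewrite le_eqVlt; apply/orP; left; apply/eqP; field.
apply: ler_sum => k _; rewrite -subr_ge0.
have -> : b k * (b k - c) - (2 * (B / n%:R) * b k - (B / n%:R) ^+ 2 - c * b k) = (b k - B / n%:R) ^+ 2 by ring.
exact: sqr_ge0.
Qed.

Lemma card_cover (T : finType) (D A1 A2 A3 A4 A5 A6 : {set T}) :
  D \subset A1 :|: A2 :|: A3 :|: A4 :|: A5 :|: A6 ->
  (#|D| <= #|A1| + #|A2| + #|A3| + #|A4| + #|A5| + #|A6|)%N.
Proof.
move/subset_leq_card => le; apply: leq_trans le _.
by do 4![apply: leq_trans (leq_card_setU _ _).1 _; rewrite leq_add2r]; exact: (leq_card_setU _ _).1.
Qed.

(** * Many switches when two columns almost coincide *)

Section CodegreeTail.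
Variables (R : realFieldType) (m n : nat) (s : 'I_m -> nat) (t : 'I_n -> nat) (l w : R).
Variables (I O : {set 'I_m * 'I_n}).
Local Notation Om := (Om s t I O).
Local Notation cnt := (cnt R s t I O).
Local Notation H := (I :|: O).
Local Notation ell := (l * (1 - l)).
Hypothesis (n0 : (0 < n)%N) (m0 : (0 < m)%N).
Hypotheses (l01 : 0 < l < 1) (gd : good s t l w I O) (wl : 80 * w <= ell) (wm : 1 <= w * m%:R).

Let nR : n%:R != 0 :> R. Proof. by rewrite pnatr_eq0 -lt0n. Qed.
Let mR : m%:R != 0 :> R. Proof. by rewrite pnatr_eq0 -lt0n. Qed.
Let n1 : 0 < n%:R :> R. Proof. by rewrite ltr0n. Qed.
Let m1 : 0 < m%:R :> R. Proof. by rewrite ltr0n. Qed.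
Let w0 : 0 < w. Proof. by rewrite -(pmulr_lgt0 _ m1); exact: lt_le_trans ltr01 wm. Qed.

Lemma freedeg_bound G k : G \in Om ->
  l * m%:R - 2 * (w * m%:R) <= #|[set j | ((j, k) \notin H) && ((j, k) \in G)]|%:R <= l * m%:R + w * m%:R.
Proof.
move=> GO; have -> : #|[set j | ((j, k) \notin H) && ((j, k) \in G)]|%:R =
    \sum_(j | (j, k) \notin H) ((j, k) \in G)%:R :> R.
  rewrite -sum1_card natr_sum [RHS](bigID (fun j => (j, k) \in G)) /= [X in _ + X]big1 ?addr0.
    by apply: eq_big => [j|j]; rewrite inE // => /andP[_ ->].
  by move=> j /andP[_ /negPf ->].
rewrite (col_sum (t := t) l m0 k GO).
have := g_v gd k; have := g_z gd k.
have : 0 <= ze R I O k by rewrite divr_ge0.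
move: (vv _ _ _ _ _) (ze _ _ _ _) => v z z0 zw; rewrite ler_norml => /andP[v1 v2].
have /andP[l0 l1] := l01.
have : 0 <= l * z by rewrite mulr_ge0 // ltW.
have : l * z <= w by nra.
move=> q1 q2; rewrite mulrDr mulrBr mulr1 [m%:R * (l - _)]mulrBr [m%:R * l]mulrC.
have : 0 <= m%:R * (w - v) by apply: mulr_ge0; [exact: ltW|lra].
have : 0 <= m%:R * (w + v) by apply: mulr_ge0; [exact: ltW|lra].
have : 0 <= m%:R * (w - l * z) by apply: mulr_ge0; [exact: ltW|lra].
have : 0 <= m%:R * (l * z) by apply: mulr_ge0; [exact: ltW|lra].
lra.
Qed.

Lemma degvH_le k : (degv H k)%:R <= w * m%:R :> R.
Proof. by have := g_z gd k; rewrite ler_pdivrMr. Qed.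

Section Graph.
Variable (G : {set 'I_m * 'I_n}).
Hypothesis GO : G \in Om.

Lemma PS_bound a b (S := hs H a b G) (P := Ps I O a b G) : l * m%:R - 3 * (w * m%:R) <= #|P|%:R + #|S|%:R <= l * m%:R + w * m%:R.
Proof.
have /andP[d1 d2] := freedeg_bound a GO.
pose D := [set j | ((j, a) \notin H) && ((j, a) \in G)].
have PSD : (#|P| + #|S| <= #|D|)%N.
  rewrite -cardsUI [P :&: S](_ : _ = set0) ?cards0 ?addn0.
    apply: subset_leq_card; apply/subsetP => j; rewrite !inE.
    by case/orP=> /andP[/andP[-> _] /andP[-> _]].
  by apply/setP => j; rewrite !inE; case: ((j, b) \in G); rewrite ?andbF.
have DPS : (#|D| <= #|P| + #|S| + degv H b)%N.
  rewrite -(cardsID (P :|: S) D) leq_add //.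
    rewrite (leq_trans (subset_leq_card (subsetIr _ _))) // cardsU leq_subLR leq_addl //.
  apply: subset_leq_card; apply/subsetP => j; rewrite !inE.
  by case: ((j, a) \in G); case: ((j, b) \in G); case: ((j, a) \in I); case: ((j, a) \in O);
   case: ((j, b) \in I); case: ((j, b) \in O).
have := degvH_le b.
move: PSD DPS; rewrite -!(ler_nat R) !natrD -/D => p1 p2 p3.
by move: d1 d2; rewrite -/D; lra.
Qed.

Section Pair.
Variables a b : 'I_n.
Local Notation J := (SJ H a b).
Local Notation S := (hs H a b G).
Local Notation S' := (hs H b a G).
Local Notation P := (Ps I O a b G).

(** Columns k and a have nearly equal degrees. So the rows of P missed by k, counted by [be], must
    be made up for by rows of k outside P. These lie in S, which already belongs to the degree of a,
    in S', among the revealed rows, or in [al]. *)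
Lemma al_ge k : #|be I O a b G k|%:R - 6 * (w * m%:R) - #|S'|%:R <= #|al I O a b G k|%:R :> R.
Proof.
have /andP[d1 d2] := freedeg_bound k GO; have /andP[p1 p2] := PS_bound a b.
pose D := [set j | ((j, k) \notin H) && ((j, k) \in G)].
have E : (#|D| + #|be I O a b G k| <= #|al I O a b G k| + (#|P| + #|S| + #|S'| + degv H a + degv H b))%N.
  have BP : be I O a b G k \subset P by apply/subsetP => j; rewrite inE => /andP[].
  rewrite -[#|P|](cardsID (be I O a b G k)) (setIidPr BP).
  rewrite [X in (_ <= X)%N](_ : _ = #|al I O a b G k| + #|P :\: be I O a b G k| + #|S| + #|S'| + degv H a + degv H b + #|be I O a b G k|)%N; last first.
    move: #|al _ _ _ _ _ _| #|be _ _ _ _ _ _| #|_ :\: _| #|S| #|S'| (degv _ a) (degv _ b); clear; lia.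
  rewrite leq_add2r /degv.
  apply: card_cover; apply/subsetP => j; rewrite !inE.
  by case: ((j, a) \in G); case: ((j, b) \in G); case: ((j, k) \in G); case: ((j, k) \in I); case: ((j, k) \in O); case: ((j, a) \in I); case: ((j, a) \in O);
   case: ((j, b) \in I); case: ((j, b) \in O).
have := degvH_le a; have := degvH_le b.
move: E; rewrite -(ler_nat R) !natrD => E; move: d1; rewrite -/D => d1; lra.
Qed.

Lemma be_sum : #|P|%:R * (n%:R * (1 - l - 2 * w)) <= \sum_k #|be I O a b G k|%:R :> R.
Proof.
have -> : \sum_k #|be I O a b G k|%:R = \sum_(j in P) \sum_(k | (j, k) \notin H) (1 - ((j, k) \in G)%:R) :> R.
  transitivity (\sum_k \sum_(j in P) (if (j, k) \notin H then 1 - ((j, k) \in G)%:R else 0 : R)).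
    apply: eq_bigr => k _; rewrite -sum1_card natr_sum big_mkcond [RHS]big_mkcond /=.
    apply: eq_bigr => j _; rewrite [j \in be _ _ _ _ _ _]inE; case: (j \in P) => //=.
    by case: ((j, k) \in G); case: (_ \notin H) => //=; rewrite ?subr0 ?subrr.
  by rewrite exchange_big; apply: eq_bigr => j _; rewrite -big_mkcond.
rewrite mulr_natl -sumr_const; apply: ler_sum => j _.
rewrite sumrB row_free // (row_sum (s := s) l n0 j GO) -mulrBr ler_pM2l //.
have := g_u gd j; have := g_x gd j.
move: (uu _ _ _ _ _) (xi _ _ _ _) => v z zw; rewrite ler_norml => /andP[v1 v2].
by move/andP: l01 => [l0 l1]; nra.
Qed.

(** If S' is small then so is S, and P contains most of column a. Each row of P is missed by about
    (1 - l) n columns, so the mean of [be] over k is at least 5/8 of ell m. As [al] is at least [be]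
    up to smaller terms, convexity bounds the sum of products. *)
Lemma F_ge : #|S'|%:R <= ell * m%:R / 4 ->
  n%:R * (ell * m%:R) ^+ 2 / 8 <= \sum_k #|al I O a b G k|%:R * #|be I O a b G k|%:R :> R.
Proof.
move=> S4; pose c := 6 * (w * m%:R) + #|S'|%:R.
apply: (@le_trans _ _ (\sum_k #|be I O a b G k|%:R * (#|be I O a b G k|%:R - c))); last first.
  apply: ler_sum => k _; rewrite mulrC ler_wpM2r //.
  by have := al_ge k; rewrite /c; lra.
apply: le_trans (sum_sqr_ge _ _ n0).
have := be_sum; have /andP[p1 p2] := PS_bound a b.
have SS : #|S|%:R <= #|S'|%:R + 4 * (w * m%:R) :> R.
  have P' : Ps I O b a G = P by apply/setP => j; rewrite !inE andbC [X in (_ && X)%B]andbC; case: ((j,a) \in G) ((j, b) \in G) => -[]; rewrite ?andbF ?andbT.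
  have : l * m%:R - 3 * (w * m%:R) <= #|P|%:R + #|S'|%:R :> R.
    by rewrite -P'; have /andP[] := PS_bound b a.
  lra.
set B := \sum_k _ => HB.
set x := ell * m%:R in S4 *; set y := w * m%:R in c p1 p2 SS *.
have y80 : 80 * y <= x by rewrite /y /x mulrA ler_wpM2r // ltW.
have y0 : 0 < y by rewrite mulr_gt0.
have BN : x - 7 * y - #|S'|%:R <= B / n%:R.
  rewrite ler_pdivlMr //; apply: le_trans HB; rewrite [leRHS]mulrCA [leLHS]mulrC ler_wpM2l ?(ltW n1) //.
  have q : 0 <= #|S'|%:R :> R by [].
  have P1 : l * m%:R - 7 * y - #|S'|%:R <= #|P|%:R by lra.
  have [l0 l1] := andP l01.
  have l2 : 0 <= 1 - l - 2 * w.
    have : 0 <= (1 - l) * (1 - l) by apply: mulr_ge0; lra.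
    have w0' := w0; move: wl; lra.
  apply: le_trans (ler_wpM2r l2 P1); rewrite -subr_ge0.
  rewrite [X in 0 <= X](_ : _ = 5 * (l * y) + l * #|S'|%:R + 2 * w * (7 * y + #|S'|%:R)); last by rewrite /x /y; ring.
  by rewrite !addr_ge0 ?mulr_ge0 // ?ltW //; lra.
have B1 : 5 / 8 * x <= B / n%:R by lra.
have B2 : 1 / 4 * x <= B / n%:R - c by rewrite /c; lra.
have -> : B * (B / n%:R - c) = n%:R * (B / n%:R * (B / n%:R - c)) by field.
rewrite -mulrA ler_wpM2l ?ltW //.
have x0 : 0 < x by lra.
by nra.
Qed.
End Pair.
End Graph.
End CodegreeTail.

(** * Inverse moments of the number of partner rows *)

Section InverseMoment.
Variables (R : realFieldType) (m n : nat) (s : 'I_m -> nat) (t : 'I_n -> nat) (l w : R).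
Local Notation Om := (Om s t).
Local Notation cnt := (cnt R s t).
Local Notation ell := (l * (1 - l)).
Hypothesis (n0 : (0 < n)%N) (m0 : (0 < m)%N).
Hypotheses (l01 : 0 < l < 1) (wl : 80 * w <= ell) (wm : 1 <= w * m%:R).

Let n1 : 0 < n%:R :> R. Proof. by rewrite ltr0n. Qed.
Let m1 : 0 < m%:R :> R. Proof. by rewrite ltr0n. Qed.
Let w0 : 0 < w. Proof. by rewrite -(pmulr_lgt0 _ m1); exact: lt_le_trans ltr01 wm. Qed.
Let e0 : 0 < ell. Proof. by have [a b] := andP l01; rewrite mulr_gt0 // subr_gt0. Qed.

Lemma hs_diff I O a b G : good s t l w I O -> G \in Om I O ->
  #|hs (I :|: O) a b G|%:R <= #|hs (I :|: O) b a G|%:R + 4 * (w * m%:R) :> R.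
Proof.
move=> gd GO.
have P' : Ps I O b a G = Ps I O a b G.
  by apply/setP => j; rewrite !inE andbC [X in (_ && X)%B]andbC; case: ((j,a) \in G) ((j, b) \in G) => -[]; rewrite ?andbF ?andbT.
have /andP[_ p1] := PS_bound m0 l01 gd GO a b.
have /andP[p2 _] := PS_bound m0 l01 gd GO b a.
by move: p1 p2; rewrite P'; lra.
Qed.

(** Either S' has more than a quarter of ell m elements and the summand is small at once, or [F_ge]
    gives so many codegree-lowering switches that the summand is at most a multiple of [F G * om G],
    whose total is bounded by [sum_om_le]. *)
Lemma inv_sum I O a b : good s t l w I O -> a != b ->
  \sum_(G in Om I O) ((#|hs (I :|: O) b a G|).+1%:R)^-1 <= 8 / (ell * m%:R) * cnt I O.
Proof.
move=> gd ab; set x := ell * m%:R.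
have x0 : 0 < x by rewrite mulr_gt0.
pose F G : R := \sum_k #|al I O a b G k|%:R * #|be I O a b G k|%:R.
apply: (@le_trans _ _ (\sum_(G in Om I O) (4 / x + 4 / (n%:R * x) * (F G * om R I O a b G)))); last first.
  rewrite big_split /= sumr_const -[_ *+ #|_|]mulr_natr -/(cnt I O) -mulr_sumr.
  have := sum_om_le R s t I O ab; rewrite -/(F _) => le.
  have -> : 8 / x * cnt I O = 4 / x * cnt I O + 4 / (n%:R * x) * (n%:R * cnt I O).
    by field; rewrite !gt_eqF.
  by rewrite lerD2l ler_wpM2l // divr_ge0 // mulr_ge0 // ltW.
apply: ler_sum => G GO.
have om0 : 0 <= om R I O a b G by rewrite invr_ge0 mulr_ge0.
have F0 : 0 <= F G by apply: sumr_ge0 => k _; rewrite mulr_ge0.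
set S' := hs (I :|: O) b a G.
have [S4|S4] := leP (#|S'|%:R : R) (x / 4); last first.
  rewrite -[leLHS]addr0 lerD //; last first.
    by apply: mulr_ge0; [rewrite divr_ge0 // mulr_ge0 // ltW | exact: mulr_ge0].
  rewrite -[4 / x]invf_div lef_pV2 ?posrE ?ltr0Sn ?divr_gt0 // -[#|_|.+1%:R]natr1; lra.
have := F_ge n0 m0 l01 gd wl wm GO S4; rewrite -/(F G) -/x => FG.
have d := hs_diff a b gd GO.
rewrite -[leLHS]add0r lerD //; first by rewrite divr_ge0 // ltW.
apply: (@le_trans _ _ (x / 2 * om R I O a b G)).
  rewrite /om -/S' invfM mulrA; apply: ler_peMl; first by rewrite invr_ge0.
  rewrite ler_pdivlMr ?ltr0Sn // mul1r -[#|_|.+1%:R]natr1.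
  have : 80 * (w * m%:R) <= x by rewrite mulrA /x ler_wpM2r // ltW.
  by move: wm d S4; rewrite -/S'; lra.
rewrite [leRHS]mulrA ler_wpM2r //.
have -> : x / 2 = 4 / (n%:R * x) * (n%:R * x ^+ 2 / 8) by field; rewrite !gt_eqF.
by rewrite ler_wpM2l // divr_ge0 // mulr_ge0 // ltW.
Qed.

(* The injection of each graph with (j,k) in, (j,k') out along its switches has fibre weights h/(h'+1), which are close to 1 by [inv_sum]. *)
Lemma crude_le I O j k k' (e := (j, k)) (e' := (j, k')) : k != k' ->
  e \notin I :|: O -> e' \notin I :|: O ->
  good s t l w (e |: I) (e' |: O) -> good s t l w (e' |: I) (e |: O) ->
  cnt (e |: I) (e' |: O) <= (1 + 32 * w / ell) * cnt (e' |: I) (e |: O)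
     + 8 * w / ell * cnt (e |: I) (e' |: O).
Proof.
move=> kk eH eH' gA gB.
pose OA := Om (e |: I) (e' |: O); pose OB := Om (e' |: I) (e |: O).
pose H1 := e |: (e' |: (I :|: O)).
have HA : (e |: I) :|: (e' |: O) = H1 by rewrite UI UO.
have HB : (e' |: I) :|: (e |: O) = H1 by rewrite UI UO setUCA.
pose J := SJ H1 k k'.
pose S G := hs H1 k k' G; pose S' G := hs H1 k' k G.
have jJ : j \notin J by rewrite !inE eqxx.
have mw : m%:R^-1 <= w by rewrite -[m%:R^-1]mul1r ler_pdivrMr.
have e8 : 8 / (ell * m%:R) <= 8 * w / ell.
  rewrite invfM mulrA [8 * w / ell]mulrAC ler_wpM2l // divr_ge0 //; exact: ltW.
have invA : \sum_(G in OA) (#|S' G|.+1%:R)^-1 <= 8 * w / ell * cnt (e |: I) (e' |: O).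
  by have := inv_sum gA kk; rewrite HA -/OA => h; apply: le_trans h _; rewrite ler_wpM2r.
have invB : \sum_(G in OB) (#|S' G|.+1%:R)^-1 <= 8 / (ell * m%:R) * cnt (e' |: I) (e |: O).
  by have := inv_sum gB kk; rewrite HB -/OB.
(* A graph with empty S' has no switch; for it the second term equals 1 and takes its place. *)
apply: (@le_trans _ _ (\sum_(G in OA) (\sum_(j2 in S' G) (#|S' G|%:R)^-1 + (#|S' G|.+1%:R)^-1))).
  rewrite cnt_sum; apply: ler_sum => G _; rewrite sumr_const.
  have [->|S0] := posnP #|S' G|; first by rewrite invr1 add0r.
  by rewrite -[_ *+ #|_|]mulr_natr mulVf ?lerDl ?invr_ge0 // pnatr_eq0 -lt0n.
rewrite big_split /= lerD //.
have -> : \sum_(G in OA) \sum_(j2 in S' G) (#|S' G|%:R)^-1 =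
  \sum_(G in OB) \sum_(j2 in S G) (#|S' G|.+1%:R)^-1 :> R.
  have inA G j2 : (G \in OA) && (j2 \in S' G) = (j2 \in J) && ((G \in Om I O) && (chk j j2 k k' G && true)).
    rewrite /OA Om_in Om_out 2!in_set /chk -/e -/e' in_hs [SJ H1 k' k]SJC -/J andbT.
    by case: (j2 \in _); case: (e \in G); case: (e' \in G); rewrite ?andbF ?andbT.
  have inB G j2 : (G \in OB) && (j2 \in S G) = (j2 \in J) && ((G \in Om I O) && (chk j j2 k' k G && true)).
    rewrite /OB Om_in Om_out 2!in_set /chk -/e -/e' in_hs -/J andbT.
    by case: (j2 \in _); case: (e \in G); case: (e' \in G); rewrite ?andbF ?andbT.
  transitivity (\sum_(j2 in J) \sum_(G in Om I O | chk j j2 k k' G && true) (#|S' G|%:R)^-1 : R).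
    rewrite (exchange_big_dep xpredT) //= [RHS]big_mkcond; apply: eq_bigr => j2 _.
    rewrite (eq_bigl _ _ (inA^~ j2)); case: (j2 \in J) => //.
    by rewrite big_pred0.
  transitivity (\sum_(j2 in J) \sum_(G in Om I O | chk j j2 k' k G && true) (#|S' G|.+1%:R)^-1 : R); last first.
    symmetry; rewrite (exchange_big_dep xpredT) //= [RHS]big_mkcond; apply: eq_bigr => j2 _.
    rewrite (eq_bigl _ _ (inB^~ j2)); case: (j2 \in J) => //.
    by rewrite big_pred0.
  have nH x : x \notin H1 -> x \notin I :|: O.
    by apply: contra => h; rewrite /H1 2!in_setU1 h !orbT.
  apply: eq_bigr => j2 j2J; have := j2J; rewrite in_set => /andP[/nH f1 /nH f2].
  have fr : free j j2 k k' (I :|: O) by apply/and4P.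
  rewrite (sum_sw s t xpredT _ fr); apply: eq_bigr => G /andP[_ /andP[cG _]].
  have /and4P[c1 c2 c3 c4] := cG; congr ((_%:R)^-1).
  have -> : S' (sw j j2 k k' G) = j2 |: S' G; last by rewrite cardsU1 in_hs (negPf c4) !andbF.
  have [_ _ w1 w2] := sw_on j j2 k k' G.
  apply/setP => i; rewrite in_setU1 !in_hs.
  have [->|ij2] := eqVneq i j2; first by rewrite SJC j2J w1 w2 c2 c4.
  have [->|ij] := eqVneq i j; first by rewrite SJC (negPf jJ).
  by rewrite !sw_out ?inE ?(negPf ij) ?(negPf ij2).
apply: (@le_trans _ _ (\sum_(G in OB) (1 + 4 * (w * m%:R) * (#|S' G|.+1%:R)^-1))).
  apply: ler_sum => G GB; rewrite sumr_const -[_ *+ #|_|]mulr_natl.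
  have := hs_diff k k' gB GB; rewrite HB -/(S G) -/(S' G) => d.
  have q : 0 < #|S' G|.+1%:R :> R by rewrite ltr0Sn.
  rewrite ler_pdivrMr // mulrDl mul1r mulfVK ?gt_eqF //.
  by move: d; rewrite -[#|_|.+1%:R]natr1; lra.
rewrite big_split /= -cnt_sum -mulr_sumr. rewrite [leRHS]mulrDl mul1r lerD2l.
apply: le_trans (ler_wpM2l _ invB) _; first by rewrite !mulr_ge0 // ltW.
have [l0 l1] := andP l01.
by rewrite le_eqVlt; apply/orP; left; apply/eqP; field; rewrite !gt_eqF ?subr_gt0.
Qed.

End InverseMoment.

(** * Numerical form of the contraction *)

Section NormBound.
Variable R : realFieldType.
Implicit Types x y a b : R.
Lemma nbD x y a b : `|x| <= a -> `|y| <= b -> `|x + y| <= a + b.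
Proof. by move=> xa yb; apply: le_trans (ler_normD _ _) _; apply: lerD. Qed.
Lemma gap_ge0 x a b : 0 <= x -> b <= a -> 0 <= x * (a - b).
Proof. by move=> x0 ab; rewrite mulr_ge0 // subr_ge0. Qed.
Lemma nbN x a : `|x| <= a -> `|- x| <= a.
Proof. by rewrite normrN. Qed.
Lemma nbM x y a b : `|x| <= a -> `|y| <= b -> `|x * y| <= a * b.
Proof. by move=> xa yb; rewrite normrM ler_pM. Qed.
Lemma nbX x a : `|x| <= a -> `|x ^+ 2| <= a * a.
Proof. by rewrite expr2; move=> xa; apply: nbM. Qed.
Lemma nbC k : `|k%:R : R| <= k%:R.
Proof. by rewrite ger0_norm. Qed.
Lemma nb1 : `|1 : R| <= 1.
Proof. by rewrite normr1. Qed.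
Lemma nbE x a : `|x| <= a -> - a <= x /\ x <= a.
Proof. by rewrite ler_norml => /andP. Qed.
End NormBound.

(** Propagation of bounds: [nb] follows the syntax of the expression down to subterms bounded by a
    hypothesis, and [nbt] leaves a polynomial inequality between the bounds. Larger subterms with a
    hypothesis of their own are not taken apart, so it pays to generalise them first. *)
Ltac nb := first [ match goal with H : is_true (`|?x| <= _) |- is_true (`|?x| <= _) => exact H end
  | eapply nbD; [nb | nb] | eapply nbN; nb | eapply nbX; nb | eapply nbM; [nb | nb]
  | exact: nb1 | exact: nbC | eassumption ].
Ltac nbt := eapply le_trans; [ nb | ].

Lemma perturb_le (R : realFieldType) (Qr Q M D w X A er : R) :
  0 <= D -> 0 <= w * D -> 0 <= X -> Q <= M + 30 * w + 12 * D -> Q <= 2 ->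
  er = D / 4 + 100 * (w * D + X) -> Qr <= Q * (er + er) -> A <= 48 * (w * D) + 560 * X ->
  Qr + A <= D / 2 * M + (6 * (D * D) + 470 * (w * D) + 1000 * X).
Proof.
move=> D0 w0 X0 Q1 Q2 -> Qr1 A1.
have h1 : 0 <= D * (M + 30 * w + 12 * D - Q) by exact: gap_ge0.
have h2 : 0 <= (w * D + X) * (2 - Q) by apply: gap_ge0 => //; exact: addr_ge0.
lra.
Qed.

Section StepNumeric.
Variable R : realFieldType.
Variables (l z w o D u v v' f f' g th th' rho im : R).
Local Notation ell := (l * (1 - l)).
Local Notation kap := ((1 - 2 * l) * z).
Hypotheses (l01 : 0 < l < 1) (ez : ell * z = 1) (w0 : 0 < w) (wo : w <= ell ^+ 2 * o)
  (o1 : o <= 1 / 200) (D0 : 0 <= D) (D1 : D <= 100 * ell * o) (D2 : D <= ell / 20).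
Hypotheses (hu : `|u| <= w) (hv : `|v| <= w) (hv' : `|v'| <= w)
  (hf : `|f| <= w) (hf' : `|f'| <= w) (hg : `|g| <= w)
  (hth : `|th| <= w ^+ 2) (hth' : `|th'| <= w ^+ 2) (hrho : `|rho| <= w ^+ 2)
  (him : `|im| <= w ^+ 2).

(** In the application [q] is the proportion of rows in which both columns k and k' are unrevealed,
    [al] and [al'] are the proportions of rows that are edges of k and k' there, and [T] is the
    difference of [phi]. [E1] and [E2] are the mean numbers of partner rows over m, [Dh] is the
    covariance of the two columns, and [Q] is the probability that exactly one of jk and jk' is an
    edge. [S0] and [Q0] approximate [E1 + E2] and [Q]. *)
Let y := f + f' - g + im.
Let q := 1 - y.
Let al := v + l * (1 - f) - ((l + v) * (f' - g) + th' - rho).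
Let al' := v' + l * (1 - f') - ((l + v') * (f - g) + th - rho).
Let T := v - v' + v * f - v' * f' + kap * u * (v - v') + th - th'.
Let S0 := 2 * ell * q + (1 - 2 * l) * (v + v').
Let Q0 := 2 * ell + (1 - 2 * l) * (2 * u + v + v').

Variables (E1 E2 Dh r1 r2 p p' p1 : R).
Let er := D / 4 + 100 * (w * D + w ^+ 3 * z).
Hypotheses (hDh : `|Dh| <= 3 * w ^+ 2) (hr1 : `|r1| <= er) (hr2 : `|r2| <= er).
Hypotheses (e1 : q * E1 = al' * (q - al) + al' * im - Dh + r1)
  (e2 : q * E2 = al * (q - al') + al * im - Dh + r2).
Let ep := D + 5 * (w ^+ 2 * z).
Hypotheses (hp : `|p - (l + u + v)| <= ep) (hp' : `|p' - (l + u + v')| <= ep)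
  (hp1 : `|p1 - (l + u + v')| <= ep).
Let Q := p + p' - 2 * (p * p1).
Hypothesis AB : (p - p') * (E1 + E2) = Q * (E2 - E1).

Lemma ell_bounds : 0 < ell /\ ell <= 1 / 4.
Proof.
have [a b] := andP l01; split; first by rewrite mulr_gt0 // subr_gt0.
by have := sqr_ge0 (l - 1 / 2); lra.
Qed.
Lemma z_ge4 : 4 <= z.
Proof.
have [a b] := ell_bounds; have z0 : 0 < z by rewrite -(pmulr_rgt0 _ a) ez.
have ez' := ez.
have : ell * z <= 1 / 4 * z by rewrite ler_wpM2r // ltW.
by rewrite ez; lra.
Qed.

Lemma sizes : [/\ w * z <= ell * o, w * z <= 1 / 200, w <= 1 / 200 & 0 < o].
Proof.
have [a b] := ell_bounds; have z4 := z_ge4; have o1' := o1; have w0' := w0; have wo' := wo.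
have o0 : 0 < o by rewrite -(pmulr_rgt0 _ (exprn_gt0 2 a)); exact: lt_le_trans wo.
have wz : w * z <= ell * o.
  have : w * z <= ell ^+ 2 * o * z by rewrite ler_wpM2r //; lra.
  by rewrite [ell ^+ 2 * o * z](_ : _ = ell * o * (ell * z)); [rewrite ez mulr1|ring].
have w1 : w * z <= 1 / 200.
  have : ell * o <= 1 / 4 * o by rewrite ler_wpM2r // ltW.
  lra.
split=> //.
have : ell ^+ 2 * o <= 1 / 16 * o.
  rewrite ler_wpM2r ?(ltW o0) // expr2 (_ : 1 / 16 = 1 / 4 * (1 / 4)); last by lra.
  by rewrite ler_pM // ltW.
lra.
Qed.

Lemma monos : [/\ 0 <= w ^+ 2, w ^+ 2 <= w / 200, 4 * w ^+ 2 <= w ^+ 2 * z, w ^+ 2 * z <= w / 200 & 0 <= w ^+ 2 * z].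
Proof.
have [s1 s2 s3 s4] := sizes; have z4 := z_ge4; have w0' := w0.
split.
- exact: sqr_ge0.
- have : 0 <= w * (1 / 200 - w) by apply: gap_ge0 => //; apply: ltW.
  lra.
- have : 0 <= w ^+ 2 * (z - 4) by apply: mulr_ge0; [exact: sqr_ge0|lra].
  lra.
- have : 0 <= w * (1 / 200 - w * z) by apply: gap_ge0 => //; apply: ltW.
  lra.
- by apply: mulr_ge0; [exact: sqr_ge0|lra].
Qed.

Lemma mono3 : [/\ 0 <= w ^+ 3, 4 * w ^+ 3 <= w ^+ 3 * z & 0 <= w ^+ 3 * z].
Proof.
have [m0 m1 m2 m3 m4] := monos; have w0' := w0.
have a : 0 <= w * (w ^+ 2 * z - 4 * w ^+ 2) by apply: gap_ge0 => //; apply: ltW.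
have b : 0 <= w * (w ^+ 2 * z) by apply: mulr_ge0 => //; apply: ltW.
have c : 0 <= w * w ^+ 2 by apply: mulr_ge0 => //; apply: ltW.
by split; lra.
Qed.

Lemma nl1 : `|1 - 2 * l| <= 1.
Proof. by have [a b] := andP l01; rewrite ler_norml; lra. Qed.
Lemma nl : `|l| <= 1.
Proof. by have [a b] := andP l01; rewrite ler_norml; lra. Qed.
Lemma nz : `|z| <= z.
Proof. by have := z_ge4 => z4; rewrite ger0_norm //; lra. Qed.
Lemma nell : `|ell| <= 1 / 4.
Proof. by have [a b] := ell_bounds; rewrite ger0_norm // ltW. Qed.

Lemma nT : `|T| <= 3 * w.
Proof.
have h1 := nl1; have h2 := nz; have [m0 m1 m2 m3 m4] := monos; have w0' := w0.
rewrite /T; nbt; lra.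
Qed.

Lemma nal : `|al - al'| <= 3 * w.
Proof.
have -> : al - al' = v - v' - v * (f' - g) + v' * (f - g) + th - th' by rewrite /al /al'; ring.
have h1 := nl1; have h2 := nz; have [m0 m1 m2 m3 m4] := monos; have w0' := w0.
nbt; lra.
Qed.

Lemma ny : `|y| <= 4 * w.
Proof.
have [m0 m1 m2 m3 m4] := monos; have w0' := w0.
rewrite /y; nbt; lra.
Qed.

(** The point where the shape of [phi] is used: all second order terms cancel, those from revealed
    pairs against [th] and [v * f], the factor [1 + kap * u] against the product term. *)
Lemma nmain : `|(1 + kap * u) * (al - al') - q * T| <= 20 * (w ^+ 3 * z).
Proof.
pose a2 := - v * (f' - g) + v' * (f - g) + th - th'.
pose T2 := v * f - v' * f' + kap * u * (v - v') + th - th'.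
have -> : (1 + kap * u) * (al - al') - q * T = (v - v') * im + kap * u * a2 + y * T2.
  by rewrite /a2 /T2 /al /al' /T /q /y; ring.
have h1 := nl1; have h2 := nz; have [m0 m1 m2 m3 m4] := monos; have w0' := w0.
have na2 : `|a2| <= 6 * w ^+ 2 by rewrite /a2; nbt; lra.
have nT2 : `|T2| <= 3 * (w ^+ 2 * z) by rewrite /T2; nbt; lra.
have h3 := ny.
clearbody a2 T2 y; nbt.
have [t0 t1 t2] := mono3; lra.
Qed.

Lemma nr3 : `|al - (l * q + v)| <= 5 * w ^+ 2 /\ `|al' - (l * q + v')| <= 5 * w ^+ 2.
Proof.
have [m0 m1 m2 m3 m4] := monos; have w0' := w0; have hl := nl.
split.
  have -> : al - (l * q + v) = - (v * (f' - g)) - th' + rho + l * im by rewrite /al /q /y; ring.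
  by nbt; lra.
have -> : al' - (l * q + v') = - (v' * (f - g)) - th + rho + l * im by rewrite /al' /q /y; ring.
by nbt; lra.
Qed.

Lemma w_ell : w <= ell / 800.
Proof.
have [a b] := ell_bounds; have [s1 s2 s3 s4] := sizes.
have h1 : 0 <= ell * o * (1 / 4 - ell) by apply: mulr_ge0; [apply: mulr_ge0|]; lra.
have h2 : 0 <= ell * (1 / 200 - o) by have o1' := o1; apply: gap_ge0 => //; apply: ltW.
have wo' := wo; lra.
Qed.

Lemma er_le : er <= D + w ^+ 2.
Proof.
have [m0 m1 m2 m3 m4] := monos; have [s1 s2 s3 s4] := sizes; have D0' := D0.
have a : 0 <= D * (1 / 200 - w) by apply: gap_ge0 => //; apply: ltW.
have b : 0 <= w ^+ 2 * (1 / 200 - w * z) by apply: gap_ge0 => //; apply: ltW.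
rewrite /er; lra.
Qed.

Let M := q * (E1 + E2).
Lemma nr : `|M - q * S0| <= 80 * w ^+ 2 + 2 * D.
Proof.
have [n3 n3'] := nr3.
pose r3 := al - (l * q + v); pose r3' := al' - (l * q + v').
have -> : M - q * S0 = q * (r3 + r3') - 2 * (l * q * (r3 + r3') + (v + r3) * (v' + r3'))
   + (l * q + v + r3 + (l * q + v' + r3')) * im - 2 * Dh + r1 + r2.
  by rewrite /M mulrDr e1 e2 /r3 /r3' /S0; ring.
rewrite -/r3 in n3; rewrite -/r3' in n3'.
have [m0 m1 m2 m3 m4] := monos; have w0' := w0; have hl := nl; have er' := er_le; have [s1 s2 s3 s4] := sizes.
have hq : `|q| <= 2 by have := ny; rewrite /q !ler_norml; lra.
clearbody r3 r3' q; nbt.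
have b : 0 <= w ^+ 2 * (1 / 200 - w) by apply: gap_ge0 => //; apply: ltW.
have c : 0 <= w ^+ 2 * (1 / 200 - w ^+ 2) by apply: mulr_ge0 => //; lra.
lra.
Qed.

Lemma qS0 : `|q * S0 - 2 * ell| <= 7 * w.
Proof.
have -> : q * S0 - 2 * ell = 2 * ell * ((- y) * (2 - y)) + (1 - 2 * l) * (v + v') * (1 - y) by rewrite /S0 /q; ring.
have hy := ny; have he := nell; have h1 := nl1; have [s1 s2 s3 s4] := sizes.
clearbody y; nbt.
have w0' := w0; have b : 0 <= w * (1 / 200 - w) by apply: gap_ge0 => //; apply: ltW.
lra.
Qed.

Lemma nQ : `|Q - Q0| <= 7 * D + 40 * (w ^+ 2 * z).
Proof.
pose a1 := p - (l + u + v); pose a2 := p' - (l + u + v'); pose a3 := p1 - (l + u + v').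
have -> : Q - Q0 = a1 + a2 - 2 * (l * (a1 + a3) + (u + v + a1) * (u + v' + a3)).
  by rewrite /Q /Q0 /a1 /a2 /a3; ring.
have n1 : `|a1| <= ep by exact: hp.
have n2 : `|a2| <= ep by exact: hp'.
have n3 : `|a3| <= ep by exact: hp1.
have [m0 m1 m2 m3 m4] := monos; have w0' := w0; have hl := nl; have [s1 s2 s3 s4] := sizes.
have D0' := D0; have D2' := D2; have [a b] := ell_bounds.
have ep1 : ep <= D + w / 40 by rewrite /ep; lra.
have ep0 : 0 <= ep by rewrite /ep; lra.
clearbody a1 a2 a3; nbt.
have -> : w + w + ep = 2 * w + ep by ring.
have : (2 * w + ep) * (2 * w + ep) <= (3 * w + D) * (3 * w + D) by apply: ler_pM; lra.
have b1 : 0 <= D * (1 / 200 - w) by apply: gap_ge0 => //; apply: ltW.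
have b2 : 0 <= D * (1 / 80 - D) by apply: mulr_ge0 => //; lra.
rewrite /ep; lra.
Qed.

Lemma nQ0 : `|Q0| <= 2 * ell + 4 * w.
Proof.
have he : `|ell| <= ell by have [a b] := ell_bounds; rewrite ger0_norm // ltW.
have h1 := nl1; rewrite /Q0; nbt; lra.
Qed.

Lemma nX0 : `|Q0 * (al - al') * q - T * q * S0| <= 40 * (w ^+ 3 * z).
Proof.
pose r5 := (1 - 2 * l) * (v + v') * (- y) - kap * (1 - 2 * l) * u * (v + v').
pose Y := (1 + kap * u) * (al - al') - q * T.
(* [Q0 * q] equals [S0 * (1 + kap * u) + r5] with [r5] of second order, which leads back to
   [nmain]. *)
have -> : Q0 * (al - al') * q - T * q * S0 = S0 * Y + r5 * (al - al').
  have : 0 = 2 * (1 - 2 * l) * u * q * (1 - ell * z) * (al - al') by rewrite ez subrr mulr0 mul0r.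
  by move=> h; rewrite -[RHS]addr0 {1}h /r5 /Y /Q0 /S0 /q; ring.
have nY : `|Y| <= 20 * (w ^+ 3 * z) by exact: nmain.
have nA := nal; have hy := ny; have he := nell; have h1 := nl1; have h2 := nz.
have [m0 m1 m2 m3 m4] := monos; have [t0 t1 t2] := mono3; have w0' := w0; have [s1 s2 s3 s4] := sizes.
have n5 : `|r5| <= 4 * (w ^+ 2 * z) by rewrite /r5; clearbody y; nbt; lra.
have nS : `|S0| <= 1.
  have hq : `|q| <= 3 / 2 by rewrite /q !ler_norml; move: hy; rewrite ler_norml; lra.
  by rewrite /S0; clearbody q; nbt; lra.
move: nY nA n5 nS; move: (al - al') => A; clearbody Y r5 S0 => nY nA n5 nS.
by nbt; lra.
Qed.

Lemma DD_le : D * D <= 100 * ell * o * D.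
Proof. by rewrite ler_wpM2r. Qed.

Lemma w_le : w <= ell * o / 4.
Proof.
have [a b] := ell_bounds; have [s1 s2 s3 s4] := sizes; have wo' := wo.
have : 0 <= ell * o * (1 / 4 - ell) by apply: gap_ge0 => //; apply: mulr_ge0; apply: ltW.
lra.
Qed.

Lemma wD_le : w * D <= ell * o * D / 4.
Proof. by rewrite [leRHS]mulrAC ler_wpM2r // w_le. Qed.

Lemma w3z_le : w ^+ 3 * z <= ell * o ^+ 3.
Proof.
have [a b] := ell_bounds; have [s1 s2 s3 s4] := sizes; have wo' := wo; have w1 := ltW w0.
have z0 : 0 <= z by apply: le_trans z_ge4.
have wz0 : 0 <= w * z by apply: mulr_ge0.
have h1 : w * (w * z) <= ell ^+ 2 * o * (ell * o) by apply: ler_pM.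
have h3 : w * (w * (w * z)) <= ell ^+ 2 * o * (ell ^+ 2 * o * (ell * o)).
  by apply: ler_pM => //; apply: mulr_ge0.
have h4 : 0 <= ell * o ^+ 3 by rewrite mulr_ge0 ?exprn_ge0 // ltW.
have ell1 : ell <= 1 by apply: le_trans b _; rewrite ler_pdivrMr // mul1r ler1n.
have h5 : ell ^+ 4 <= 1 by rewrite exprn_ile1 // ltW.
have h6 : ell ^+ 4 * (ell * o ^+ 3) <= 1 * (ell * o ^+ 3) by rewrite ler_wpM2r.
have -> : w ^+ 3 * z = w * (w * (w * z)) by ring.
apply: le_trans h3 _; rewrite -[leRHS]mul1r; apply: le_trans h6.
by rewrite le_eqVlt; apply/orP; left; apply/eqP; ring.
Qed.

Lemma nq : `|q| <= 2.
Proof. by have [s1 s2 s3 s4] := sizes; have := ny; rewrite /q !ler_norml; lra. Qed.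

Lemma M_ge : ell <= M.
Proof.
have we := w_ell; have [M1 _] := nbE nr; have [M3 _] := nbE qS0; have D2' := D2.
by have [e0 _] := ell_bounds; have [_ m1 _ _ _] := monos; lra.
Qed.

Lemma Q_le : `|Q| <= M + 30 * w + 12 * D.
Proof.
have [_ m1 _ m3 _] := monos; have w0' := w0; have D0' := D0.
have [M1 _] := nbE nr; have [M3 _] := nbE qS0; have [Q1 Q2] := nbE nQ; have [Q3 Q4] := nbE nQ0.
by rewrite ler_norml; lra.
Qed.

Lemma Q_le2 : `|Q| <= 2.
Proof.
have [_ _ _ m3 _] := monos; have we := w_ell; have D2' := D2; have [a b] := ell_bounds.
by have [Q1 Q2] := nbE nQ; have [Q3 Q4] := nbE nQ0; rewrite ler_norml; lra.
Qed.

Lemma rest_le : `|(Q - Q0) * (al - al') * q + Q * (al - al') * im - T * (M - q * S0)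
   + (Q0 * (al - al') * q - T * q * S0)| <= 48 * (w * D) + 560 * (w ^+ 3 * z).
Proof.
have [t0 t1 t2] := mono3.
move: nX0 nT nr nQ nal Q_le2 nq him.
move: (Q0 * (al - al') * q - T * q * S0) (M - q * S0) (Q - Q0) (al - al').
clearbody T Q q => y1 y2 y3 y4 n1 n2 n3 n4 n5 n6 hq hi.
by nbt; lra.
Qed.

Lemma absorb_le : 6 * (D * D) + 470 * (w * D) + 1000 * (w ^+ 3 * z) <= 1100 * (o * D + o ^+ 3) * ell.
Proof.
have := DD_le; have := wD_le; have := w3z_le.
have [e0 _] := ell_bounds; have [_ _ _ o0] := sizes.
have := mulr_ge0 (mulr_ge0 (ltW e0) (ltW o0)) D0.
have := mulr_ge0 (ltW e0) (exprn_ge0 3 (ltW o0)).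
by move: (D * D) (w * D) (w ^+ 3 * z) => x1 x2 x3; lra.
Qed.

(* The equations [e1], [e2] give E1 and E2 up to error about D/4 each; since (p - p') (E1 + E2) = Q (E2 - E1) with Q close to q (E1 + E2), the error D is halved. *)
Lemma step_num : `|p - p' - T| <= D / 2 + 1100 * (o * D + o ^+ 3).
Proof.
(* In [E2 - E1] the covariance [Dh] cancels. It survives only in the sum [M], where its second order
   bound suffices. *)
have EQ : (p - p' - T) * M = Q * (r2 - r1) + ((Q - Q0) * (al - al') * q + Q * (al - al') * im - T * (M - q * S0)
   + (Q0 * (al - al') * q - T * q * S0)).
  have : (p - p') * M = Q * (al - al') * (q + im) + Q * (r2 - r1).
    transitivity (q * ((p - p') * (E1 + E2))); first by rewrite /M; ring.
    by rewrite AB mulrCA mulrBr e1 e2; ring.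
  by move=> h; rewrite mulrBl h; ring.
have nrr : `|r2 - r1| <= er + er by nb.
have [e0 _] := ell_bounds; have M0 := lt_le_trans e0 M_ge.
have [_ _ t2] := mono3; have [_ _ _ o0] := sizes.
have wD0 : 0 <= w * D by apply: mulr_ge0; [exact: ltW|].
have fin : `|p - p' - T| * M <= D / 2 * M + (6 * (D * D) + 470 * (w * D) + 1000 * (w ^+ 3 * z)).
  rewrite -[X in _ * X <= _](gtr0_norm M0) -normrM EQ.
  apply: le_trans (ler_normD _ _) _.
  have Qr : `|Q * (r2 - r1)| <= `|Q| * (er + er) by rewrite normrM ler_wpM2l.
  exact: (perturb_le D0 wD0 t2 Q_le Q_le2 (erefl er) Qr rest_le).
rewrite -(ler_pM2r M0); apply: le_trans fin _; rewrite [leRHS]mulrDl lerD2l.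
apply: le_trans absorb_le _; rewrite ler_wpM2l ?M_ge //.
by rewrite mulr_ge0 // addr_ge0 ?exprn_ge0 ?mulr_ge0 // ltW.
Qed.
End StepNumeric.

(** * Contraction of the error *)

Lemma norm_sum_le (R : realFieldType) (T : finType) (P : pred T) (F : T -> R) c :
  (forall i, P i -> `|F i| <= c) -> `|\sum_(i | P i) F i| <= c * #|P|%:R.
Proof.
move=> Fc; apply: le_trans (ler_norm_sum _ _ _) _.
apply: (@le_trans _ _ (\sum_(i | P i) c)); first exact: ler_sum.
by rewrite sumr_const mulr_natr.
Qed.

Lemma avg_diff (R : realFieldType) (T : finType) (P : pred T) (F : T -> R) c i :
  P i -> 0 <= c -> (forall k, P k -> k != i -> `|F i - F k| <= c) ->
  `|F i - (\sum_(k | P k) F k) / #|P|%:R| <= c.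
Proof.
move=> Pi c0 Fc; have P0 : 0 < #|P|%:R :> R by rewrite ltr0n; apply/card_gt0P; exists i.
have -> : F i - (\sum_(k | P k) F k) / #|P|%:R = (\sum_(k | P k) (F i - F k)) / #|P|%:R.
  by rewrite sumrB sumr_const mulrBl -[F i *+ _]mulr_natr mulfK // gt_eqF.
rewrite normrM normfV (gtr0_norm P0) ler_pdivrMr //.
apply: norm_sum_le => k Pk; have [->|ki] := eqVneq k i; first by rewrite subrr normr0.
exact: Fc.
Qed.

Section DiffDef.
Variables (R : realFieldType) (m n : nat) (s : 'I_m -> nat) (t : 'I_n -> nat) (l : R).
(* [diffR v D] and [diffC v D]: in every state with parameters at most [v], differences of [pr] along rows (columns) agree with those of [phi] up to [D]. *)
Definition diffR (v D : R) := forall I O, good s t l v I O -> 0 < cnt R s t I O ->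
  forall j k k', k != k' -> (j, k) \notin I :|: O -> (j, k') \notin I :|: O ->
  `|pr R s t I O (j, k) - pr R s t I O (j, k') - (phi s t l I O j k - phi s t l I O j k')| <= D.
Definition diffC (v D : R) := forall I O, good s t l v I O -> 0 < cnt R s t I O ->
  forall j j' k, j != j' -> (j, k) \notin I :|: O -> (j', k) \notin I :|: O ->
  `|pr R s t I O (j, k) - pr R s t I O (j', k) - (phi s t l I O j k - phi s t l I O j' k)| <= D.
End DiffDef.

Lemma diff_tr (R : realFieldType) (m n : nat) (s : 'I_m -> nat) (t : 'I_n -> nat) (l v D : R) :
  (0 < n)%N -> (0 < m)%N -> (\sum_j s j = \sum_k t k)%N ->
  (diffR t s l v D <-> diffC s t l v D).
Proof.
move=> n0 m0 st; split=> H I O.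
  move=> g c j j' k jj e e'.
  have := H (tr I) (tr O) (good_tr n0 m0 st g); rewrite cnt_tr => /(_ c k j j' jj).
  by rewrite -trU !in_tr !pr_tr !phi_tr //; apply.
move=> g c j k k' kk e e'.
have := H (tr I) (tr O) (good_tr m0 n0 (esym st) g); rewrite cnt_tr => /(_ c k k' j kk).
by rewrite -trU !in_tr !pr_tr !phi_tr //; apply.
Qed.

(** * From differences to values *)

Section Approx.
Variables (R : realFieldType) (m n : nat) (s : 'I_m -> nat) (t : 'I_n -> nat) (l w o : R).
Local Notation Om := (Om s t).
Local Notation cnt := (cnt R s t).
Local Notation pr := (pr R s t).
Local Notation Ex := (@Ex R m n s t).
Local Notation ell := (l * (1 - l)).
Local Notation z := (ell^-1).
Local Notation good := (good s t l).
Local Notation uu := (uu s l). Local Notation vv := (vv t l).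
Local Notation xi := (@xi R m n). Local Notation ze := (@ze R m n).
Local Notation sg := (sg s l). Local Notation th := (th s l). Local Notation ph := (ph t l).
Local Notation phi := (phi s t l).
Hypotheses (n0 : (0 < n)%N) (m0 : (0 < m)%N) (st : (\sum_j s j = \sum_k t k)%N).
Hypotheses (l01 : 0 < l < 1) (w0 : 0 < w) (wo : w <= ell ^+ 2 * o) (o1 : o <= 1 / 200).

Let nR : n%:R != 0 :> R. Proof. by rewrite pnatr_eq0 -lt0n. Qed.
Let mR : m%:R != 0 :> R. Proof. by rewrite pnatr_eq0 -lt0n. Qed.
Let n1 : 0 < n%:R :> R. Proof. by rewrite ltr0n. Qed.
Let m1 : 0 < m%:R :> R. Proof. by rewrite ltr0n. Qed.
Let e0 : 0 < ell. Proof. by have [] := ell_bounds l01. Qed.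
Let ez : ell * z = 1. Proof. by rewrite divff // gt_eqF. Qed.
Let sz := sizes l01 ez w0 wo o1.
Let mo := monos l01 ez w0 wo o1.
Let mo3 := mono3 l01 ez w0 wo o1.

Lemma kapE : kap l = (1 - 2 * l) * z. Proof. by []. Qed.
Lemma nkap : `|kap l| <= z.
Proof.
rewrite kapE normrM (gtr0_norm (x := z)) ?invr_gt0 // ler_piMl ?invr_ge0 ?(ltW e0) //.
exact: nl1.
Qed.

Section State.
Variables (I O : {set 'I_m * 'I_n}).
Hypothesis gd : good w I O.
Local Notation H := (I :|: O).

Lemma xi_ge0 j : 0 <= xi I O j. Proof. by rewrite divr_ge0. Qed.
Lemma ze_ge0 k : 0 <= ze I O k. Proof. by rewrite divr_ge0. Qed.
Lemma nxi j : `|xi I O j| <= w. Proof. by rewrite ger0_norm ?xi_ge0 //; exact: g_x gd j. Qed.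
Lemma nze k : `|ze I O k| <= w. Proof. by rewrite ger0_norm ?ze_ge0 //; exact: g_z gd k. Qed.

Lemma sum_th_le (P : pred 'I_m) k (F : 'I_m -> R) : (forall j, `|F j| <= w) -> (forall j, P j -> (j, k) \in H) ->
  `|(\sum_(j | P j) F j) / m%:R| <= w ^+ 2.
Proof.
move=> Fw PH; rewrite normrM normfV (gtr0_norm m1) ler_pdivrMr //.
apply: le_trans (norm_sum_le (fun j _ => Fw j)) _.
rewrite expr2 -mulrA ler_wpM2l ?(ltW w0) //.
apply: (@le_trans _ _ (ze I O k * m%:R)); last by rewrite ler_wpM2r //; exact: g_z gd k.
rewrite /ze divfK // ler_nat; apply: subset_leq_card; apply/subsetP => j jP.
by rewrite inE; apply: PH.
Qed.

Lemma sum_ph_le (P : pred 'I_n) j (F : 'I_n -> R) : (forall k, `|F k| <= w) -> (forall k, P k -> (j, k) \in H) ->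
  `|(\sum_(k | P k) F k) / n%:R| <= w ^+ 2.
Proof.
move=> Fw PH; rewrite normrM normfV (gtr0_norm n1) ler_pdivrMr //.
apply: le_trans (norm_sum_le (fun j _ => Fw j)) _.
rewrite expr2 -mulrA ler_wpM2l ?(ltW w0) //.
apply: (@le_trans _ _ (xi I O j * n%:R)); last by rewrite ler_wpM2r //; exact: g_x gd j.
rewrite /xi divfK // ler_nat; apply: subset_leq_card; apply/subsetP => k kP.
by rewrite inE; apply: PH.
Qed.

Lemma nth_ k : `|th I O k| <= w ^+ 2. Proof. exact: (sum_th_le (g_u gd) (fun j => id)). Qed.
Lemma nph j : `|ph I O j| <= w ^+ 2. Proof. exact: (sum_ph_le (g_v gd) (fun j => id)). Qed.

Lemma phi_first j k : `|phi I O j k - (l + uu I O j + vv I O k)| <= 3 * (w ^+ 2 * z).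
Proof.
rewrite /phi.
have h1 := nxi j; have h2 := nze k; have h3 := nth_ k; have h4 := nph j.
have h5 := g_u gd j; have h6 := g_v gd k; have h7 := g_sg gd; have h8 := nkap.
have [q0 q1 q2 q3 q4] := mo.
move: (uu _ _ _) (vv _ _ _) (xi _ _ _) (ze _ _ _) (th _ _ _) (ph _ _ _) (sg _ _) (kap l) h1 h2 h3 h4 h5 h6 h7 h8.
move=> u v x y a b c d h1 h2 h3 h4 h5 h6 h7 h8.
have -> : l + u + v - c + u * x + v * y + d * u * v + b + a - (l + u + v) = - c + u * x + v * y + d * u * v + b + a by ring.
by nbt; lra.
Qed.

Lemma sum_ze : \sum_k (ze I O k) = #|H|%:R / m%:R.
Proof. by rewrite -mulr_suml -natr_sum sum_degv. Qed.

Lemma Hn_le : #|H|%:R / m%:R <= w ^+ 2 * n%:R.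
Proof. by rewrite ler_pdivrMr // -mulrA [n%:R * _]mulrC; exact: g_H gd. Qed.

Lemma row_card j : #|[pred k | (j, k) \notin H]|%:R = n%:R * (1 - xi I O j) :> R.
Proof. by rewrite -(row_free R n0) -sum1_card natr_sum. Qed.

(** The sum of [vv] over the unrevealed pairs of the row is n (sg - ph), which is compensated by
    [- sg + ph] in each term. The sums of [vv * ze] and of [th] are of third order because only a
    proportion [w ^+ 2] of all pairs is revealed. *)
Lemma row_phi j : `|(\sum_(k | (j, k) \notin H) phi I O j k) - n%:R * (uu I O j + l * (1 - xi I O j))|
   <= n%:R * (4 * (w ^+ 3 * z)).
Proof.
have Sv : \sum_(k | (j, k) \notin H) vv I O k = n%:R * (sg I O - ph I O j).
  rewrite (sgE' l n0 m0 st) /ph -mulrBl mulrCA divff // mulr1.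
  by rewrite [X in _ = X - _](bigID (fun k => (j, k) \in H)) /= addrAC subrr add0r.
have S1 : \sum_(k | (j, k) \notin H) 1 = n%:R * (1 - xi I O j) :> R by exact: row_free.
pose V := \sum_(k | (j, k) \notin H) vv I O k * ze I O k.
pose TH := \sum_(k | (j, k) \notin H) th I O k.
have -> : \sum_(k | (j, k) \notin H) phi I O j k =
   n%:R * ((1 - xi I O j) * (l + uu I O j - sg I O + uu I O j * xi I O j + ph I O j)
   + (1 + kap l * uu I O j) * (sg I O - ph I O j)) + V + TH.
  transitivity (\sum_(k | (j, k) \notin H) ((l + uu I O j - sg I O + uu I O j * xi I O j + ph I O j) * 1
     + (1 + kap l * uu I O j) * vv I O k + vv I O k * ze I O k + th I O k)).
    by apply: eq_bigr => k _; rewrite /phi; ring.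
  by rewrite !big_split /= -!mulr_sumr S1 Sv -/V -/TH; ring.
have Hn := Hn_le.
have nV : `|V| <= n%:R * w ^+ 3.
  apply: le_trans (ler_norm_sum _ _ _) _.
  apply: (@le_trans _ _ (\sum_k w * ze I O k)).
    rewrite [leLHS]big_mkcond; apply: ler_sum => k _; case: ifP => _; last by rewrite mulr_ge0 ?ze_ge0 // ltW.
    by rewrite normrM [X in _ * X]ger0_norm ?ze_ge0 // ler_wpM2r ?ze_ge0 //; exact: g_v gd k.
  by rewrite -mulr_sumr sum_ze exprS [leRHS]mulrCA ler_wpM2l ?(ltW w0) // [leRHS]mulrC.
have nTH : `|TH| <= n%:R * w ^+ 3.
  apply: le_trans (ler_norm_sum _ _ _) _.
  apply: (@le_trans _ _ (\sum_k w * ze I O k)).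
    rewrite [leLHS]big_mkcond; apply: ler_sum => k _; case: ifP => _; last by rewrite mulr_ge0 ?ze_ge0 // ltW.
    rewrite /th /ze normrM normfV (gtr0_norm m1) mulrA ler_wpM2r ?invr_ge0 //.
    apply: le_trans (norm_sum_le (fun j _ => g_u gd j)) _.
    rewrite ler_wpM2l ?(ltW w0) // ler_nat; apply: subset_leq_card; apply/subsetP => i iP.
    by rewrite inE.
  by rewrite -mulr_sumr sum_ze exprS [leRHS]mulrCA ler_wpM2l ?(ltW w0) // [leRHS]mulrC.
have h1 := nxi j; have h4 := nph j.
have h5 := g_u gd j; have h7 := g_sg gd; have h8 := nkap.
have [q0 q1 q2 q3 q4] := mo; have [t0 t1 t2] := mo3.
move: (uu _ _ _) (xi _ _ _) (ph _ _ _) (sg _ _) (kap l) h1 h4 h5 h7 h8 => u x p g kp h1 h4 h5 h7 h8.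
have -> : n%:R * ((1 - x) * (l + u - g + u * x + p) + (1 + kp * u) * (g - p)) + V + TH - n%:R * (u + l * (1 - x)) =
  n%:R * (- (u * x * x) + x * (g - p) + kp * u * (g - p)) + V + TH by ring.
have inner : `|- (u * x * x) + x * (g - p) + kp * u * (g - p)| <= 3 * w ^+ 3 + 2 * (w ^+ 3 * z).
  by nbt; lra.
have : `|n%:R * (- (u * x * x) + x * (g - p) + kp * u * (g - p)) + V + TH| <=
  n%:R * (3 * w ^+ 3 + 2 * (w ^+ 3 * z)) + n%:R * w ^+ 3 + n%:R * w ^+ 3.
  by apply: nbD => //; apply: nbD => //; rewrite normrM ger0_norm // ler_wpM2l.
move=> h; apply: le_trans h _; rewrite -!mulrDr ler_wpM2l //; lra.
Qed.

Lemma Ex_row j : 0 < cnt I O -> \sum_(k | (j, k) \notin H) pr I O (j, k) = n%:R * (uu I O j + l * (1 - xi I O j)).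
Proof.
move=> c0; rewrite -[RHS](Ex_cst (s := s) (t := t) (I := I) (O := O)) // -Ex_sum.
by apply: eq_Ex => G GO; rewrite (row_sum (s := s) l n0 j GO).
Qed.

(* Both [pr] and [phi] have (nearly) the prescribed row sums, so closeness of differences along the row gives closeness of values. *)
Lemma pr_phi D j k : 0 < cnt I O -> 0 <= D -> (j, k) \notin H ->
  (forall k', k' != k -> (j, k') \notin H ->
    `|pr I O (j, k) - pr I O (j, k') - (phi I O j k - phi I O j k')| <= D) ->
  `|pr I O (j, k) - phi I O j k| <= D + 5 * (w ^+ 3 * z).
Proof.
move=> c0 D0 jk hD.
have A := @avg_diff R _ [pred k | (j, k) \notin H] (fun k => pr I O (j, k) - phi I O j k) D k jk D0.
have {}A : `|pr I O (j, k) - phi I O j k - (\sum_(k | (j, k) \notin H) (pr I O (j, k) - phi I O j k)) / (n%:R * (1 - xi I O j))| <= D.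
  rewrite -row_card; apply: A => k' jk' kk.
  have -> : pr I O (j, k) - phi I O j k - (pr I O (j, k') - phi I O j k') =
    pr I O (j, k) - pr I O (j, k') - (phi I O j k - phi I O j k') by ring.
  exact: hD.
have w1 : 0 < 1 - xi I O j.
  have := g_x gd j; have [s1 s2 s3 s4] := sz; lra.
rewrite sumrB Ex_row // in A.
rewrite -[pr I O (j, k) - phi I O j k](subrK ((n%:R * (uu I O j + l * (1 - xi I O j)) - \sum_(k | (j, k) \notin H) phi I O j k) / (n%:R * (1 - xi I O j)))).
apply: nbD => //; rewrite normrM normfV distrC.
rewrite [X in _ / X]gtr0_norm ?mulr_gt0 // ler_pdivrMr ?mulr_gt0 //.
apply: le_trans (row_phi j) _; rewrite [leRHS]mulrCA ler_wpM2l //.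
have := g_x gd j; have [s1 s2 s3 s4] := sz; have [t0 t1 t2] := mo3 => xw.
have : (w ^+ 3 * z) * xi I O j <= (w ^+ 3 * z) * w by rewrite ler_wpM2l.
have : 0 <= (w ^+ 3 * z) * (1 / 200 - w) by apply: gap_ge0 => //; apply: ltW.
lra.
Qed.
End State.
End Approx.

(** * A crude estimate as starting point *)

Section Crude.
Variables (R : realFieldType) (m n : nat) (s : 'I_m -> nat) (t : 'I_n -> nat) (l w o h : R).
Local Notation Om := (Om s t).
Local Notation cnt := (cnt R s t).
Local Notation pr := (pr R s t).
Local Notation ell := (l * (1 - l)).
Local Notation z := (ell^-1).
Local Notation good := (good s t l).
Local Notation uu := (uu s l). Local Notation vv := (vv t l).
Local Notation phi := (phi s t l).
Hypotheses (n0 : (0 < n)%N) (m0 : (0 < m)%N) (st : (\sum_j s j = \sum_k t k)%N).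
Hypotheses (l01 : 0 < l < 1) (w0 : 0 < w) (wo : w <= ell ^+ 2 * o) (o1 : o <= 1 / 200).
Hypotheses (hm : 1 <= h * m%:R) (hn : 1 <= h * n%:R) (hw : h <= w ^+ 2) (o2 : 44 * o <= 1 / 20).

Let n1 : 0 < n%:R :> R. Proof. by rewrite ltr0n. Qed.
Let m1 : 0 < m%:R :> R. Proof. by rewrite ltr0n. Qed.
Let e0 : 0 < ell. Proof. by have [] := ell_bounds l01. Qed.
Let ez : ell * z = 1. Proof. by rewrite divff // gt_eqF. Qed.
Let sz := sizes l01 ez w0 wo o1.
Let mo := monos l01 ez w0 wo o1.
Let mo3 := mono3 l01 ez w0 wo o1.
Let h0 : 0 < h. Proof. exact: (h_gt0 n0 hn). Qed.

Lemma h_le_w : h <= w.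
Proof. by have [q0 q1 q2 q3 q4] := mo; have hw' := hw; have w0' := w0; lra. Qed.
Lemma w_m : 1 <= w * m%:R.
Proof. by apply: le_trans hm _; rewrite ler_wpM2r // h_le_w. Qed.
Lemma wl80 : 80 * w <= ell.
Proof. by have := w_ell l01 ez w0 wo o1; have w0' := w0; have e0' := e0; lra. Qed.

Lemma good_le v v' I O : 0 <= v -> v <= v' -> good v I O -> good v' I O.
Proof.
move=> v0 vv' [d gu gx gv gz gs gH]; have v'0 := le_trans v0 vv'.
have v2 : v ^+ 2 <= v' ^+ 2 by rewrite ler_sqr.
split => //.
- by move=> j; apply: le_trans (gu j) vv'.
- by move=> j; apply: le_trans (gx j) vv'.
- by move=> j; apply: le_trans (gv j) vv'.
- by move=> j; apply: le_trans (gz j) vv'.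
- exact: le_trans gs v2.
- by apply: le_trans gH _; rewrite ler_wpM2r // mulr_ge0.
Qed.

(** Graphs containing both pairs cancel, leaving the two sets of graphs that a switch maps to each
    other. *)
Lemma pr_pair I O e e' : pr I O e - pr I O e' = (cnt (e |: I) (e' |: O) - cnt (e' |: I) (e |: O)) / cnt I O.
Proof.
rewrite !prE -mulrBl (cnt_split R s t (e |: I) O e') (cnt_split R s t (e' |: I) O e) setUCA.
by congr (_ / _); ring.
Qed.

Lemma cnt_in_le I O e : cnt (e |: I) O <= cnt I O.
Proof. by rewrite (cnt_split R s t I O e) lerDl cnt_ge0. Qed.
Lemma cnt_out_le I O e : cnt I (e |: O) <= cnt I O.
Proof. by rewrite (cnt_split R s t I O e) lerDr cnt_ge0. Qed.

Lemma good2 v I O e e' : 0 <= v -> v + h + h <= w -> good v I O -> e != e' -> e \notin I :|: O -> e' \notin I :|: O ->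
  good (v + h + h) (e |: I) (e' |: O).
Proof.
move=> v0 vw g ee eH eH'.
have v1 : 0 <= v + h by rewrite addr_ge0 // ltW.
apply: (good_out n0 m0 l01 hm hn) => //; first exact: (good_in n0 m0 l01 hm hn).
by rewrite UI in_setU1 negb_or eq_sym ee.
Qed.

Lemma edge_neq (j : 'I_m) (k k' : 'I_n) : k != k' -> (j, k) != (j, k').
Proof. by rewrite xpair_eqE eqxx. Qed.

(** Both directions of [crude_le] contribute 32 + 8 = 40 to the constant, the difference of [phi]
    itself at most 3. The room [h + h] is for revealing the two pairs. *)
Lemma crude_diff v : 0 <= v -> v + h + h <= w -> diffR s t l v (43 * (w * z)).
Proof.
move=> v0 vw I O g c j k k' kk e e'.
have ke := edge_neq j kk; have ke' : (j, k') != (j, k) by rewrite eq_sym.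
have gA := good_le _ vw (good2 v0 vw g ke e e').
have gB := good_le _ vw (good2 v0 vw g ke' e' e).
have vh : 0 <= v + h + h by rewrite !addr_ge0 // ltW.
have cA := crude_le n0 m0 l01 wl80 w_m kk e e' (gA vh) (gB vh).
have kk' : k' != k by rewrite eq_sym.
have cB := crude_le n0 m0 l01 wl80 w_m kk' e' e (gB vh) (gA vh).
have A1 := le_trans (cnt_in_le I ((j, k') |: O) (j, k)) (cnt_out_le I O (j, k')).
have B1 := le_trans (cnt_in_le I ((j, k) |: O) (j, k')) (cnt_out_le I O (j, k)).
have A0 := cnt_ge0 R s t ((j, k) |: I) ((j, k') |: O).
have B0 := cnt_ge0 R s t ((j, k') |: I) ((j, k) |: O).
have p0 : `|pr I O (j, k) - pr I O (j, k')| <= 40 * (w * z).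
  rewrite pr_pair normrM normfV (gtr0_norm c) ler_pdivrMr //.
  move: cA cB A1 B1 A0 B0; move: (cnt _ (_ |: O)) (cnt (_ |: I) _) (cnt I O) => A B N cA cB A1 B1 A0 B0.
  have x0 : 0 <= w * z by rewrite mulr_ge0 ?invr_ge0 // ltW.
  have XA : (w * z) * A <= (w * z) * N by rewrite ler_wpM2l.
  have XB : (w * z) * B <= (w * z) * N by rewrite ler_wpM2l.
  rewrite ler_norml; apply/andP; split; lra.
have vw' : v <= w by have h0' := h0; lra.
have gw := good_le v0 vw' g.
have q1 := phi_first n0 m0 l01 w0 wo o1 gw j k.
have q2 := phi_first n0 m0 l01 w0 wo o1 gw j k'.
have q3 := g_v gw k; have q4 := g_v gw k'.
apply: le_trans (_ : 40 * (w * z) + 3 * (w * z) <= _); last by lra.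
apply: nbD => //; apply: nbN.
have -> : phi I O j k - phi I O j k' = phi I O j k - (l + uu I O j + vv I O k) -
  (phi I O j k' - (l + uu I O j + vv I O k')) + (vv I O k - vv I O k') by ring.
have [p1 p2 p3 p4 p5] := mo; have w0' := w0.
have z4 : 0 <= w * (z - 4) by have z4 := z_ge4 l01 ez; apply: gap_ge0 => //; apply: ltW.
by nbt; lra.
Qed.

Lemma pr_first v D I O j k : 0 <= v <= w -> 0 <= D -> diffR s t l v D -> good v I O -> 0 < cnt I O ->
  (j, k) \notin I :|: O -> `|pr I O (j, k) - (l + uu I O j + vv I O k)| <= D + 4 * (w ^+ 2 * z).
Proof.
move=> /andP[v0 vw] D0 dR g c jk; have gw := good_le v0 vw g.
have a : `|pr I O (j, k) - phi I O j k| <= D + 5 * (w ^+ 3 * z).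
  apply: (pr_phi n0 m0 st l01 w0 wo o1 gw c D0 jk) => k' kk jk'.
  by apply: dR => //; rewrite eq_sym.
have b := phi_first n0 m0 l01 w0 wo o1 gw j k.
rewrite -[pr _ _ _](subrK (phi I O j k)) -addrA.
apply: le_trans (nbD a b) _.
have [p1 p2 p3 p4 p5] := mo; have [t0 t1 t2] := mo3; have [s1 s2 s3 s4] := sz.
have : 0 <= w ^+ 2 * z * (1 / 200 - w) by apply: gap_ge0 => //; apply: ltW.
lra.
Qed.

Lemma crude_pr v I O j k : 0 <= v -> v + h + h <= w -> good v I O -> 0 < cnt I O ->
  (j, k) \notin I :|: O -> `|pr I O (j, k) - l| <= 45 * (w * z).
Proof.
move=> v0 vw g c jk.
have z4 : 0 <= w * (z - 4) by have z4 := z_ge4 l01 ez; have w0' := w0; apply: gap_ge0 => //; apply: ltW.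
have vw' : 0 <= v <= w by rewrite v0; have h0' := h0; lra.
have D0 : 0 <= 43 * (w * z) by have w0' := w0; lra.
have a := pr_first vw' D0 (crude_diff v0 vw) g c jk.
have gw := good_le v0 (andP vw').2 g.
have b := g_u gw j; have d := g_v gw k.
have -> : pr I O (j, k) - l = pr I O (j, k) - (l + uu I O j + vv I O k) + uu I O j + vv I O k by ring.
have [p1 p2 p3 p4 p5] := mo; have w0' := w0.
by nbt; lra.
Qed.

(** The error 45 w z is less than ell, hence less than both l and 1 - l. So either way of revealing
    a pair leaves a nonempty state, on which averages are meaningful. *)
Lemma pr_gt0_lt1 v I O j k : 0 <= v -> v + h + h <= w -> good v I O -> 0 < cnt I O ->
  (j, k) \notin I :|: O -> 0 < pr I O (j, k) < 1.
Proof.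
move=> v0 vw g c jk; have := crude_pr v0 vw g c jk.
have [l0 l1] := andP l01; have o0 : 0 < o by have [] := sz.
have [wz _ _ _] := sz.
have : 45 * (w * z) < ell.
  have e0' := e0; have h1 : 45 * (w * z) <= 45 * (ell * o) by rewrite ler_wpM2l.
  apply: le_lt_trans h1 _; rewrite mulrCA gtr_pMr //; have o2' := o2; lra.
have : 0 <= l * l by rewrite mulr_ge0 // ltW.
have : 0 <= (1 - l) * (1 - l) by apply: mulr_ge0; lra.
rewrite ler_norml => q1 q2 q3 /andP[q4 q5]; apply/andP; split; lra.
Qed.

Lemma cnt_in_gt0 v I O j k : 0 <= v -> v + h + h <= w -> good v I O -> 0 < cnt I O ->
  (j, k) \notin I :|: O -> 0 < cnt ((j, k) |: I) O.
Proof.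
move=> v0 vw g c jk; have /andP[p0 _] := pr_gt0_lt1 v0 vw g c jk.
by move: p0; rewrite prE pmulr_lgt0 // invr_gt0.
Qed.

Lemma cnt_out_gt0 v I O j k : 0 <= v -> v + h + h <= w -> good v I O -> 0 < cnt I O ->
  (j, k) \notin I :|: O -> 0 < cnt I ((j, k) |: O).
Proof.
move=> v0 vw g c jk; have /andP[_ p0] := pr_gt0_lt1 v0 vw g c jk.
by move: p0; rewrite -subr_gt0 pr_out // pmulr_lgt0 // invr_gt0.
Qed.
End Crude.

Lemma sum_antisym (R : realFieldType) (T : finType) (P : pred T) (g f : T -> T -> R) :
  (forall i j, P i -> P j -> f i j = - f j i) ->
  \sum_(i | P i) \sum_(j | P j) g i j * f i j =
  \sum_(i | P i) \sum_(j | P j) (g i j - g j i) * f i j / 2.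
Proof.
move=> fa.
have E : \sum_(i | P i) \sum_(j | P j) g j i * f i j = - \sum_(i | P i) \sum_(j | P j) g i j * f i j.
  rewrite exchange_big -sumrN; apply: eq_bigr => i Pi; rewrite -sumrN; apply: eq_bigr => j Pj.
  by rewrite (fa j i) // mulrN.
transitivity ((\sum_(i | P i) \sum_(j | P j) g i j * f i j - \sum_(i | P i) \sum_(j | P j) g j i * f i j) / 2).
  by rewrite E; field.
rewrite -sumrB mulr_suml; apply: eq_bigr => i _.
by rewrite -sumrB mulr_suml; apply: eq_bigr => j _; rewrite -mulrBl.
Qed.

Lemma nb_trans (R : realFieldType) (x y w a b : R) : `|x - y| <= a -> `|y - w| <= b -> `|x - w| <= a + b.
Proof. by move=> xa yb; rewrite -[x](subrK y) -addrA; apply: nbD. Qed.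

(** * The expected codegree of two columns *)

Section CodegreeExpectation.
Variables (R : realFieldType) (m n : nat) (s : 'I_m -> nat) (t : 'I_n -> nat) (l w o h : R).
Local Notation Om := (Om s t).
Local Notation cnt := (cnt R s t).
Local Notation pr := (pr R s t).
Local Notation Ex := (@Ex R m n s t).
Local Notation ell := (l * (1 - l)).
Local Notation z := (ell^-1).
Local Notation good := (good s t l).
Local Notation uu := (uu s l). Local Notation vv := (vv t l).
Local Notation phi := (phi s t l).
Hypotheses (n0 : (0 < n)%N) (m0 : (0 < m)%N) (st : (\sum_j s j = \sum_k t k)%N).
Hypotheses (l01 : 0 < l < 1) (w0 : 0 < w) (wo : w <= ell ^+ 2 * o) (o1 : o <= 1 / 200).
Hypotheses (hm : 1 <= h * m%:R) (hn : 1 <= h * n%:R) (hw : h <= w ^+ 2) (o2 : 44 * o <= 1 / 20).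

Let n1 : 0 < n%:R :> R. Proof. by rewrite ltr0n. Qed.
Let m1 : 0 < m%:R :> R. Proof. by rewrite ltr0n. Qed.
Let e0 : 0 < ell. Proof. by have [] := ell_bounds l01. Qed.
Let ez : ell * z = 1. Proof. by rewrite divff // gt_eqF. Qed.
Let sz := sizes l01 ez w0 wo o1.
Let mo := monos l01 ez w0 wo o1.
Let mo3 := mono3 l01 ez w0 wo o1.
Let h0 : 0 < h. Proof. exact: (h_gt0 n0 hn). Qed.

Variables (v D : R) (I O : {set 'I_m * 'I_n}) (k k' : 'I_n).
Hypotheses (v0 : 0 <= v) (vw : v + h + h + h + h <= w) (D0 : 0 <= D) (kk : k != k').
Hypotheses (dC : diffC s t l v D) (dC2 : diffC s t l (v + h + h) D).
Hypotheses (gd : good v I O) (c0 : 0 < cnt I O).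
Local Notation H := (I :|: O).
Local Notation J := (SJ H k k').
Let gw : good w I O.
Proof. by apply: good_le gd => //; have h0' := h0; have vw' := vw; lra. Qed.

Definition ind (e : 'I_m * 'I_n) (G : {set 'I_m * 'I_n}) : R := (e \in G)%:R.
Definition nin (e : 'I_m * 'I_n) (G : {set 'I_m * 'I_n}) : R := (e \notin G)%:R.
Lemma ninE e G : nin e G = 1 - ind e G.
Proof. by rewrite /nin /ind; case: (e \in G); rewrite ?subrr ?subr0. Qed.
Lemma Ex_ind e : Ex I O (ind e) = pr I O e. Proof. by []. Qed.

Definition gg j1 j2 : R := Ex I O (fun G => ind (j1, k) G * nin (j2, k) G).
(** This is |J| times the codegree of k and k' within J minus the product of the two column sums,
    that is, |J|^2 times the covariance of the columns. As a sum over pairs of rows it turns into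
    differences of probabilities within column k', after revealing one edge and one non-edge of
    column k. *)
Definition Wf G : R := \sum_(j1 in J) \sum_(j2 in J)
  ind (j1, k) G * (nin (j2, k) G * (ind (j1, k') G - ind (j2, k') G)).
(** The predicted covariance: rows of large excess favour both columns, which gives the variance of
    [uu]; against this, an edge in column k uses up part of the degree of its row, which gives
    [- ell / n]. *)
Definition Dhat : R := (\sum_(j1 in J) \sum_(j2 in J) (uu I O j1 - uu I O j2) ^+ 2 / 2) / m%:R ^+ 2 - ell / n%:R.

Lemma in_J j : j \in J -> (j, k) \notin H /\ (j, k') \notin H.
Proof. by rewrite inE => /andP. Qed.

Section Pair.
Variables (j1 j2 : 'I_m).
Hypotheses (J1 : j1 \in J) (J2 : j2 \in J) (jj : j1 != j2).
Let I2 := (j1, k) |: I.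
Let O2 := (j2, k) |: O.
Let e1H : (j1, k) \notin H. Proof. by have [] := in_J J1. Qed.
Let e2H : (j2, k) \notin H. Proof. by have [] := in_J J2. Qed.
Let ne : (j2, k) != (j1, k). Proof. by rewrite xpair_eqE eqxx andbT eq_sym. Qed.
Let e2H' : (j2, k) \notin (j1, k) |: I :|: O. Proof. by rewrite UI in_setU1 negb_or ne. Qed.
Let gI : good (v + h) I2 O. Proof. exact: (good_in n0 m0 l01 hm hn). Qed.
Let v0' : 0 <= v + h. Proof. by rewrite addr_ge0 // ltW. Qed.
Let g2 : good (v + h + h) I2 O2. Proof. exact: (good_out n0 m0 l01 hm hn). Qed.
Let cI : 0 < cnt I2 O.
Proof. by apply: (cnt_in_gt0 n0 m0 st l01 w0 wo o1 hm hn hw o2 v0) => //; have h0' := h0; have vw' := vw; lra. Qed.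
Let c2 : 0 < cnt I2 O2.
Proof. by apply: (cnt_out_gt0 n0 m0 st l01 w0 wo o1 hm hn hw o2 v0') => //; have h0' := h0; have vw' := vw; lra. Qed.
Let H2 : I2 :|: O2 = (j1, k) |: ((j2, k) |: H).
Proof. by rewrite UI UO. Qed.

Lemma vv2 k1 : k1 != k -> vv I2 O2 k1 = vv I O k1.
Proof. by move=> kk1; rewrite vv_out // vv_in //= (negPf kk1) /= !mul0r subr0 addr0. Qed.

Lemma ph2 j : j \in pred2 j1 j2 -> ph t l I2 O2 j = ph t l I O j + vv I2 O2 k / n%:R.
Proof.
move=> jP; have jH : (j, k) \notin H by case/orP: jP => /eqP ->.
rewrite /ph H2 (bigD1 k) /=; last by case/orP: jP => /eqP ->; rewrite !inE eqxx ?orbT.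
rewrite mulrDl addrC; congr (_ / _ + _); apply: eq_big => k1.
  rewrite !in_setU1 !xpair_eqE; have [->|k1k] := eqVneq k1 k; first by rewrite andbF (negPf jH).
  by rewrite !andbF /= andbT.
by case/andP=> _ k1k; rewrite vv2.
Qed.

(** Revealing j1 k as an edge and j2 k as a non-edge changes the two excesses by -(1 - l)/n and l/n,
    so their difference drops by 1/n. The changes of [ph] are equal and cancel; the rest is of third
    order. *)
Lemma phi_shift : `|phi I2 O2 j1 k' - phi I2 O2 j2 k' -
    (phi I O j1 k' - phi I O j2 k' - n%:R^-1)| <= 3 * (w ^+ 3 * z).
Proof.
have k'k : k' != k by rewrite eq_sym.
have ph1 := ph2 (j := j1); have ph1' := ph2 (j := j2).
rewrite /phi ph1 ?inE ?eqxx // ph1' ?inE ?eqxx ?orbT //.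
rewrite !uu_out // !uu_in // !xi_out // !xi_in // vv2 //=.
rewrite !eqxx (negPf jj) [j2 == j1]eq_sym (negPf jj) /=.
have hi : `|n%:R^-1 : R| <= w ^+ 2.
  by rewrite ger0_norm ?invr_ge0 //; apply: le_trans (h_n n0 hn) hw.
have h1 := nxi gw j1; have h2 := nxi gw j2; have h3 := g_u gw j1; have h4 := g_u gw j2.
have h5 := g_v gw k'; have h6 := nkap l01.
move: h1 h2 h3 h4 h5 h6.
set u1 := uu I O j1; set u2 := uu I O j2; set x1 := xi R I O j1; set x2 := xi R I O j2; set p1 := ph _ _ _ _ j1; set p2 := ph _ _ _ _ j2.
set vk := vv I2 O2 k / _; set V := vv I O k'; set K := kap l.

move: hi; move: (n%:R^-1) => i hi h1 h2 h3 h4 h5 h6.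
match goal with |- is_true (`|?X| <= _) => have -> : X = u1 * i - (1 - l) * i * x1 - (1 - l) * (i * i) - (u2 * i + l * i * x2 + l * (i * i)) - K * V * i by ring end.
have hl := nl l01; have hl1 : `|1 - l| <= 1 by have [q1 q2] := andP l01; rewrite ler_norml; lra.
have [p1' p2' p3 p4 p5] := mo; have [t0 t1 t2] := mo3; have [s1 s2 s3 s4] := sz.
have w4 : 0 <= w ^+ 3 * (1 / 200 - w) by apply: gap_ge0 => //; apply: ltW.
by nbt; lra.
Qed.

Lemma pr2_diff : `|pr I2 O2 (j1, k') - pr I2 O2 (j2, k') - (phi I O j1 k' - phi I O j2 k' - n%:R^-1)| <= D + 3 * (w ^+ 3 * z).
Proof.
have k'k : k' != k by rewrite eq_sym.
have [_ a1] := in_J J1; have [_ a2] := in_J J2.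
have nin2 j : (j, k') \notin H -> (j, k') \notin I2 :|: O2.
  by move=> jH; rewrite H2 !in_setU1 !xpair_eqE (negPf k'k) !andbF.
have := dC2 g2 c2 jj (nin2 _ a1) (nin2 _ a2) => d.
have e := phi_shift.
exact: nb_trans d e.
Qed.

Lemma Ex_pair : Ex I O (fun G => ind (j1, k) G * (nin (j2, k) G * (ind (j1, k') G - ind (j2, k') G))) =
  gg j1 j2 * (pr I2 O2 (j1, k') - pr I2 O2 (j2, k')).
Proof.
rewrite /gg !Ex_in -mulrA; congr (_ * _); rewrite Ex_out // ExB.
have -> : Ex I2 O (nin (j2, k)) = 1 - pr I2 O (j2, k).
  rewrite -(Ex_cst (s := s) (t := t) (I := I2) (O := O) (1 : R)) // -ExB.
  by apply: eq_Ex => G _; rewrite ninE.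
by [].
Qed.
End Pair.

Lemma gg_refl j : gg j j = 0.
Proof.
rewrite /gg -(Ex_cst (s := s) (t := t) (I := I) (O := O) (0 : R)) //; apply: eq_Ex => G _.
by rewrite /ind /nin; case: (_ \in G); rewrite ?mulr0 ?mul0r.
Qed.

Lemma gg_ge0 j1 j2 : 0 <= gg j1 j2.
Proof.
rewrite -(Ex_cst (s := s) (t := t) (I := I) (O := O) (0 : R)) //; apply: le_Ex => G _.
by rewrite mulr_ge0 // ler0n.
Qed.

Lemma gg_anti j1 j2 : gg j1 j2 - gg j2 j1 = pr I O (j1, k) - pr I O (j2, k).
Proof.
rewrite /gg -ExB -2!Ex_ind -ExB; apply: eq_Ex => G _; rewrite !ninE; ring.
Qed.

Definition Xf G : R := \sum_(j in J) ind (j, k) G.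

Lemma sum_gg : \sum_(j1 in J) \sum_(j2 in J) gg j1 j2 = Ex I O (fun G => Xf G * (#|J|%:R - Xf G)).
Proof.
under eq_bigr do rewrite -Ex_sum; rewrite -Ex_sum; apply: eq_Ex => G _.
rewrite /Xf mulr_suml; apply: eq_bigr => j1 _; rewrite -mulr_sumr; congr (_ * _).
rewrite -sum1_card natr_sum -sumrB; apply: eq_bigr => j2 _; exact: ninE.
Qed.

Lemma Xf_bound G : G \in Om I O -> `|Xf G / m%:R - l| <= 3 * w.
Proof.
move=> GO; have := PS_bound m0 l01 gw GO k k'; cbv zeta.
have -> : #|Ps I O k k' G|%:R + #|hs H k k' G|%:R = Xf G.
  rewrite -natrD /Xf /ind -natr_sum; congr (_%:R).
  rewrite -cardsUI [Ps _ _ _ _ _ :&: _](_ : _ = set0) ?cards0 ?addn0.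
    rewrite -sum1_card big_mkcond [RHS]big_mkcond; apply: eq_bigr => j _.
    rewrite !inE; case: ((j, k) \in G); case: ((j, k') \in G); rewrite ?andbT ?andbF ?orbF //=; by case: ifP.
  by apply/setP => j; rewrite !inE; case: ((j, k') \in G); rewrite ?andbF.
move=> /andP[a b]; have w0' := w0.
have wm0 : 0 < w * m%:R by rewrite mulr_gt0.
rewrite -[l](mulfK (x := m%:R)) ?gt_eqF // -mulrBl normrM normfV (gtr0_norm m1) ler_pdivrMr //.
rewrite ler_norml; apply/andP; split; lra.
Qed.

Lemma J_bound : `|#|J|%:R / m%:R - 1| <= 2 * w.
Proof.
have Jm : (#|J| <= m)%N by rewrite -[m in (_ <= m)%N]card_ord max_card.
have mJ : (m <= #|J| + degv H k + degv H k')%N.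
  rewrite -[m in (m <= _)%N]card_ord -cardsT /degv.
  apply: leq_trans (_ : _ <= #|J :|: [set j | (j, k) \in H] :|: [set j | (j, k') \in H]|)%N _.
    apply: subset_leq_card; apply/subsetP => j _; rewrite !in_setU !in_set.
    by do 4!case: (_ \in _).
  apply: leq_trans (leq_card_setU _ _).1 _; rewrite leq_add2r; exact: (leq_card_setU _ _).1.
have := degvH_le m0 gw k; have := degvH_le m0 gw k'.
move: Jm mJ; rewrite -!(ler_nat R) !natrD => a b c d.
have -> : #|J|%:R / m%:R - 1 = (#|J|%:R - m%:R) / m%:R :> R by field; rewrite gt_eqF.
rewrite normrM normfV (gtr0_norm m1) ler_pdivrMr //.
rewrite ler_norml; apply/andP; split; lra.
Qed.

Lemma XqX G : G \in Om I O -> `|Xf G * (#|J|%:R - Xf G) - ell * m%:R ^+ 2| <= 9 * w * m%:R ^+ 2.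
Proof.
move=> GO; have a := Xf_bound GO; have b := J_bound.
pose x := Xf G / m%:R - l; pose y : R := #|J|%:R / m%:R - 1.
have -> : Xf G * (#|J|%:R - Xf G) - ell * m%:R ^+ 2 = ((1 - l) * x + l * (y - x) + x * (y - x)) * m%:R ^+ 2.
  by rewrite /x /y; field; rewrite gt_eqF.
rewrite -/x in a; rewrite -/y in b; rewrite normrM [X in _ * X]gtr0_norm ?exprn_gt0 // ler_wpM2r ?exprn_ge0 //.
clearbody x y; have l1 : `|1 - l| <= 1 - l by have [q1 q2] := andP l01; rewrite ger0_norm //; lra.
have ll : `|l| <= l by have [q1 q2] := andP l01; rewrite ger0_norm //; lra.
have [s1 s2 s3 s4] := sz; have w0' := w0; have [l0 l2] := andP l01.
nbt.
have : 0 <= l * w by rewrite mulr_ge0 // ltW.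
have : 0 <= (1 - l) * w by apply: mulr_ge0; lra.
have : 0 <= w * (1 / 200 - w) by apply: gap_ge0 => //; apply: ltW.
lra.
Qed.

(** The maximum of x (|J| - x). This factor 1/4 is the origin of the contraction: it multiplies the
    error [D] in [Ex_W], two such errors meet in [step_num], and D/2 results. *)
Lemma sum_gg_le : \sum_(j1 in J) \sum_(j2 in J) gg j1 j2 <= m%:R ^+ 2 / 4.
Proof.
have Jm : #|J|%:R <= m%:R :> R by rewrite ler_nat -[m in (_ <= m)%N]card_ord max_card.
rewrite sum_gg -(Ex_cst (s := s) (t := t) (I := I) (O := O) (m%:R ^+ 2 / 4)) //.
apply: le_Ex => G _; move: (Xf G) => x.
have : 0 <= (x - #|J|%:R / 2) ^+ 2 by exact: sqr_ge0.
have : #|J|%:R * #|J|%:R <= m%:R * m%:R :> R by apply: ler_pM.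
lra.
Qed.

Lemma sum_gg_approx : `|\sum_(j1 in J) \sum_(j2 in J) gg j1 j2 - ell * m%:R ^+ 2| <= 9 * w * m%:R ^+ 2.
Proof.
rewrite sum_gg -[ell * _](Ex_cst (s := s) (t := t) (I := I) (O := O)) // -ExB.
rewrite ler_norml; apply: Ex_bound => // G GO.
by have := XqX GO; rewrite ler_norml.
Qed.

(** Each pair of rows contributes [gg] times a difference within column k' in a state with two more
    revealed pairs. The differences are known up to D, and the weights [gg] sum to at most m^2/4. *)
Lemma Ex_W : `|Ex I O Wf - Dhat * m%:R ^+ 2| <= m%:R ^+ 2 * (D / 4 + 2 * (w * D) + 30 * (w ^+ 3 * z)).
Proof.
have [p1 p2 p3 p4 p5] := mo; have [t0 t1 t2] := mo3; have [s1 s2 s3 s4] := sz; have D0' := D0; have w0' := w0.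
pose a j1 j2 := phi I O j1 k' - phi I O j2 k'.
have E1 : `|Ex I O Wf - \sum_(j1 in J) \sum_(j2 in J) gg j1 j2 * (a j1 j2 - n%:R^-1)|
   <= (D + 3 * (w ^+ 3 * z)) * (m%:R ^+ 2 / 4).
  have -> : Ex I O Wf = \sum_(j1 in J) \sum_(j2 in J)
     Ex I O (fun G => ind (j1, k) G * (nin (j2, k) G * (ind (j1, k') G - ind (j2, k') G))).
    by rewrite /Wf Ex_sum; apply: eq_bigr => j1 _; rewrite Ex_sum.
  rewrite -sumrB; apply: le_trans (ler_norm_sum _ _ _) _.
  apply: le_trans (_ : _ <= (D + 3 * (w ^+ 3 * z)) * (\sum_(j1 in J) \sum_(j2 in J) gg j1 j2)) _; last first.
    by rewrite ler_wpM2l ?sum_gg_le //; lra.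
  rewrite mulr_sumr; apply: ler_sum => j1 J1; rewrite -sumrB mulr_sumr.
  apply: le_trans (ler_norm_sum _ _ _) _; apply: ler_sum => j2 J2.
  have [->|jj] := eqVneq j1 j2.
    rewrite gg_refl mul0r mulr0 subr0 -[X in _ <= X](normr0 R) le_eqVlt; apply/orP; left; apply/eqP; congr (`|_|).
    rewrite -(Ex_cst (s := s) (t := t) (I := I) (O := O) (0 : R)) //; apply: eq_Ex => G _.
    by rewrite subrr !mulr0.
  rewrite Ex_pair // -mulrBr normrM (ger0_norm (gg_ge0 _ _)) mulrC ler_wpM2r ?gg_ge0 //.
  exact: pr2_diff.
have E2 : `|\sum_(j1 in J) \sum_(j2 in J) gg j1 j2 * (a j1 j2 - n%:R^-1) - Dhat * m%:R ^+ 2|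
   <= m%:R ^+ 2 * (3 / 2 * (w * D) + 20 * (w ^+ 3 * z)).
  (* As [a] is antisymmetric, only the antisymmetric part of [gg] matters. It is a difference of
     probabilities in column k, of first order, so the error D enters here multiplied by w. *)
  have -> : \sum_(j1 in J) \sum_(j2 in J) gg j1 j2 * (a j1 j2 - n%:R^-1) =
    \sum_(j1 in J) \sum_(j2 in J) (gg j1 j2 - gg j2 j1) * a j1 j2 / 2 - (\sum_(j1 in J) \sum_(j2 in J) gg j1 j2) / n%:R.
    rewrite -sum_antisym; last by move=> i j _ _; rewrite /a opprB.
    rewrite mulr_suml -sumrB; apply: eq_bigr => j1 _; rewrite mulr_suml -sumrB; apply: eq_bigr => j2 _.
    by rewrite mulrBr.
  have -> : \sum_(j1 in J) \sum_(j2 in J) (gg j1 j2 - gg j2 j1) * a j1 j2 / 2 - (\sum_(j1 in J) \sum_(j2 in J) gg j1 j2) / n%:R - Dhat * m%:R ^+ 2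
    = (\sum_(j1 in J) \sum_(j2 in J) ((gg j1 j2 - gg j2 j1) * a j1 j2 / 2 - (uu I O j1 - uu I O j2) ^+ 2 / 2))
      - (\sum_(j1 in J) \sum_(j2 in J) gg j1 j2 - ell * m%:R ^+ 2) / n%:R.
    under [X in _ = X - _]eq_bigr do rewrite sumrB.
    by rewrite sumrB /Dhat; field; rewrite !gt_eqF.
  apply: le_trans (_ : _ <= m%:R ^+ 2 * (3 / 2 * (w * D) + 15 * (w ^+ 3 * z) + w ^+ 3 * z / 4) + 9 * w * m%:R ^+ 2 * w ^+ 2) _; last first.
    rewrite [9 * w * _ * _](_ : _ = m%:R ^+ 2 * (9 * w ^+ 3)); last by ring.
    by rewrite -mulrDr ler_wpM2l ?exprn_ge0 //; lra.
  apply: nbD; last first.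
    rewrite normrN normrM; apply: ler_pM; [exact: normr_ge0|exact: normr_ge0|exact: sum_gg_approx|].
    by rewrite ger0_norm ?invr_ge0 //; apply: le_trans (h_n n0 hn) hw.
  have Jm : #|J|%:R <= m%:R :> R by rewrite ler_nat -[m in (_ <= m)%N]card_ord max_card.
  set c := (X in m%:R ^+ 2 * X).
  have wD : 0 <= w * D by rewrite mulr_ge0 // ltW.
  have c00 : 0 <= c by rewrite /c; lra.
  apply: le_trans (norm_sum_le (c := c * m%:R) _) _; last first.
    by rewrite (_ : _ * c = c * m%:R * m%:R); [rewrite ler_wpM2l ?mulr_ge0|ring].
  move=> j1 J1; apply: le_trans (norm_sum_le (c := c) _) _; last by rewrite ler_wpM2l.
  move=> j2 J2; rewrite gg_anti.
  have [->|jj] := eqVneq j1 j2; first by rewrite !subrr mul0r expr0n /= !mul0r subr0 normr0.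
  have [x1 y1] := in_J J1; have [x2 y2] := in_J J2.
  have q := dC gd c0 jj x1 x2.
  have f1 := phi_first n0 m0 l01 w0 wo o1 gw j1 k; have f2 := phi_first n0 m0 l01 w0 wo o1 gw j2 k.
  have f3 := phi_first n0 m0 l01 w0 wo o1 gw j1 k'; have f4 := phi_first n0 m0 l01 w0 wo o1 gw j2 k'.
  have q1 := g_u gw j1; have q2 := g_u gw j2.
  pose b1 := (pr I O (j1, k) - pr I O (j2, k)) - (uu I O j1 - uu I O j2).
  pose b2 := a j1 j2 - (uu I O j1 - uu I O j2).
  have nb1 : `|b1| <= D + 6 * (w ^+ 2 * z).
    have -> : b1 = pr I O (j1, k) - pr I O (j2, k) - (phi I O j1 k - phi I O j2 k) +
      (phi I O j1 k - (l + uu I O j1 + vv I O k)) - (phi I O j2 k - (l + uu I O j2 + vv I O k)) by rewrite /b1; ring.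
    by nbt; lra.
  have nb2 : `|b2| <= 6 * (w ^+ 2 * z).
    have -> : b2 = (phi I O j1 k' - (l + uu I O j1 + vv I O k')) - (phi I O j2 k' - (l + uu I O j2 + vv I O k')) by rewrite /b2 /a; ring.
    by nbt; lra.
  have -> : (pr I O (j1, k) - pr I O (j2, k)) * a j1 j2 / 2 - (uu I O j1 - uu I O j2) ^+ 2 / 2 =
     ((uu I O j1 - uu I O j2) * b2 + b1 * (uu I O j1 - uu I O j2) + b1 * b2) / 2 by rewrite /b1 /b2; field.
  move: q1 q2 nb1 nb2; move: (uu I O j1) (uu I O j2) => u1 u2; clearbody b1 b2 => q1 q2 nb1 nb2.
  have hf : `|2^-1 : R| <= 2^-1 by rewrite ger0_norm ?invr_ge0 ?ler0n.
  nbt; rewrite /c.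
  have : 0 <= w * D by rewrite mulr_ge0 // ltW.
  have : 0 <= D * (w / 200 - w ^+ 2 * z) by apply: gap_ge0 => //; apply: ltW.
  have : 0 <= (w ^+ 2 * z) * (w / 200 - w ^+ 2 * z) by apply: gap_ge0 => //; apply: ltW.
  lra.
have wD : 0 <= w * D by rewrite mulr_ge0 // ltW.
apply: le_trans (nb_trans E1 E2) _; move: t2 wD; move: (w ^+ 3 * z) (w * D) => q wD q0 wD0.
rewrite [leLHS](_ : _ = m%:R ^+ 2 * ((D + 3 * q) / 4 + (3 / 2 * wD + 20 * q))); last by field.
by rewrite ler_wpM2l ?exprn_ge0 //; lra.
Qed.
End CodegreeExpectation.

(** * The expected number of partner rows *)

Section SwitchCount.
Variables (R : realFieldType) (m n : nat) (s : 'I_m -> nat) (t : 'I_n -> nat) (l w o h : R).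
Local Notation Om := (Om s t).
Local Notation cnt := (cnt R s t).
Local Notation pr := (pr R s t).
Local Notation Ex := (@Ex R m n s t).
Local Notation ell := (l * (1 - l)).
Local Notation z := (ell^-1).
Local Notation good := (good s t l).
Local Notation uu := (uu s l). Local Notation vv := (vv t l).
Local Notation phi := (phi s t l).
Local Notation ind := (ind R). Local Notation nin := (nin R).
Hypotheses (n0 : (0 < n)%N) (m0 : (0 < m)%N) (st : (\sum_j s j = \sum_k t k)%N).
Hypotheses (l01 : 0 < l < 1) (w0 : 0 < w) (wo : w <= ell ^+ 2 * o) (o1 : o <= 1 / 200).
Hypotheses (hm : 1 <= h * m%:R) (hn : 1 <= h * n%:R) (hw : h <= w ^+ 2) (o2 : 44 * o <= 1 / 20).

Let n1 : 0 < n%:R :> R. Proof. by rewrite ltr0n. Qed.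
Let m1 : 0 < m%:R :> R. Proof. by rewrite ltr0n. Qed.
Let e0 : 0 < ell. Proof. by have [] := ell_bounds l01. Qed.
Let ez : ell * z = 1. Proof. by rewrite divff // gt_eqF. Qed.
Let sz := sizes l01 ez w0 wo o1.
Let mo := monos l01 ez w0 wo o1.
Let mo3 := mono3 l01 ez w0 wo o1.
Let h0 : 0 < h. Proof. exact: (h_gt0 n0 hn). Qed.

Variables (v D : R) (I O : {set 'I_m * 'I_n}) (k k' : 'I_n).
Hypotheses (v0 : 0 <= v) (vw : v + h + h + h + h <= w) (D0 : 0 <= D) (kk : k != k').
Hypotheses (dR : diffR s t l v D) (dR1 : diffR s t l (v + h) D).
Hypotheses (dC : diffC s t l v D) (dC2 : diffC s t l (v + h + h) D).
Hypotheses (gd : good v I O) (c0 : 0 < cnt I O).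
Local Notation H := (I :|: O).
Local Notation J := (SJ H k k').
Let gw : good w I O.
Proof. by apply: good_le gd => //; have h0' := h0; have vw' := vw; lra. Qed.

(** The number of unrevealed edges of column a is fixed by its degree. So the number of those in
    rows of J varies only through [ff], the edges in rows where the pair in column b is revealed,
    and there are few such rows. *)
Definition Ka (a b : 'I_n) := [set j : 'I_m | ((j, a) \notin H) && ((j, b) \in H)].
Definition ff a b G : R := \sum_(j in Ka a b) ind (j, a) G.
Definition av a : R := vv I O a + l * (1 - ze R I O a).
Definition hf G : R := \sum_(j in J) ind (j, k') G * nin (j, k) G.
Local Notation X := (Xf R I O k k').
Definition X' (G : {set 'I_m * 'I_n}) : R := \sum_(j in J) ind (j, k') G.

(** The partner rows are the edges of k' in J less the codegree, and the codegree is expressed by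
    [Wf]. *)
Lemma qhf G : #|J|%:R * hf G = X' G * (#|J|%:R - X G) - Wf R I O k k' G.
Proof.
have WE : Wf R I O k k' G = (X' G - hf G) * (#|J|%:R - X G) - X G * hf G.
  have -> : X' G - hf G = \sum_(j in J) ind (j, k) G * ind (j, k') G.
    by rewrite /X' /hf -sumrB; apply: eq_bigr => j _; rewrite ninE; ring.
  have -> : #|J|%:R - X G = \sum_(j in J) nin (j, k) G.
    by rewrite /Xf -sum1_card natr_sum -sumrB; apply: eq_bigr => j _; rewrite ninE.
  rewrite /Wf /Xf !mulr_suml -sumrB; apply: eq_bigr => j1 _.
  rewrite /hf !mulr_sumr -sumrB; apply: eq_bigr => j2 _; ring.
by rewrite WE; ring.
Qed.

Lemma XE G : G \in Om I O -> X G = m%:R * av k - ff k k' G.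
Proof.
move=> GO; rewrite /av -(col_sum (t := t) l m0 k GO) /ff /Xf.
rewrite [X in _ = X - _](bigID (fun j => (j, k') \in H)) /= [X in X + _ - _](_ : _ = \sum_(j in Ka k k') ind (j, k) G).
  by rewrite addrAC subrr add0r; apply: eq_big => [j|//]; rewrite !inE.
by apply: eq_big => [j|//]; rewrite !inE.
Qed.

Lemma XE' G : G \in Om I O -> X' G = m%:R * av k' - ff k' k G.
Proof.
move=> GO; rewrite /av -(col_sum (t := t) l m0 k' GO) /ff /X'.
rewrite [X in _ = X - _](bigID (fun j => (j, k) \in H)) /= [X in X + _ - _](_ : _ = \sum_(j in Ka k' k) ind (j, k') G).
  by rewrite addrAC subrr add0r; apply: eq_big => [j|//]; rewrite !inE andbC.
by apply: eq_big => [j|//]; rewrite !inE.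
Qed.

Lemma Ka_card a b : #|Ka a b|%:R <= w * m%:R :> R.
Proof.
apply: le_trans (degvH_le m0 gw b); rewrite ler_nat /degv; apply: subset_leq_card.
by apply/subsetP => j; rewrite !in_set => /andP[].
Qed.

Lemma Ex_ff a b : Ex I O (ff a b) = \sum_(j in Ka a b) pr I O (j, a).
Proof. by rewrite /ff Ex_sum. Qed.

Let vw1 : 0 <= v <= w. Proof. by rewrite v0; have h0' := h0; have vw' := vw; lra. Qed.
Let vw2 : 0 <= v + h <= w. Proof. by have v0' := v0; have h0' := h0; have vw' := vw; apply/andP; split; lra. Qed.

(** Each term of the covariance is the effect of revealing one pair on the probability of another in
    a different row and column, whose first order parameters do not change. The two sets of rows
    have at most w m elements each, whence the factor [w ^+ 2]. *)
Lemma cov_le : `|Ex I O (fun G => ff k k' G * ff k' k G) - Ex I O (ff k k') * Ex I O (ff k' k)|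
  <= m%:R ^+ 2 * (w ^+ 2 * (2 * D + 8 * (w ^+ 2 * z))).
Proof.
have [p1 p2 p3 p4 p5] := mo; have D0' := D0.
have -> : Ex I O (fun G => ff k k' G * ff k' k G) - Ex I O (ff k k') * Ex I O (ff k' k) =
  \sum_(j1 in Ka k k') \sum_(j2 in Ka k' k) pr I O (j1, k) * (pr ((j1, k) |: I) O (j2, k') - pr I O (j2, k')).
  rewrite !Ex_ff mulr_suml.
  have -> : Ex I O (fun G => ff k k' G * ff k' k G) =
    \sum_(j1 in Ka k k') \sum_(j2 in Ka k' k) Ex I O (fun G => ind (j1, k) G * ind (j2, k') G).
    under eq_bigr do rewrite -Ex_sum; rewrite -Ex_sum; apply: eq_Ex => G _.
    by rewrite /ff mulr_suml; apply: eq_bigr => j1 _; rewrite mulr_sumr.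
  rewrite -sumrB; apply: eq_bigr => j1 _; rewrite mulr_sumr -sumrB; apply: eq_bigr => j2 _.
  by rewrite Ex_in mulrBr.
set c := 2 * D + 8 * (w ^+ 2 * z).
have cc0 : 0 <= c by rewrite /c; lra.
apply: le_trans (norm_sum_le (c := c * (w * m%:R)) _) _; last first.
  rewrite [leRHS](_ : _ = c * (w * m%:R) * (w * m%:R)); last by ring.
  by rewrite ler_wpM2l ?Ka_card // !mulr_ge0 // ltW.
move=> j1; rewrite in_set => /andP[a1 a2].
apply: le_trans (norm_sum_le (c := c) _) _; last by rewrite ler_wpM2l ?Ka_card.
move=> j2; rewrite in_set => /andP[b1 b2].
rewrite normrM -[leRHS]mul1r ler_pM //; first by rewrite ger0_norm ?pr_le1 // pr_ge0.
have j12 : j2 != j1 by apply: contraNneq b1 => ->.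
have gI : good (v + h) ((j1, k) |: I) O by apply: (good_in n0 m0 l01 hm hn).
have cI : 0 < cnt ((j1, k) |: I) O.
  by apply: (cnt_in_gt0 n0 m0 st l01 w0 wo o1 hm hn hw o2 v0) => //; have h0' := h0; have vw' := vw; lra.
have k'k : k' != k by rewrite eq_sym.
have nin2 : (j2, k') \notin (j1, k) |: I :|: O by rewrite UI in_setU1 xpair_eqE (negPf j12) /=.
have q1 := pr_first n0 m0 st l01 w0 wo o1 vw2 D0 dR1 gI cI nin2.
have q2 := pr_first n0 m0 st l01 w0 wo o1 vw1 D0 dR gd c0 b1.
move: q1; rewrite uu_in // vv_in //= (negPf j12) (negPf k'k) /= !mul0r !subr0 => q1.
rewrite distrC in q2; apply: le_trans (nb_trans q1 q2) _; rewrite /c; lra.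
Qed.

Lemma Ex_hf : `|#|J|%:R / m%:R * (Ex I O hf / m%:R) -
   ((av k' - Ex I O (ff k' k) / m%:R) * (#|J|%:R / m%:R - av k + Ex I O (ff k k') / m%:R) - Dhat s l I O k k')|
   <= D / 4 + 3 * (w * D) + 31 * (w ^+ 3 * z).
Proof.
have E1 : #|J|%:R * Ex I O hf = (m%:R * av k' - Ex I O (ff k' k)) * (#|J|%:R - m%:R * av k + Ex I O (ff k k'))
   - (Ex I O (fun G => ff k k' G * ff k' k G) - Ex I O (ff k k') * Ex I O (ff k' k)) - Ex I O (Wf R I O k k').
  rewrite -ExZ (eq_Ex (g := fun G => (m%:R * av k') * (#|J|%:R - m%:R * av k) + (m%:R * av k') * ff k k' G
     - (#|J|%:R - m%:R * av k) * ff k' k G - ff k k' G * ff k' k G - Wf R I O k k' G)).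
    by rewrite !ExB ExD !ExZ Ex_cst //; ring.
  by move=> G GO; rewrite qhf XE // XE' //; ring.
have cv := cov_le; have EW := Ex_W n0 m0 st l01 w0 wo o1 hm hn hw o2 v0 vw D0 kk dC dC2 gd c0.
rewrite -(ler_pM2l (exprn_gt0 2 m1)) -[X in X * `|_|](gtr0_norm (exprn_gt0 2 m1)) -normrM.
set Dh := Dhat _ _ _ _ _ _ in EW *.
set W := Ex I O (Wf _ _ _ _ _) in EW E1.
set C := _ - _ * _ in cv E1.
have -> : m%:R ^+ 2 * (#|J|%:R / m%:R * (Ex I O hf / m%:R) -
   ((av k' - Ex I O (ff k' k) / m%:R) * (#|J|%:R / m%:R - av k + Ex I O (ff k k') / m%:R) - Dh)) =
   - C - (W - Dh * m%:R ^+ 2).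
  transitivity (#|J|%:R * Ex I O hf - ((m%:R * av k' - Ex I O (ff k' k)) * (#|J|%:R - m%:R * av k + Ex I O (ff k k')) - Dh * m%:R ^+ 2)).
    by field; rewrite gt_eqF.
  by rewrite E1; ring.
clearbody C W Dh; nbt.
rewrite -mulrDr ler_wpM2l ?exprn_ge0 //.
have [p1 p2 p3 p4 p5] := mo; have [t0 t1 t2] := mo3; have [s1 s2 s3 s4] := sz; have D0' := D0; have w0' := w0.
have : 0 <= D * (w / 200 - w ^+ 2) by apply: gap_ge0 => //; apply: ltW.
have : 0 <= w * D by rewrite mulr_ge0 // ltW.
have : 0 <= w ^+ 3 * z * (1 / 200 - w) by apply: gap_ge0 => //; apply: ltW.
lra.
Qed.

(** Here [c] stands for the column excess before jk and jk' were revealed, so that both switched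
    states are compared with one common value. *)
Lemma Ex_ff_approx a b (c : R) : `|vv I O a - c| <= h ->
  `|Ex I O (ff a b) / m%:R - (\sum_(j in Ka a b) (l + uu I O j + c)) / m%:R| <= w * (D + 5 * (w ^+ 2 * z)).
Proof.
move=> hc; rewrite -mulrBl normrM normfV (gtr0_norm m1) ler_pdivrMr // Ex_ff -sumrB.
have [p1 p2 p3 p4 p5] := mo; have D0' := D0.
apply: le_trans (norm_sum_le (c := D + 5 * (w ^+ 2 * z)) _) _; last first.
  rewrite [leRHS]mulrAC [leRHS]mulrC ler_wpM2l ?Ka_card //; lra.
move=> j; rewrite in_set => /andP[a1 a2].
have q2 := pr_first n0 m0 st l01 w0 wo o1 vw1 D0 dR gd c0 a1.
have q3 : `|l + uu I O j + vv I O a - (l + uu I O j + c)| <= h.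
  by rewrite [X in `|X|](_ : _ = vv I O a - c) //; ring.
apply: le_trans (nb_trans q2 q3) _; have hw' := hw; lra.
Qed.
End SwitchCount.

Lemma small_bounds (R : realFieldType) (l w v f f' g th rho im : R) : 0 < w -> w <= 1 / 200 -> w ^+ 2 <= w / 200 ->
  `|l| <= 1 -> `|v| <= w -> `|f| <= w -> `|f'| <= w -> `|g| <= w -> `|th| <= w ^+ 2 -> `|rho| <= w ^+ 2 -> `|im| <= w ^+ 2 ->
  [/\ `|(l + v) * (f' - g) + th - rho| <= 1 / 40, `|v + l * (1 - f)| <= 21 / 20 & `|1 - (f + f' - g + im)| <= 21 / 20].
Proof. by move=> w0 w1 w2 h1 h2 h3 h4 h5 h6 h7 h8; split; nbt; lra. Qed.

Lemma eF_small (R : realFieldType) (w D q : R) : 0 < w -> w <= 1 / 200 -> 0 <= D -> D <= 1 / 80 -> 0 <= q -> q <= w / 200 ->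
  w * (D + 5 * q) <= 1 / 40.
Proof.
move=> w0 w1 D0 D1 q0 q1; have : w * (D + 5 * q) <= 1 / 200 * 1 by apply: ler_pM; lra.
lra.
Qed.

Lemma three_half (R : realFieldType) (a b : R) : `|a| <= 21 / 20 -> `|b| <= 1 / 40 -> `|a - b| <= 3 / 2.
Proof. by move=> h1 h2; nbt; lra. Qed.
Lemma five_half (R : realFieldType) (q a im F Fb e w : R) : `|q| <= 21 / 20 -> `|a| <= 21 / 20 -> `|im| <= w -> w <= 1 / 200 ->
  `|F - Fb| <= e -> e <= 1 / 40 -> `|Fb| <= 1 / 40 -> `|q - (a - im) + F| <= 5 / 2.
Proof.
move=> h1 h2 h3 h4 h5 h6 h7; have -> : q - (a - im) + F = q - a + im + (F - Fb) + Fb by ring.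
by nbt; lra.
Qed.
Lemma er_combine (R : realFieldType) (D w q x eF : R) : 0 <= w * D -> 0 <= x -> eF = w * D + 5 * x ->
  D / 4 + 3 * (w * D) + 31 * x + 4 * eF <= D / 4 + 100 * (w * D + x).
Proof. by move=> a b ->; lra. Qed.

Lemma setU_swap (T : finType) (e e' : T) (I O : {set T}) : (e |: I) :|: (e' |: O) = (e' |: I) :|: (e |: O).
Proof. by rewrite setUACA [[set _] :|: [set _]]setUC -setUACA. Qed.

Lemma in_SJ (m n : nat) (H : {set 'I_m * 'I_n}) a b j : (j \in SJ H a b) = ((j, a) \notin H) && ((j, b) \notin H).
Proof. by rewrite [LHS]in_set. Qed.
Lemma in_Ka (m n : nat) (I O : {set 'I_m * 'I_n}) a b j : (j \in Ka I O a b) = ((j, a) \notin I :|: O) && ((j, b) \in I :|: O).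
Proof. by rewrite [LHS]in_set. Qed.

Lemma product_perturb (R : realFieldType) (q E a a' F F' Fb Fb' Dh im er0 eF : R) :
  `|q * E - ((a' - F') * (q - a + F) - Dh)| <= er0 -> `|F - Fb| <= eF -> `|F' - Fb'| <= eF ->
  `|a' - Fb'| <= 3 / 2 -> `|q - a + F| <= 5 / 2 ->
  `|q * E - ((a' - Fb') * (q - (a + im - Fb)) + (a' - Fb') * im - Dh)| <= er0 + 4 * eF.
Proof.
move=> h1 h2 h3 h4 h5.
have -> : er0 + 4 * eF = er0 + (3 / 2 * eF + eF * (5 / 2)) by field.
apply: nb_trans h1 _.
have -> : (a' - F') * (q - a + F) - Dh - ((a' - Fb') * (q - (a + im - Fb)) + (a' - Fb') * im - Dh) =
  (a' - Fb') * (F - Fb) - (F' - Fb') * (q - a + F) by ring.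
by nb.
Qed.

(** * One step of the contraction *)

Section Step.
Variables (R : realFieldType) (m n : nat) (s : 'I_m -> nat) (t : 'I_n -> nat) (l w o h : R).
Local Notation Om := (Om s t).
Local Notation cnt := (cnt R s t).
Local Notation pr := (pr R s t).
Local Notation Ex := (@Ex R m n s t).
Local Notation ell := (l * (1 - l)).
Local Notation z := (ell^-1).
Local Notation good := (good s t l).
Local Notation uu := (uu s l). Local Notation vv := (vv t l).
Local Notation phi := (phi s t l).
Hypotheses (n0 : (0 < n)%N) (m0 : (0 < m)%N) (st : (\sum_j s j = \sum_k t k)%N).
Hypotheses (l01 : 0 < l < 1) (w0 : 0 < w) (wo : w <= ell ^+ 2 * o) (o1 : o <= 1 / 200).
Hypotheses (hm : 1 <= h * m%:R) (hn : 1 <= h * n%:R) (hw : h <= w ^+ 2) (o2 : 44 * o <= 1 / 20).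

Let n1 : 0 < n%:R :> R. Proof. by rewrite ltr0n. Qed.
Let m1 : 0 < m%:R :> R. Proof. by rewrite ltr0n. Qed.
Let e0 : 0 < ell. Proof. by have [] := ell_bounds l01. Qed.
Let ez : ell * z = 1. Proof. by rewrite divff // gt_eqF. Qed.
Let sz := sizes l01 ez w0 wo o1.
Let mo := monos l01 ez w0 wo o1.
Let mo3 := mono3 l01 ez w0 wo o1.
Let h0 : 0 < h. Proof. exact: (h_gt0 n0 hn). Qed.

Lemma diffR_mono v v' D : 0 <= v -> v <= v' -> diffR s t l v' D -> diffR s t l v D.
Proof. by move=> v0 vv' dR I O g; apply: dR; apply: good_le g. Qed.
Lemma diffC_mono v v' D : 0 <= v -> v <= v' -> diffC s t l v' D -> diffC s t l v D.
Proof. by move=> v0 vv' dR I O g; apply: dR; apply: good_le g. Qed.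

Section Switching.
Variables (I O : {set 'I_m * 'I_n}) (j : 'I_m) (k k' : 'I_n).
Local Notation H := (I :|: O).
Hypotheses (kk : k != k') (eH : (j, k) \notin H) (eH' : (j, k') \notin H).
Local Notation I1 := ((j, k) |: I). Local Notation O1 := ((j, k') |: O).

Lemma sum_hf_chk : \sum_(G in Om I1 O1) hf R I1 O1 k k' G =
  \sum_(j2 in SJ (I1 :|: O1) k k') \sum_(G in Om I O | chk j j2 k k' G && xpredT G) (1 : R).
Proof.
rewrite /hf exchange_big; apply: eq_bigr => j2 _.
rewrite sum_in [LHS]big_mkcondr /= sum_out [LHS]big_mkcondr [RHS]big_mkcondr; apply: eq_bigr => G _.
rewrite /chk /ind /nin.
by case: ((j, k) \in G); case: ((j, k') \in G); case: ((j2, k) \in G); case: ((j2, k') \in G); rewrite /= ?mulr0 ?mul0r ?mulr1.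
Qed.
End Switching.

(** Double counting: [hf] counts the rows that form a checkerboard with row j, so both sides count
    the switches between graphs with jk but not jk' and graphs with jk' but not jk. *)
Lemma switch_balance I O j k k' : k != k' -> (j, k) \notin I :|: O -> (j, k') \notin I :|: O ->
  \sum_(G in Om ((j, k) |: I) ((j, k') |: O)) hf R ((j, k) |: I) ((j, k') |: O) k k' G =
  \sum_(G in Om ((j, k') |: I) ((j, k) |: O)) hf R ((j, k') |: I) ((j, k) |: O) k' k G.
Proof.
move=> kk eH eH'; rewrite !sum_hf_chk.
have -> : SJ (((j, k') |: I) :|: ((j, k) |: O)) k' k = SJ (((j, k) |: I) :|: ((j, k') |: O)) k k'.
  by rewrite SJC setU_swap.
apply: eq_bigr => j2; rewrite in_set UI UO => /andP[f1 f2].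
have nH x : x \notin (j, k) |: ((j, k') |: (I :|: O)) -> x \notin I :|: O.
  by apply: contra => hh; rewrite 2!in_setU1 hh !orbT.
by rewrite (sum_sw s t xpredT _) //; apply/and4P; split => //; apply: nH.
Qed.

(** Let A and B be the probabilities that only jk, respectively only jk', is an edge. Then p - p' =
    A - B and p + p' - 2 p p1 = A + B, while [switch_balance] says A E1 = B E2. *)
Lemma pair_balance I O j k k' : k != k' -> (j, k) \notin I :|: O -> (j, k') \notin I :|: O ->
  0 < cnt I O -> 0 < cnt ((j, k) |: I) O ->
  let p := pr I O (j, k) in let p' := pr I O (j, k') in let p1 := pr ((j, k) |: I) O (j, k') in
  let E1 := Ex ((j, k) |: I) ((j, k') |: O) (hf R ((j, k) |: I) ((j, k') |: O) k k') in
  let E2 := Ex ((j, k') |: I) ((j, k) |: O) (hf R ((j, k') |: I) ((j, k) |: O) k' k) in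
  0 < cnt ((j, k) |: I) ((j, k') |: O) -> 0 < cnt ((j, k') |: I) ((j, k) |: O) ->
  (p - p') * (E1 + E2) = (p + p' - 2 * (p * p1)) * (E2 - E1).
Proof.
move=> kk eH eH' c c1 p p' p1 E1 E2 cA cB.
have pE := pr_pair R s t I O (j, k) (j, k').
have sw := switch_balance kk eH eH'.
pose A := cnt ((j, k) |: I) ((j, k') |: O) / cnt I O.
pose B := cnt ((j, k') |: I) ((j, k) |: O) / cnt I O.
have AB : p - p' = A - B by rewrite /p /p' pE mulrBl.
have AE : A = p * (1 - p1).
  rewrite /A /p /p1 pr_out // prE mulrACA [cnt _ O * _]mulrC mulrA mulrC.
  by field; rewrite !gt_eqF.
have QE : p + p' - 2 * (p * p1) = A + B.
  have -> : B = A - (p - p') by rewrite AB opprB addrCA subrr addr0.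
  by rewrite AE; ring.
have EE : A * E1 = B * E2.
  rewrite /A /B /E1 /E2 /Ex sw.
  by field; rewrite !gt_eqF.
rewrite QE AB; have -> : (A - B) * (E1 + E2) = A * E1 + A * E2 - B * E1 - B * E2 by ring.
have -> : (A + B) * (E2 - E1) = A * E2 - A * E1 + B * E2 - B * E1 by ring.
by rewrite EE; ring.
Qed.

Section Main.
Variables (v D : R) (I O : {set 'I_m * 'I_n}) (j : 'I_m) (k k' : 'I_n).
Hypotheses (v0 : 0 <= v) (vw : v + h + h + h + h + h + h <= w) (D0 : 0 <= D) (kk : k != k').
Hypotheses (D1 : D <= 100 * ell * o) (D2 : D <= ell / 20).
Hypotheses (dR : diffR s t l (v + h + h + h + h) D) (dC : diffC s t l (v + h + h + h + h) D).
Hypotheses (gd : good v I O) (c0 : 0 < cnt I O).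
Local Notation H := (I :|: O).
Hypotheses (eH : (j, k) \notin H) (eH' : (j, k') \notin H).
Local Notation I1 := ((j, k) |: I). Local Notation O1 := ((j, k') |: O).
Local Notation I2 := ((j, k') |: I). Local Notation O2 := ((j, k) |: O).

Let gw : good w I O.
Proof. by apply: good_le gd => //; have h0' := h0; have vw' := vw; lra. Qed.

Definition Kc := [set i : 'I_m | ((i, k) \in H) && ((i, k') \in H)].
Let f := ze R I O k. Let f' := ze R I O k'.
Let g : R := #|Kc|%:R / m%:R.
Let rho : R := (\sum_(i in Kc) uu I O i) / m%:R.
Let im : R := m%:R^-1.

Lemma Ka_sum a b (c : R) (F : 'I_m -> R) : (Kc == [set i | ((i, a) \in H) && ((i, b) \in H)]) ->
  (\sum_(i in Ka I O a b) (l + F i + c)) / m%:R =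
  (l + c) * (ze R I O b - g) + (\sum_(i | (i, b) \in H) F i) / m%:R - (\sum_(i in Kc) F i) / m%:R.
Proof.
move=> /eqP KE.
have split_ (P : 'I_m -> R) : \sum_(i | (i, b) \in H) P i = \sum_(i in Ka I O a b) P i + \sum_(i in Kc) P i.
  rewrite (bigID (fun i => (i, a) \in H)) addrC KE; congr (_ + _); apply: eq_bigl => i.
    by rewrite [i \in _]in_set andbC.
  by rewrite [i \in _]in_set andbC.
have := split_ F; have := split_ (fun=> 1).
rewrite !sumr_const => E1 E2; rewrite E2.
have -> : ze R I O b = #|[pred i | (i, b) \in H]|%:R / m%:R.
  by rewrite /ze /degv cardsE.
rewrite E1 /g (eq_bigr (fun i => (l + c) + F i)); last by move=> i _; rewrite addrAC.
rewrite big_split /= sumr_const -[(l + c) *+ _]mulr_natr; field.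
by rewrite gt_eqF.
Qed.

Let ke : (j, k) != (j, k'). Proof. exact: edge_neq. Qed.
Let ke' : (j, k') != (j, k). Proof. by rewrite eq_sym. Qed.
Let v2 : 0 <= v + h + h. Proof. by have v0' := v0; have h0' := h0; lra. Qed.
Let vh : 0 <= v + h. Proof. by have v0' := v0; have h0' := h0; lra. Qed.
Let vw2 : v + h + h <= w. Proof. by have vw' := vw; have h0' := h0; lra. Qed.
Let vw3 : v + h + h + h <= w. Proof. by have vw' := vw; have h0' := h0; lra. Qed.
Let vw1 : 0 <= v <= w. Proof. by rewrite v0; have vw' := vw; have h0' := h0; lra. Qed.
Let vw2' : 0 <= v + h <= w. Proof. by rewrite vh; have vw' := vw; have h0' := h0; lra. Qed.
Let lv : v <= v + h + h + h + h. Proof. by have h0' := h0; lra. Qed.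
Let lv1 : v + h <= v + h + h + h + h. Proof. by have h0' := h0; lra. Qed.

Lemma st_good (e e' : 'I_m * 'I_n) (a b : 'I_n) : e = (j, a) -> e' = (j, b) -> e != e' -> e \notin H -> e' \notin H ->
  good (v + h + h) (e |: I) (e' |: O) /\ 0 < cnt (e |: I) (e' |: O).
Proof.
move=> ea eb ee x x'; split.
  by exact: (good2 n0 m0 l01 hm hn v0 vw2 gd ee x x').
rewrite eb; apply: (cnt_out_gt0 n0 m0 st l01 w0 wo o1 hm hn hw o2 vh) => //.
- exact: (good_in n0 m0 l01 hm hn).
- by rewrite ea; apply: (cnt_in_gt0 n0 m0 st l01 w0 wo o1 hm hn hw o2 v0) => //; rewrite -ea.
- by rewrite -eb UI in_setU1 negb_or eq_sym ee.
Qed.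

Lemma SJ_add : SJ (I1 :|: O1) k k' = SJ H k k' :\ j.
Proof.
apply/setP => i; rewrite UI UO in_setD1 !in_SJ !in_setU1 !xpair_eqE !eqxx !andbT (negPf kk) [k' == k]eq_sym (negPf kk) ?andbF ?orbF.
by case: (i == j); rewrite ?orbF ?orbT ?andbF ?andbT /=.
Qed.

(** Inclusion and exclusion over the rows revealed in either column. The extra [im] is row j itself,
    whose two pairs have just been revealed. *)
Lemma q_eq : #|SJ (I1 :|: O1) k k'|%:R / m%:R = 1 - (f + f' - g + im).
Proof.
have E1 : #|SJ H k k'| = #|SJ (I1 :|: O1) k k'|.+1.
  by rewrite (cardsD1 j) SJ_add in_SJ eH eH'.
have E2 : (#|SJ H k k'| + (degv H k + degv H k') = m + #|Kc|)%N.
  rewrite /degv -cardsUI addnA; congr (_ + _)%N.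
    rewrite -[RHS]card_ord -[RHS](cardsC (SJ H k k')); congr (_ + _)%N.
    by apply: eq_card => i; rewrite in_setC in_SJ !inE negb_and !negbK.
  by apply: eq_card => i; rewrite !inE.
have := congr1 (fun x => x%:R : R) E2; rewrite E1 /f /f' /g /im /ze !natrD -natr1 => h1.
have -> : #|SJ (I1 :|: O1) k k'|%:R = m%:R + #|Kc|%:R - (degv H k)%:R - (degv H k')%:R - 1 :> R by move: h1; lra.
by field; rewrite gt_eqF.
Qed.

Lemma uu_st (e e' : 'I_m * 'I_n) (a b : 'I_n) i : e = (j, a) -> e' = (j, b) -> e != e' -> e \notin H -> e' \notin H -> i != j ->
  uu (e |: I) (e' |: O) i = uu I O i.
Proof.
move=> ea eb ee x x' ij; rewrite uu_out //; last by rewrite UI in_setU1 negb_or eq_sym ee.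
by rewrite uu_in // ea eb /= (negPf ij) /= !mul0r subr0 addr0.
Qed.

Lemma Ka_st (e e' : 'I_m * 'I_n) (a b c d : 'I_n) : e = (j, a) -> e' = (j, b) ->
  ((c, d) == (a, b)) || ((c, d) == (b, a)) -> (j, c) \notin H -> (j, d) \notin H ->
  Ka (e |: I) (e' |: O) c d = Ka I O c d.
Proof.
move=> -> -> cd x y; apply/setP => i; rewrite !in_Ka UI UO !in_setU1 !xpair_eqE.
have [->|ij] := eqVneq i j; last by rewrite /=.
by rewrite (negPf y) andbF; case/orP: cd => /eqP[-> ->]; rewrite !eqxx ?orbT ?andbF.
Qed.

Lemma Dh_le : `|Dhat s l I1 O1 k k'| <= 3 * w ^+ 2.
Proof.
have [g1 c1] := st_good erefl erefl ke eH eH'.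
have gg1 := good_le v2 vw2 g1.
have [p1 p2 p3 p4 p5] := mo; have w0' := w0; have [b1 b2] := ell_bounds l01.
rewrite /Dhat; apply: le_trans (_ : 2 * w ^+ 2 + w ^+ 2 <= _); last by lra.
have Jm : #|SJ (I1 :|: O1) k k'|%:R <= m%:R :> R by rewrite ler_nat -[m in (_ <= m)%N]card_ord max_card.
apply: nbD.
  rewrite normrM normfV (gtr0_norm (exprn_gt0 2 m1)) ler_pdivrMr ?exprn_gt0 //.
  apply: le_trans (norm_sum_le (c := 2 * w ^+ 2 * m%:R) _) _; last first.
    rewrite [m%:R ^+ 2]expr2 [leRHS]mulrA; apply: ler_wpM2l; [by do 2!apply: mulr_ge0 => //|exact: Jm].
  move=> i _; apply: le_trans (norm_sum_le (c := 2 * w ^+ 2) _) _; last by rewrite ler_wpM2l // mulr_ge0.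
  move=> i' _; have q1 := g_u gg1 i; have q2 := g_u gg1 i'.
  have hf : `|2^-1 : R| <= 2^-1 by rewrite ger0_norm ?invr_ge0 ?ler0n.
  by nbt; lra.
rewrite normrN ger0_norm ?divr_ge0 // ?(ltW b1) //.
apply: le_trans (_ : 1 * h <= _); last by rewrite mul1r; exact: hw.
apply: ler_pM; rewrite ?invr_ge0 ?(ltW b1) //; [lra|exact: (h_n n0 hn)].
Qed.

(** The sum runs over rows other than j, whose excesses are the same in both switched states. This
    is why the covariance cancels in the difference of the two equations. *)
Lemma Dh_swap : Dhat s l I2 O2 k' k = Dhat s l I1 O1 k k'.
Proof.
have JE : SJ (I2 :|: O2) k' k = SJ (I1 :|: O1) k k' by rewrite SJC setU_swap.
rewrite /Dhat JE; congr (_ / _ - _).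
have nj i : i \in SJ (I1 :|: O1) k k' -> i != j by rewrite SJ_add in_setD1 => /andP[].
apply: eq_bigr => i1 /nj i1j; apply: eq_bigr => i2 /nj i2j.
by rewrite !(uu_st erefl erefl ke') // !(uu_st erefl erefl ke).
Qed.

Let Fb := (l + vv I O k) * (f' - g) + th s l I O k' - rho.
Let Fb' := (l + vv I O k') * (f - g) + th s l I O k - rho.

Lemma Fb_approx (e e' : 'I_m * 'I_n) (a b : 'I_n) : e = (j, a) -> e' = (j, b) -> e != e' -> e \notin H -> e' \notin H ->
  (a == k) && (b == k') || (a == k') && (b == k) ->
  `|Ex (e |: I) (e' |: O) (ff R (e |: I) (e' |: O) k k') / m%:R - Fb| <= w * (D + 5 * (w ^+ 2 * z)) /\
  `|Ex (e |: I) (e' |: O) (ff R (e |: I) (e' |: O) k' k) / m%:R - Fb'| <= w * (D + 5 * (w ^+ 2 * z)).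
Proof.
move=> ea eb ee x x' ab; have [g1 c1] := st_good ea eb ee x x'.
have dR2 : diffR s t l (v + h + h) D by apply: diffR_mono dR => //; have h0' := h0; lra.
have vv2 : 0 <= v + h + h <= w by rewrite v2 vw2.
have x2 : e' \notin e |: I :|: O by rewrite UI in_setU1 negb_or eq_sym ee.
have close c : `|vv (e |: I) (e' |: O) c - vv I O c| <= h.
  rewrite vv_out // vv_in // [X in `|X|](_ : _ = (c == e'.2)%:R * (l * m%:R^-1) - (c == e.2)%:R * (m%:R^-1 - l * m%:R^-1)); last first.
    by field; rewrite gt_eqF.
  have hm' := h_m m0 hm; have i0 : 0 <= m%:R^-1 :> R by rewrite invr_ge0.
  have [l0 l1] := andP l01; have h0' := h0.
  have li : 0 <= l * m%:R^-1 by rewrite mulr_ge0 // ltW.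
  have li' : l * m%:R^-1 <= m%:R^-1 by rewrite ler_piMl // ltW.
  by case: (c == e.2); case: (c == e'.2); rewrite /= ?mul1r ?mul0r ler_norml; apply/andP; split; lra.
have KaE c d : ((c, d) == (k, k')) || ((c, d) == (k', k)) -> Ka (e |: I) (e' |: O) c d = Ka I O c d.
  move=> cd; apply: (Ka_st ea eb).
  - by case/orP: ab => /andP[/eqP-> /eqP->] //; rewrite orbC.
  - by case/orP: cd => /eqP[-> _].
  - by case/orP: cd => /eqP[_ ->].
have sE c d (y : R) : ((c, d) == (k, k')) || ((c, d) == (k', k)) -> \sum_(i in Ka (e |: I) (e' |: O) c d) (l + uu (e |: I) (e' |: O) i + y) =
   \sum_(i in Ka I O c d) (l + uu I O i + y).
  move=> cd; rewrite KaE //; apply: eq_bigr => i; rewrite in_Ka => /andP[_ iH].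
  rewrite (uu_st ea eb ee) //; apply: contraTneq iH => ->.
  by case/orP: cd => /eqP[_ ->].
have KC : Kc == [set i | ((i, k) \in H) && ((i, k') \in H)] by [].
have KC' : Kc == [set i | ((i, k') \in H) && ((i, k) \in H)] by apply/eqP/setP => i; rewrite !inE andbC.
split.
  have := Ex_ff_approx n0 m0 st l01 w0 wo o1 hn hw v2 vw D0 dR2 g1 c1 k' (close k).
  by rewrite sE ?eqxx // (Ka_sum _ _ KC).
have := Ex_ff_approx n0 m0 st l01 w0 wo o1 hn hw v2 vw D0 dR2 g1 c1 k (close k').
by rewrite sE ?eqxx ?orbT // (Ka_sum _ _ KC').
Qed.

Lemma av_st (e e' : 'I_m * 'I_n) (a b : 'I_n) : e = (j, a) -> e' = (j, b) -> e != e' -> e \notin H -> e' \notin H -> a != b ->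
  av t l (e |: I) (e' |: O) a = vv I O a + l * (1 - ze R I O a) - im /\
  av t l (e |: I) (e' |: O) b = vv I O b + l * (1 - ze R I O b).
Proof.
move=> ea eb ee x x' ab; have x2 : e' \notin e |: I :|: O by rewrite UI in_setU1 negb_or eq_sym ee.
rewrite /av !vv_out // !vv_in // !ze_out // !ze_in // ea eb /= !eqxx (negPf ab) [b == a]eq_sym (negPf ab) /im /=.
by split; field; rewrite gt_eqF.
Qed.

Let weak (x : R) : x <= D + 4 * (w ^+ 2 * z) -> x <= D + 5 * (w ^+ 2 * z).
Proof. have [p1 p2 p3 p4 p5] := mo; lra. Qed.
Let weak1 : D + 4 * (w ^+ 2 * z) + h <= D + 5 * (w ^+ 2 * z).
Proof. have [p1 p2 p3 p4 p5] := mo; have hw' := hw; lra. Qed.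
Let D80 : D <= 1 / 80.
Proof. have [b1 b2] := ell_bounds l01; have D2' := D2; lra. Qed.
Let w2w : w ^+ 2 <= w.
Proof. have [p1 p2 p3 p4 p5] := mo; have w0' := w0; lra. Qed.
Let dRm a : 0 <= a -> a <= v + h + h + h + h -> diffR s t l a D.
Proof. by move=> a0 al; apply: diffR_mono dR. Qed.
Let gI : good (v + h) I1 O. Proof. exact: (good_in n0 m0 l01 hm hn). Qed.
Let cI : 0 < cnt I1 O.
Proof. exact: (cnt_in_gt0 n0 m0 st l01 w0 wo o1 hm hn hw o2 v0 vw2 gd c0 eH). Qed.

Let hp : `|pr I O (j, k) - (l + uu I O j + vv I O k)| <= D + 5 * (w ^+ 2 * z).
Proof. by apply: weak; apply: (pr_first n0 m0 st l01 w0 wo o1 vw1 D0 (dRm v0 lv) gd c0 eH). Qed.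
Let hp' : `|pr I O (j, k') - (l + uu I O j + vv I O k')| <= D + 5 * (w ^+ 2 * z).
Proof. by apply: weak; apply: (pr_first n0 m0 st l01 w0 wo o1 vw1 D0 (dRm v0 lv) gd c0 eH'). Qed.
Let hp1 : `|pr I1 O (j, k') - (l + uu I O j + vv I O k')| <= D + 5 * (w ^+ 2 * z).
Proof.
have x2 : (j, k') \notin I1 :|: O by rewrite UI in_setU1 negb_or ke'.
have q1 := pr_first n0 m0 st l01 w0 wo o1 vw2' D0 (dRm vh lv1) gI cI x2.
apply: le_trans (nb_trans q1 (_ : _ <= h)) weak1.
rewrite uu_in // vv_in //= eqxx [k' == k]eq_sym (negPf kk) /= !mul0r subr0.
rewrite [X in `|X|](_ : _ = - ((1 - l) * n%:R^-1)); last by rewrite mul1r; ring.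
have [l0 l1] := andP l01.
rewrite normrN ger0_norm ?mulr_ge0 ?invr_ge0 ?subr_ge0 ?(ltW l1) //.
by apply: le_trans (h_n n0 hn); rewrite ler_piMl ?invr_ge0 // gerBl ltW.
Qed.

(* The contraction: knowing all differences up to [D] in the states with a few more revealed pairs, one knows them up to about [D / 2]. *)
Lemma step : `|pr I O (j, k) - pr I O (j, k') - (phi I O j k - phi I O j k')| <= D / 2 + 1100 * (o * D + o ^+ 3).
Proof.
have [g1 c1] := st_good erefl erefl ke eH eH'.
have [g2 c2] := st_good erefl erefl ke' eH' eH.
have kk' : k' != k by rewrite eq_sym.
have ab1 : (k == k) && (k' == k') || (k == k') && (k' == k) by rewrite !eqxx.
have ab2 : (k' == k) && (k == k') || (k' == k') && (k == k) by rewrite !eqxx orbT.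
have [F1 F1'] := Fb_approx erefl erefl ke eH eH' ab1.
have [F2 F2'] := Fb_approx erefl erefl ke' eH' eH ab2.
have v3 : 0 <= v + h + h + h by have v2' := v2; have h0' := h0; lra.
have dCm x : 0 <= x -> x <= v + h + h + h + h -> diffC s t l x D by move=> x0 xx; apply: diffC_mono dC.
have l2 : v + h + h <= v + h + h + h + h by have h0' := h0; lra.
have l3 : v + h + h + h <= v + h + h + h + h by have h0' := h0; lra.
have H1 := Ex_hf n0 m0 st l01 w0 wo o1 hm hn hw o2 v2 vw D0 kk (dRm v2 l2) (dRm v3 l3) (dCm _ v2 l2) dC g1 c1.
have H2 := Ex_hf n0 m0 st l01 w0 wo o1 hm hn hw o2 v2 vw D0 kk' (dRm v2 l2) (dRm v3 l3) (dCm _ v2 l2) dC g2 c2.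
have JE : SJ (I2 :|: O2) k' k = SJ (I1 :|: O1) k k' by rewrite SJC setU_swap.
move: H1 H2; rewrite JE Dh_swap q_eq.
have [A1 A1'] := av_st erefl erefl ke eH eH' kk.
have [A2 A2'] := av_st erefl erefl ke' eH' eH kk'.
rewrite A1 A1' A2 A2'.
set a := vv I O k + l * (1 - ze R I O k); set a' := vv I O k' + l * (1 - ze R I O k').
set q := 1 - _; set Dh := Dhat _ _ _ _ _ _.
set e1 := Ex I1 O1 (hf _ _ _ _ _) / _; set e2 := Ex I2 O2 (hf _ _ _ _ _) / _.
move=> H1 H2.
have [p1 p2 p3 p4 p5] := mo; have [s1 s2 s3 s4] := sz; have w0' := w0; have D0' := D0.
have nv := g_v gw k; have nv' := g_v gw k'; have nf := nze gw k; have nf' := nze gw k'.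
have nu := g_u gw j; have nth1 := nth_ m0 w0 gw k; have nth2 := nth_ m0 w0 gw k'.
have ng : `|g| <= w.
  rewrite ger0_norm ?divr_ge0 // ler_pdivrMr //; apply: le_trans (degvH_le m0 gw k).
  by rewrite ler_nat /degv; apply: subset_leq_card; apply/subsetP => i; rewrite in_set [_ \in [set _ | _]]in_set => /andP[].
have nrho : `|rho| <= w ^+ 2.
  by apply: (sum_th_le m0 w0 gw (P := fun i => i \in Kc) (k := k) (g_u gw)) => i; rewrite [_ \in Kc]in_set => /andP[].
have nim : `|im| <= w ^+ 2.
  by rewrite ger0_norm ?invr_ge0 //; apply: le_trans (h_m m0 hm) hw.
have hl := nl l01.
have [nFb na nq] := small_bounds w0' s3 p2 hl nv nf nf' ng nth2 nrho nim.
have [nFb' na' nq'] := small_bounds w0' s3 p2 hl nv' nf' nf ng nth1 nrho nim.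
set eF := w * (D + 5 * (w ^+ 2 * z)) in F1 F1' F2 F2'.
have eF1 : eF <= 1 / 40 by exact: eF_small.
have nim2 : `|im| <= w := le_trans nim w2w.
have P1 := product_perturb im H1 F1 F1' (three_half na' nFb') (five_half nq na nim2 s3 F1 eF1 nFb).
have P2 := product_perturb im H2 F2' F2 (three_half na nFb) (five_half nq na' nim2 s3 F2' eF1 nFb').
rewrite subrK in P1; rewrite subrK in P2.
have [t0 t1 t2] := mo3.
have wD : 0 <= w * D by rewrite mulr_ge0 // ltW.
have eFE : eF = w * D + 5 * (w ^+ 3 * z) by rewrite /eF [w ^+ 3]exprS; move: (z) => zz; ring.
have er := er_combine D wD t2 eFE.
have hr1 := le_trans P1 er; have hr2 := le_trans P2 er.
set r1 := q * e1 - _ in hr1; set r2 := q * e2 - _ in hr2.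
have E1 : q * e1 = (a' - Fb') * (q - (a - Fb)) + (a' - Fb') * im - Dh + r1 by rewrite /r1; ring.
have E2 : q * e2 = (a - Fb) * (q - (a' - Fb')) + (a - Fb) * im - Dh + r2 by rewrite /r2; ring.
have AB : (pr I O (j, k) - pr I O (j, k')) * (e1 + e2) =
  (pr I O (j, k) + pr I O (j, k') - 2 * (pr I O (j, k) * pr I1 O (j, k'))) * (e2 - e1).
  have := pair_balance kk eH eH' c0 cI c1 c2; cbv zeta => pb.
  rewrite /e1 /e2 -mulrDl.
  by rewrite -[X in _ = _ * X]mulrBl [LHS]mulrA [RHS]mulrA pb.
have := step_num l01 ez w0 wo o1 D0 D1 D2 nu nv nv' nf nf' ng nth1 nth2 nrho nim Dh_le hr1 hr2 E1 E2 hp hp' hp1 AB.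
rewrite -kapE; apply: le_trans; rewrite le_eqVlt; apply/orP; left; apply/eqP; congr (`|_|).
by rewrite /phi; ring.
Qed.
End Main.
End Step.

Lemma contract_id (R : realFieldType) (q x o : R) : 3 / 4 * (q * x + 4 * o) + o = 3 / 4 * q * x + 4 * o.
Proof. lra. Qed.

(** * Iteration of the contraction *)

Section Contract.
Variables (R : realFieldType) (l w o h : R).
Local Notation ell := (l * (1 - l)).
Local Notation z := (ell^-1).
Hypotheses (l01 : 0 < l < 1) (w0 : 0 < w) (wo : w <= ell ^+ 2 * o) (o1 : o <= 1 / 200).
Hypotheses (hw : h <= w ^+ 2) (o2 : 44 * o <= 1 / 20) (o3 : 1100 * o <= 1 / 4) (oe : o <= ell / 100).
Let e0 : 0 < ell. Proof. by have [] := ell_bounds l01. Qed.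
Let ez : ell * z = 1. Proof. by rewrite divff // gt_eqF. Qed.
Let sz := sizes l01 ez w0 wo o1.

Section Sides.
Variables (m n : nat) (s : 'I_m -> nat) (t : 'I_n -> nat).
Hypotheses (n0 : (0 < n)%N) (m0 : (0 < m)%N) (st : (\sum_j s j = \sum_k t k)%N).
Hypotheses (hm : 1 <= h * m%:R) (hn : 1 <= h * n%:R).

(** Four pairs are revealed: two in row j and two more for the covariance of the columns. The room
    [6 * h] also covers the crude estimates that keep the states on the way nonempty. Since 1100 o
    is at most 1/4, the factor 1/2 becomes 3/4. *)
Lemma step_diffR v D : 0 <= v -> v + 6 * h <= w -> 0 <= D -> D <= 100 * ell * o -> D <= ell / 20 ->
  diffR s t l (v + 4 * h) D -> diffC s t l (v + 4 * h) D -> diffR s t l v (3 / 4 * D + 1100 * o ^+ 3).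
Proof.
have -> : v + 6 * h = v + h + h + h + h + h + h by ring.
have -> : v + 4 * h = v + h + h + h + h by ring.
move=> v0 vw D0 D1 D2 dR dC I O g c j k k' kk e e'.
have S := step n0 m0 st l01 w0 wo o1 hm hn hw o2 v0 vw D0 kk D1 D2 dR dC g c e e'.
apply: le_trans S _.
have : (1100 * o) * D <= 1 / 4 * D by rewrite ler_wpM2r.
lra.
Qed.
End Sides.

Variables (m n : nat) (s : 'I_m -> nat) (t : 'I_n -> nat).
Hypotheses (n0 : (0 < n)%N) (m0 : (0 < m)%N) (st : (\sum_j s j = \sum_k t k)%N).
Hypotheses (hm : 1 <= h * m%:R) (hn : 1 <= h * n%:R).
Let h0 : 0 < h. Proof. exact: (h_gt0 n0 hn). Qed.

(** The orbit of D -> 3/4 D + 1100 o^3: its fixed point is 4 times 1100 o^3, and the other term is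
    the decaying crude bound. *)
Definition Dseq i : R := (3 / 4) ^+ i * (43 * (w * z)) + 4 * (1100 * o ^+ 3).

Lemma Dseq_bounds i : [/\ 0 <= Dseq i, Dseq i <= 100 * ell * o & Dseq i <= ell / 20].
Proof.
have [s1 s2 s3 s4] := sz; have w0' := w0; have oe' := oe; have [b1 b2] := ell_bounds l01; have o2' := o2.
have z0 : 0 < z by rewrite invr_gt0.
have wz0 : 0 <= w * z by apply: mulr_ge0; exact: ltW.
have q34 : (0 : R) <= 3 / 4 by rewrite divr_ge0.
have q0 : 0 <= (3 / 4 : R) ^+ i by exact: exprn_ge0.
have q1 : (3 / 4 : R) ^+ i <= 1 by apply: exprn_ile1 => //; lra.
have a0 : 0 <= (3 / 4) ^+ i * (43 * (w * z)) by apply: mulr_ge0 => //; apply: mulr_ge0.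
have a1 : (3 / 4) ^+ i * (43 * (w * z)) <= 43 * (w * z) by apply: ler_piMl => //; apply: mulr_ge0.
have o4 : o <= 1 / 400 by lra.
have oo : o * o <= ell / 100 * (1 / 400) by apply: ler_pM => //; exact: ltW.
have c0 : 0 <= o ^+ 3 by apply: exprn_ge0; exact: ltW.
have c1 : o ^+ 3 <= ell * o / 100 * (1 / 400).
  rewrite !exprS expr0 mulr1 mulrA [ell * o / 100 * _](_ : _ = ell / 100 * (1 / 400) * o); last by field.
  by rewrite ler_wpM2r // ltW.
have eo : ell * (44 * o) <= ell * (1 / 20) by rewrite ler_wpM2l // ltW.
by rewrite /Dseq; split; lra.
Qed.

(** Rows and columns advance together, because a step for either needs the previous bound for both.
    The remaining room for [v] pays for four revealed pairs per step. *)
Lemma diff_seq i v : 0 <= v -> v + (4 * i%:R + 6) * h <= w ->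
  diffR s t l v (Dseq i) /\ diffC s t l v (Dseq i).
Proof.
have h0' := h0.
elim: i v => [|i IH] v v0 vw.
  have vw' : v + h + h <= w by lra.
  have [D0 _ _] := Dseq_bounds 0; have c3 : 0 <= o ^+ 3 by have [_ _ _ o0] := sz; rewrite exprn_ge0 // ltW.
  have le0 : 43 * (w * z) <= Dseq 0 by rewrite /Dseq expr0 mul1r lerDl; do 2!apply: mulr_ge0 => //.
  split.
    by move=> I O g c j k k' kk e e'; apply: le_trans le0; apply: (crude_diff n0 m0 l01 w0 wo o1 hm hn hw v0 vw').
  apply/(diff_tr l v _ n0 m0 st).
  by move=> I O g c j k k' kk e e'; apply: le_trans le0; apply: (crude_diff m0 n0 l01 w0 wo o1 hn hm hw v0 vw').
have [D0 D1 D2] := Dseq_bounds i.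
have v4 : 0 <= v + 4 * h by lra.
have v6 : v + 6 * h <= w.
  have : 0 <= i%:R * h by rewrite mulr_ge0 // ltW.
  move: vw; rewrite -[i.+1%:R]natr1; lra.
have [dR dC] : diffR s t l (v + 4 * h) (Dseq i) /\ diffC s t l (v + 4 * h) (Dseq i).
  by apply: IH => //; move: vw; rewrite -[i.+1%:R]natr1; lra.
have E : 3 / 4 * Dseq i + 1100 * o ^+ 3 = Dseq i.+1 by rewrite /Dseq [_ ^+ i.+1]exprS; exact: contract_id.
rewrite -E; split; first exact: (step_diffR n0 m0 st hm hn v0 v6 D0 D1 D2).
apply/(diff_tr l v _ n0 m0 st).
apply: (step_diffR m0 n0 (esym st) hn hm v0 v6 D0 D1 D2); first exact/(diff_tr l _ _ n0 m0 st).
exact/(diff_tr l _ _ m0 n0 (esym st)).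
Qed.

Lemma bernoulli_34 j : (3 / 4 : R) ^+ j * (1 + j%:R / 3) <= 1.
Proof.
elim: j => [|j IH]; first by rewrite expr0 mul0r addr0 mulr1.
apply: le_trans IH; rewrite exprS -mulrA mulrCA ler_wpM2l ?exprn_ge0 ?divr_ge0 //.
have : 0 <= j%:R :> R by []. rewrite -[j.+1%:R]natr1; lra.
Qed.

(** By Bernoulli, K rounds bring the power of 3/4 below 3/K and so below o. The second K rounds give
    o^2, and the crude bound is itself of order o, so what remains of it is of third order. The
    constant is the fixed point 4400 with some room. *)
Theorem pr_approx (K : nat) v I O j k : 3 <= o * K%:R -> 0 <= v -> v + (4 * (K + K)%:R + 6) * h <= w ->
  good s t l v I O -> 0 < cnt R s t I O -> (j, k) \notin I :|: O ->
  `|pr R s t I O (j, k) - phi s t l I O j k| <= 45 * 100 * o ^+ 3.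
Proof.
move=> Ko v0 vw g c e; have [dR _] := diff_seq v0 vw; have [D0 _ _] := Dseq_bounds (K + K).
have h0' := h0.
have vw' : v <= w.
  have : 0 <= (4 * (K + K)%:R + 6) * h by rewrite mulr_ge0 ?addr_ge0 ?mulr_ge0 // ltW.
  lra.
have gw := good_le v0 vw' g.
have hd k' : k' != k -> (j, k') \notin I :|: O ->
    `|pr R s t I O (j, k) - pr R s t I O (j, k') - (phi s t l I O j k - phi s t l I O j k')| <= Dseq (K + K).
  by move=> kk e'; apply: dR => //; rewrite eq_sym.
apply: le_trans (pr_phi n0 m0 st l01 w0 wo o1 gw c D0 e hd) _.
have [s1 s2 s3 o0] := sz; have w0' := w0; have [b1 b2] := ell_bounds l01.
have K3 : (3 / 4 : R) ^+ K <= o.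
  have := bernoulli_34 K => B.
  have q0 : 0 <= (3 / 4 : R) ^+ K by rewrite exprn_ge0 // divr_ge0.
  have : (3 / 4 : R) ^+ K * (K%:R / 3) <= 1.
    by apply: le_trans B; rewrite ler_wpM2l // lerDr.
  have : (3 / 4 : R) ^+ K * 3 <= (3 / 4 : R) ^+ K * (o * K%:R) by rewrite ler_wpM2l.
  have oo : 0 <= o by rewrite ltW.
  move=> a1 a2.
  have : o * ((3 / 4 : R) ^+ K * (K%:R / 3)) <= o * 1 by rewrite ler_wpM2l.
  lra.
have KK : (3 / 4 : R) ^+ (K + K) <= o * o.
  by rewrite exprD ler_pM // exprn_ge0 // divr_ge0.
have z0 : 0 < z by rewrite invr_gt0.
have wz0 : 0 <= w * z by apply: mulr_ge0; exact: ltW.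
have c3 : 0 <= o ^+ 3 by rewrite exprn_ge0 // ltW.
have wzo : w * z <= o / 4.
  have : ell * o <= 1 / 4 * o by rewrite ler_wpM2r // ltW.
  lra.
have t1 : (3 / 4 : R) ^+ (K + K) * (43 * (w * z)) <= o * o * (43 * (o / 4)).
  by apply: ler_pM; rewrite ?exprn_ge0 ?divr_ge0 ?mulr_ge0 //; lra.
have wo1 : w <= o.
  apply: le_trans wo _; rewrite ler_piMl ?(ltW o0) // exprn_ile1 ?(ltW b1) //.
  by apply: le_trans b2 _; rewrite ler_pdivrMr // mul1r ler1n.
have t2 : w * w * (w * z) <= o * o * (o / 4).
  have ww : w * w <= o * o by apply: ler_pM => //; exact: ltW.
  by apply: ler_pM => //; apply: mulr_ge0; exact: ltW.
have -> : w ^+ 3 * z = w * w * (w * z) by rewrite !exprS expr0 mulr1 !mulrA.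
have c3E : o ^+ 3 = o * o * o by ring.
by rewrite /Dseq c3E in c3 *; lra.
Qed.
End Contract.

(** * Increments of the main term *)

Section MainTerm.
Variables (R : realFieldType) (m n : nat).
Implicit Types (S : {set 'I_m * 'I_n}).

Definition rs (F : R -> R -> R) (l : R) (b : 'I_m -> R) S :=
  \sum_j F (b j + l * (degu S j)%:R) (degu S j)%:R.
Definition cs (F : R -> R -> R) (l : R) (c : 'I_n -> R) S :=
  \sum_k F (c k + l * (degv S k)%:R) (degv S k)%:R.
Definition ys (l : R) (b : 'I_m -> R) (c : 'I_n -> R) S :=
  \sum_(e in S) (b e.1 + l * (degu S e.1)%:R) * (c e.2 + l * (degv S e.2)%:R).

(* For l = lambda and b, c the deviations of the degrees from their averages this is the exponent for avoiding S; for l = 1 - lambda and -b, -c it is the exponent for containing S. *)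
Definition MF (l : R) (b : 'I_m -> R) (c : 'I_n -> R) S : R :=
  let Xr := #|S|%:R in let mr := m%:R in let nr := n%:R in
  let Rhl h1 h2 := rs (fun d x => d ^+ h1 * x ^+ h2) l b S in
  let Chl h1 h2 := cs (fun d x => d ^+ h1 * x ^+ h2) l c S in
  l * Xr / (2 * (1 - l)) * (1 / nr + 1 / mr)
  + l * Xr ^+ 2 / (2 * (1 - l) * mr * nr)
  - 1 / (1 - l) * (Rhl 1 1 / nr + Chl 1 1 / mr)
  - ys l b c S / (l * (1 - l) * mr * nr)
  + l / (2 * (1 - l)) * (Rhl 0 2 / nr + Chl 0 2 / mr)
  + l * (1 - 2 * l) / (6 * (1 - l) ^+ 2) * (Rhl 0 3 / nr ^+ 2 + Chl 0 3 / mr ^+ 2)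
  - (1 - 2 * l) / (2 * (1 - l) ^+ 2) * (Rhl 1 2 / nr ^+ 2 + Chl 1 2 / mr ^+ 2)
  - 1 / (2 * (1 - l) ^+ 2) * (Rhl 2 1 / nr ^+ 2 + Chl 2 1 / mr ^+ 2).

Lemma rs_inc F l b S e : e \notin S ->
  rs F l b (e |: S) = rs F l b S + F (b e.1 + l * (degu S e.1)%:R + l) ((degu S e.1)%:R + 1)
    - F (b e.1 + l * (degu S e.1)%:R) (degu S e.1)%:R.
Proof.
move=> eS; rewrite /rs (bigD1 e.1) //= [in RHS](bigD1 e.1) //= degu_add // eqxx addn1 -natr1.
rewrite (eq_bigr (fun j => F (b j + l * (degu S j)%:R) (degu S j)%:R)); last first.
  by move=> j je; rewrite degu_add // (negPf je) addn0.
by rewrite mulrDr mulr1 addrA; ring.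
Qed.

Lemma cs_inc F l b S e : e \notin S ->
  cs F l b (e |: S) = cs F l b S + F (b e.2 + l * (degv S e.2)%:R + l) ((degv S e.2)%:R + 1)
    - F (b e.2 + l * (degv S e.2)%:R) (degv S e.2)%:R.
Proof.
move=> eS; rewrite /cs (bigD1 e.2) //= [in RHS](bigD1 e.2) //= degv_add // eqxx addn1 -natr1.
rewrite (eq_bigr (fun j => F (b j + l * (degv S j)%:R) (degv S j)%:R)); last first.
  by move=> j je; rewrite degv_add // (negPf je) addn0.
by rewrite mulrDr mulr1 addrA; ring.
Qed.

Lemma sum_row S j (F : 'I_n -> R) : \sum_(e in S) (e.1 == j)%:R * F e.2 = \sum_(k | (j, k) \in S) F k.
Proof.
rewrite big_mkcond (eq_bigr (fun e : 'I_m * 'I_n => (fun a b => if (a, b) \in S then (a == j)%:R * F b else 0) e.1 e.2)); last by case.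
rewrite -(pair_bigA _ (fun a b => if (a, b) \in S then (a == j)%:R * F b else 0)) /= (bigD1 j) //= [X in _ + X]big1 ?addr0.
  by rewrite [RHS]big_mkcond; apply: eq_bigr => k _; rewrite eqxx mul1r.
by move=> a /negPf aj; rewrite big1 // => k _; rewrite aj mul0r; case: ifP.
Qed.

Lemma sum_col S k (F : 'I_m -> R) : \sum_(e in S) (e.2 == k)%:R * F e.1 = \sum_(j | (j, k) \in S) F j.
Proof.
rewrite big_mkcond (eq_bigr (fun e : 'I_m * 'I_n => (fun a b => if (a, b) \in S then (b == k)%:R * F a else 0) e.1 e.2)); last by case.
rewrite -(pair_bigA _ (fun a b => if (a, b) \in S then (b == k)%:R * F a else 0)) /= exchange_big (bigD1 k) //= [X in _ + X]big1 ?addr0.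
  by rewrite [RHS]big_mkcond; apply: eq_bigr => j _; rewrite eqxx mul1r.
by move=> a /negPf aj; rewrite big1 // => j _; rewrite aj mul0r; case: ifP.
Qed.

Lemma ys_inc l b c S j k : (j, k) \notin S ->
  ys l b c ((j, k) |: S) = ys l b c S + (b j + l * (degu S j)%:R + l) * (c k + l * (degv S k)%:R + l)
   + l * \sum_(k' | (j, k') \in S) (c k' + l * (degv S k')%:R) + l * \sum_(j' | (j', k) \in S) (b j' + l * (degu S j')%:R).
Proof.
move=> eS; rewrite /ys big_setU1 //= degu_add // degv_add // !eqxx !addn1 -!natr1.
have -> : \sum_(e in S) (b e.1 + l * (degu ((j, k) |: S) e.1)%:R) * (c e.2 + l * (degv ((j, k) |: S) e.2)%:R) =
  \sum_(e in S) ((b e.1 + l * (degu S e.1)%:R) * (c e.2 + l * (degv S e.2)%:R)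
    + l * ((e.1 == j)%:R * (c e.2 + l * (degv S e.2)%:R)) + l * ((e.2 == k)%:R * (b e.1 + l * (degu S e.1)%:R))).
  apply: eq_bigr => -[a d] aS /=; rewrite degu_add // degv_add //= !natrD.
  (* A pair of S shares at most one index with the new pair jk, so the product of the two changes
     vanishes. *)
  have : (a == j)%:R * (d == k)%:R = 0 :> R.
    case: (eqVneq a j) (eqVneq d k) => [aj|_] [dk|_] /=; rewrite ?mul0r ?mulr0 //.
    by move: eS; rewrite -aj -dk aS.
  by move: (_ == j)%:R (_ == k)%:R => x y xy; rewrite -[RHS]addr0 -(mulr0 (l * l)) -xy; ring.
rewrite [X in _ + X = _]big_split /= [X in _ + (X + _) = _]big_split /= -!mulr_sumr (sum_row S j (fun k' => c k' + l * (degv S k')%:R)) (sum_col S k (fun j' => b j' + l * (degu S j')%:R)); ring.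
Qed.

(* The increment of [MF] when an edge jk is added, in terms of the parameters of the state before. *)
Definition INC (l u v x y g p q i i' : R) : R :=
  l / (2 * (1 - l)) * (i + i') + (g + l * i * i' / 2) / (1 - l)
  - 1 / (1 - l) * ((u + l * x + l * i) + (v + l * y + l * i'))
  - ((u + l * i) * (v + l * i') + l * p + l * q) / (l * (1 - l))
  + l / (2 * (1 - l)) * ((2 * x + i) + (2 * y + i'))
  + l * (1 - 2 * l) / (6 * (1 - l) ^+ 2) * ((3 * x ^+ 2 + 3 * x * i + i ^+ 2) + (3 * y ^+ 2 + 3 * y * i' + i' ^+ 2))
  - (1 - 2 * l) / (2 * (1 - l) ^+ 2) * ((u * (2 * x + i) + l * (x + i) ^+ 2) + (v * (2 * y + i') + l * (y + i') ^+ 2))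
  - 1 / (2 * (1 - l) ^+ 2) * ((u ^+ 2 + (2 * u * l + l ^+ 2 * i) * (x + i)) + (v ^+ 2 + (2 * v * l + l ^+ 2 * i') * (y + i'))).

Lemma MF_inc l b c S j k : (0 < n)%N -> (0 < m)%N -> 0 < l < 1 -> (j, k) \notin S ->
  MF l b c ((j, k) |: S) - MF l b c S =
  INC l ((b j + l * (degu S j)%:R) / n%:R) ((c k + l * (degv S k)%:R) / m%:R)
    ((degu S j)%:R / n%:R) ((degv S k)%:R / m%:R) (l * #|S|%:R / (m%:R * n%:R))
    ((\sum_(k' | (j, k') \in S) ((c k' + l * (degv S k')%:R) / m%:R)) / n%:R)
    ((\sum_(j' | (j', k) \in S) ((b j' + l * (degu S j')%:R) / n%:R)) / m%:R) n%:R^-1 m%:R^-1.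
Proof.
move=> n0 m0 /andP[l0 l1] eS.
rewrite -!mulr_suml /MF !rs_inc // !cs_inc // ys_inc //= cardsU1 eS natrD /=.
set d := b j + _; set e := c k + _; set x := (degu S j)%:R; set y := (degv S k)%:R.
set SC := \sum_(k' | _) _; set SR := \sum_(j' | _) _.
set Y := ys _ _ _ _; move: (rs _ _ _ _) (rs _ _ _ _) (rs _ _ _ _) (rs _ _ _ _) (rs _ _ _ _).
move: (cs _ _ _ _) (cs _ _ _ _) (cs _ _ _ _) (cs _ _ _ _) (cs _ _ _ _) => c1 c2 c3 c4 c5 r1 r2 r3 r4 r5.
have nR : n%:R != 0 :> R by rewrite pnatr_eq0 -lt0n.
have mR : m%:R != 0 :> R by rewrite pnatr_eq0 -lt0n.
have lR : l != 0 by rewrite gt_eqF.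
have lR' : 1 - l != 0 by rewrite gt_eqF // subr_gt0.
move: nR mR; move: (n%:R) (m%:R) (#|S|%:R) => nr mr X nR mR.
rewrite /INC; field; rewrite ?nR ?mR ?lR ?lR' //.
Qed.

Lemma MF0 l b c : MF l b c set0 = 0.
Proof.
have du j : degu (set0 : {set 'I_m * 'I_n}) j = 0%N by rewrite degu_sum big1 // => k _; rewrite inE.
have dv k : degv (set0 : {set 'I_m * 'I_n}) k = 0%N by rewrite degv_sum big1 // => j _; rewrite inE.
rewrite /MF cards0 /ys big_set0.
have r0 h1 h2 : rs (fun d x => d ^+ h1 * x ^+ h2.+1) l b set0 = 0.
  by rewrite /rs big1 // => j _; rewrite du expr0n mulr0.
have c0 h1 h2 : cs (fun d x => d ^+ h1 * x ^+ h2.+1) l c set0 = 0.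
  by rewrite /cs big1 // => j _; rewrite dv expr0n mulr0.
by rewrite !r0 !c0 !expr0n /= !mul0r !mulr0 !mul0r !addr0 !mulr0 !subr0 !addr0.
Qed.
End MainTerm.

(** * The increment as a logarithm to second order *)

Section IncNumeric.
Variable R : realFieldType.
Variables (l w o u v x y g p q i i' : R).
Local Notation ell := (l * (1 - l)).
Local Notation z := (ell^-1).
Hypotheses (l01 : 0 < l < 1) (w0 : 0 < w) (wo : w <= ell ^+ 2 * o) (o1 : o <= 1 / 200).
Hypotheses (hu : `|u| <= w) (hv : `|v| <= w) (hx : `|x| <= w) (hy : `|y| <= w)
  (hg : `|g| <= w ^+ 2) (hp : `|p| <= w ^+ 2) (hq : `|q| <= w ^+ 2)
  (hi : `|i| <= w ^+ 2) (hi' : `|i'| <= w ^+ 2).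

Let e0 : 0 < ell. Proof. by have [] := ell_bounds l01. Qed.
Let ez : ell * z = 1. Proof. by rewrite divff // gt_eqF. Qed.
Let sz := sizes l01 ez w0 wo o1.
Let mo := monos l01 ez w0 wo o1.
Let mo3 := mono3 l01 ez w0 wo o1.
Let s1 := (1 - l)^-1.
Let A := u + v - g + u * x + v * y + kap l * u * v + p + q.
Let y0 := A * s1.

Lemma ns1 : `|s1| <= z.
Proof.
have [l0 l1] := andP l01.
rewrite ger0_norm /s1 ?invr_ge0 ?subr_ge0 ?(ltW l1) // lef_pV2 ?posrE ?subr_gt0 //.
by rewrite ler_piMl ?subr_ge0 ?ltW.
Qed.

Lemma nkap' : `|kap l| <= z.
Proof.
rewrite /kap normrM (gtr0_norm (x := z)) ?invr_gt0 // ler_piMl ?invr_ge0 ?(ltW e0) //.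
exact: nl1.
Qed.

Let b2 := A - (u + v).
Lemma nb2 : `|b2| <= 3 * (w ^+ 2 * z).
Proof.
have -> : b2 = - g + u * x + v * y + kap l * u * v + p + q by rewrite /b2 /A; ring.
have hk := nkap'; have [m0 m1 m2 m3 m4] := mo; have w0' := w0.
by nbt; lra.
Qed.

Lemma nA : `|A| <= 3 * w.
Proof.
have h := nb2; have -> : A = u + v + b2 by rewrite /b2; ring.
have [m0 m1 m2 m3 m4] := mo; have w0' := w0; clearbody b2.
by nbt; lra.
Qed.

(** [y0] is (phi - l)/(1 - l), so the left side starts with the second order expansion of ln((1 -
    phi)/(1 - l)). Its first and second order terms agree with [INC]; every term on the right is of
    third order, up to powers of z. *)
Lemma inc_id : - y0 - y0 ^+ 2 / 2 - INC l u v x y g p q i i' =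
  - (s1 ^+ 2 * ((u + v) * b2 + b2 ^+ 2 / 2))
  + s1 * (u * i' + v * i + l * (i * i') / 2)
  - s1 ^+ 2 * (l * (1 - 2 * l) * ((3 * x * i + i ^+ 2) + (3 * y * i' + i' ^+ 2)) / 6
     - (1 - 2 * l) * (u * i + l * (2 * x * i + i ^+ 2) + (v * i' + l * (2 * y * i' + i' ^+ 2))) / 2
     - (2 * u * l * i + l ^+ 2 * i * (x + i) + (2 * v * l * i' + l ^+ 2 * i' * (y + i'))) / 2).
Proof.
have [l0 l1] := andP l01.
rewrite /INC /y0 /b2 /A /s1 /kap; field.
by rewrite !gt_eqF ?subr_gt0.
Qed.

Let z4 : 4 <= z. Proof. exact: z_ge4 l01 ez. Qed.
Let z0 : 0 <= z. Proof. exact: le_trans z4. Qed.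
Let w3 : 0 <= w ^+ 3. Proof. by have [] := mo3. Qed.
Let half_nb : `|2^-1 : R| <= 2^-1. Proof. by rewrite ger0_norm ?invr_ge0 ?ler0n. Qed.
Let sixth_nb : `|6^-1 : R| <= 6^-1. Proof. by rewrite ger0_norm ?invr_ge0 ?ler0n. Qed.

Lemma inc_p1 : `|(u + v) * b2 + b2 ^+ 2 / 2| <= 7 * (w ^+ 3 * z).
Proof.
move: nb2 hu hv half_nb; clearbody b2 => h1 h2 h3 h4; nbt.
have [_ _ _ m3 m4] := mo.
by have := gap_ge0 m4 m3; have [_ _ t2] := mo3; lra.
Qed.

Lemma inc_p2 : `|u * i' + v * i + l * (i * i') / 2| <= 3 * w ^+ 3.
Proof.
have hl := nl l01; have hf := half_nb.
have [_ _ w1 _] := sz; have g3 := gap_ge0 w3 w1; have w3' := w3.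
by nbt; lra.
Qed.

Lemma inc_p3 : `|l * (1 - 2 * l) * ((3 * x * i + i ^+ 2) + (3 * y * i' + i' ^+ 2)) / 6
     - (1 - 2 * l) * (u * i + l * (2 * x * i + i ^+ 2) + (v * i' + l * (2 * y * i' + i' ^+ 2))) / 2
     - (2 * u * l * i + l ^+ 2 * i * (x + i) + (2 * v * l * i' + l ^+ 2 * i' * (y + i'))) / 2| <= 9 * w ^+ 3.
Proof.
have hl := nl l01; have hf := half_nb; have hf6 := sixth_nb; have h1 := nl1 l01.
have [_ _ w1 _] := sz; have g3 := gap_ge0 w3 w1; have w3' := w3.
by nbt; lra.
Qed.

Lemma wz3_le : 4 * (w ^+ 3 * z ^+ 2) <= w ^+ 3 * z ^+ 3 /\ w ^+ 3 * z ^+ 3 <= o ^+ 3 / 64.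
Proof.
split.
  have -> : w ^+ 3 * z ^+ 3 = w ^+ 3 * z ^+ 2 * z by move: (z) => zz; ring.
  by rewrite [leRHS]mulrC ler_wpM2r // mulr_ge0 // exprn_ge0.
have [b0 b1] := ell_bounds l01; have [wz _ _ o0] := sz.
have -> : w ^+ 3 * z ^+ 3 = (w * z) ^+ 3 by rewrite exprMn.
have -> : o ^+ 3 / 64 = (o / 4) ^+ 3 by field.
have wz0 : 0 <= w * z := mulr_ge0 (ltW w0) z0.
have o4 : 0 <= o / 4 := divr_ge0 (ltW o0) (ler0n _ 4).
apply: lerXn2r; rewrite ?nnegrE //.
by apply: le_trans wz _; rewrite mulrC ler_wpM2l ?(ltW o0) // -[4^-1]mul1r.
Qed.

Lemma inc_poly : `|- y0 - y0 ^+ 2 / 2 - INC l u v x y g p q i i'| <= o ^+ 3.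
Proof.
rewrite inc_id.
have zz : `|s1 ^+ 2| <= z ^+ 2 by rewrite normrX ler_sqr ?nnegrE // ns1.
have P1 : `|- (s1 ^+ 2 * ((u + v) * b2 + b2 ^+ 2 / 2))| <= 7 * (w ^+ 3 * z ^+ 3).
  rewrite normrN; apply: le_trans (nbM zz inc_p1) _.
  by rewrite le_eqVlt; apply/orP; left; apply/eqP; move: (z) => zz'; ring.
have P2 : `|s1 * (u * i' + v * i + l * (i * i') / 2)| <= 3 * (w ^+ 3 * z ^+ 2).
  apply: le_trans (nbM ns1 inc_p2) _.
  have : 0 <= w ^+ 3 * z * (z - 4) by apply: gap_ge0 => //; apply: mulr_ge0.
  have : 0 <= w ^+ 3 * z by apply: mulr_ge0.
  by move: (w ^+ 3) => W; lra.
have P3 := nbM zz inc_p3.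
apply: le_trans (nbD (nbD P1 P2) (nbN P3)) _.
have [YX Yo] := wz3_le; have o3 : 0 <= o ^+ 3 by have [_ _ _ o0] := sz; rewrite exprn_ge0 // ltW.
have -> : z ^+ 2 * (9 * w ^+ 3) = 9 * (w ^+ 3 * z ^+ 2) by move: (z) => zz'; ring.
clear zz P1 P2 P3; lra.
Qed.
End IncNumeric.

(** * Existence of a graph with the given degrees *)

Section Existence.
Variables (m n : nat).
Implicit Types (G : {set 'I_m * 'I_n}).

Definition move_edge G (j : 'I_m) (a b : 'I_n) := (j, b) |: (G :\ (j, a)).

Lemma in_move G j a b j' k : ((j', k) \in move_edge G j a b) =
  ((j', k) == (j, b)) || ((j', k) != (j, a)) && ((j', k) \in G).
Proof. by rewrite in_setU1 in_setD1. Qed.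

Lemma move_degu G j a b j' : (j, a) \in G -> (j, b) \notin G -> degu (move_edge G j a b) j' = degu G j'.
Proof.
move=> ja jb; rewrite /move_edge degu_add ?in_setD1 ?(negPf jb) ?andbF //.
by rewrite -{2}(setD1K ja) [in RHS]degu_add ?setD11.
Qed.

Lemma move_degv G j a b k : (j, a) \in G -> (j, b) \notin G ->
  (degv (move_edge G j a b) k + (k == a) = degv G k + (k == b))%N.
Proof.
move=> ja jb; rewrite /move_edge degv_add ?in_setD1 ?(negPf jb) ?andbF //.
by rewrite -{2}(setD1K ja) [in RHS]degv_add ?setD11 // addnAC.
Qed.

Variables (s : 'I_m -> nat) (t : 'I_n -> nat).
(** The subtraction is truncated, so only columns of too large degree count. As the degree sums
    agree, excess 0 already means that all column degrees are right. *)
Definition excess G : nat := \sum_k (degv G k - t k)%N.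

Lemma excess_move G G' (a b : 'I_n) : (forall k, degv G' k + (k == a) = degv G k + (k == b))%N ->
  (t a < degv G a)%N -> (degv G b < t b)%N -> (excess G' < excess G)%N.
Proof.
move=> dE ta tb; have ab : a != b by apply: contraTneq ta => ->; rewrite -leqNgt ltnW.
rewrite /excess (bigD1 a) //= [X in (_ < X)%N](bigD1 a) //= -addSn leq_add //.
  by have := dE a; rewrite eqxx (negPf ab); lia.
by apply: leq_sum => k ka; have := dE k; rewrite (negPf ka); case: eqP => [->|_]; lia.
Qed.

Variables (R : realFieldType) (l tau : R).
Hypotheses (l01 : 0 < l < 1) (t0 : 0 < tau) (t3 : 3 * tau < l * (1 - l)).
Hypotheses (n0 : (0 < n)%N) (m0 : (0 < m)%N) (st : (\sum_j s j = \sum_k t k)%N).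
Hypotheses (sn : forall j, `|(s j)%:R - l * n%:R| <= tau * n%:R)
  (tm : forall k, `|(t k)%:R - l * m%:R| <= tau * m%:R).

(* If neither moving an edge nor moving along an alternating path of length four reduces the excess, then all column degrees are close to their average and every column meeting the rows not adjacent to [b] contains all rows adjacent to [a]; counting the edges in the former rows gives a contradiction. *)
Lemma excess_decr G : (forall j, degu G j = s j) -> (0 < excess G)%N ->
  exists2 G', forall j, degu G' j = s j & (excess G' < excess G)%N.
Proof.
move=> ds E0.
have [a ta] : exists a, (t a < degv G a)%N.
  apply/existsP; apply: contraLR E0 => /existsPn h; rewrite -leqNgt leqn0.
  by apply/eqP; apply: big1 => k _; apply/eqP; rewrite subn_eq0 leqNgt h.
have tot : (\sum_k degv G k = \sum_k t k)%N.
  by rewrite sum_degv -sum_degu (eq_bigr _ (fun j _ => ds j)).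
have [b tb] : exists b, (degv G b < t b)%N.
  apply/existsP; apply: contraPT tot => /existsPn h; apply/eqP; rewrite neq_ltn; apply/orP; right.
  rewrite (bigD1 a) //= [X in (_ < X)%N](bigD1 a) //= -addSn leq_add // leq_sum // => k _.
  by rewrite leqNgt h.
pose good G' := [forall j, degu G' j == s j] && (excess G' < excess G)%N.
have gE G' : good G' -> exists2 G', forall j, degu G' j = s j & (excess G' < excess G)%N.
  by case/andP => /forallP h1 h2; exists G' => // j; apply/eqP.
have [/existsP[G' /gE]//|/existsPn ng] := boolP [exists G', good G'].
have sub x y : (t x < degv G x)%N -> (degv G y < t y)%N -> forall j, (j, x) \in G -> (j, y) \in G.
  move=> tx ty j jx; apply: contraNT (ng (move_edge G j x y)) => jy; apply/andP; split.
    by apply/forallP => j'; rewrite move_degu ?ds.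
  by apply: (@excess_move _ _ x y) => // k; apply: move_degv.
have nest j1 j2 c : (j1, a) \in G -> (j2, b) \notin G -> (j2, c) \in G -> (j1, c) \in G.
  move=> j1a j2b j2c; apply: contraNT (ng (move_edge (move_edge G j1 a c) j2 c b)) => j1c.
  have j12 : j2 != j1 by apply: contraNneq j2b => ->; exact: (sub a b).
  have i1 : (j2, c) \in move_edge G j1 a c by rewrite in_move j2c !xpair_eqE (negPf j12).
  have i2 : (j2, b) \notin move_edge G j1 a c by rewrite in_move (negPf j2b) andbF orbF xpair_eqE (negPf j12).
  apply/andP; split; first by apply/forallP => j'; rewrite !move_degu ?ds.
  apply: (@excess_move _ _ a b) => // k.
  apply: (@addIn (k == c)); rewrite addnAC (move_degv k i1 i2) addnAC.
  by rewrite (move_degv k j1a j1c) addnAC.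
have dle x y : (t x < degv G x)%N -> (degv G y < t y)%N -> (degv G x <= degv G y)%N.
  by move=> tx ty; apply: subset_leq_card; apply/subsetP => j; rewrite !in_set; exact: sub.
have up k : (degv G k)%:R <= (l + tau) * m%:R.
  have key k' : (t k')%:R <= (l + tau) * m%:R by have := tm k'; rewrite ler_norml => /andP[]; lra.
  have [h|h] := leqP (degv G k) (t k); first by apply: le_trans (key k); rewrite ler_nat.
  by apply: le_trans (key b); rewrite ler_nat ltnW // (leq_ltn_trans (dle k b h tb)).
have low k : (l - tau) * m%:R <= (degv G k)%:R.
  have key k' : (l - tau) * m%:R <= (t k')%:R by have := tm k'; rewrite ler_norml => /andP[]; lra.
  have [h|h] := leqP (t k) (degv G k); first by apply: le_trans (key k) _; rewrite ler_nat.
  by apply: le_trans (key a) _; rewrite ler_nat ltnW // (leq_trans ta (dle a k ta h)).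
exfalso.
pose C := [set j | (j, b) \notin G].
have cC : (1 - l - tau) * m%:R <= #|C|%:R.
  have : (#|C| + degv G b = m)%N.
    rewrite /degv -[RHS]card_ord -(cardC [set j | (j, b) \in G]) addnC; congr (_ + _)%N.
    by apply: eq_card => j; rewrite !inE.
  move/(congr1 (fun x => x%:R : R)); rewrite natrD; have := up b; lra.
(* A column meeting C contains every row of column a. Those number at least (l - tau) m and lie
   outside C, since they also belong to b; of the at most (l + tau) m rows of the column at most 2
   tau m remain for C. *)
have col k : ((\sum_(j in C) ((j, k) \in G))%N%:R : R) <= 2 * tau * m%:R.
  have [/existsP[j /andP[jC jk]]|/existsPn h] := boolP [exists j, (j \in C) && ((j, k) \in G)]; last first.
    rewrite big1; first by rewrite mulr_ge0 // mulr_ge0 // ltW.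
    by move=> j jC; have := h j; rewrite jC /= => /negPf ->.
  have : (degv G a + \sum_(j in C) ((j, k) \in G) <= degv G k)%N.
    rewrite !degv_sum [leqRHS](bigID (mem C)) /= addnC leq_add2l [leqRHS]big_mkcond /=.
    apply: leq_sum => j' _; case: ifPn => j'C.
      case aG : ((j', a) \in G) => //; rewrite (nest j' j) //.
      by move: jC; rewrite inE.
    case aG : ((j', a) \in G) => //; move: j'C; rewrite negbK inE => /negP[].
    exact: (sub a b).
  rewrite -(ler_nat R) natrD; have := up k; have := low a; lra.
have tot1 : (\sum_(j in C) s j)%N%:R <= 2 * tau * m%:R * n%:R.
  have -> : (\sum_(j in C) s j = \sum_k \sum_(j in C) ((j, k) \in G))%N.
    by rewrite exchange_big /=; apply: eq_bigr => j _; rewrite -ds degu_sum.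
  rewrite natr_sum; apply: le_trans (ler_sum _ (fun k _ => col k)) _.
  by rewrite sumr_const card_ord -[_ *+ n]mulr_natr.
have : #|C|%:R * ((l - tau) * n%:R) <= (\sum_(j in C) s j)%N%:R.
  rewrite natr_sum mulr_natl -sumr_const; apply: ler_sum => j _.
  by have := sn j; rewrite ler_norml => /andP[]; lra.
have nR : 0 < n%:R :> R by rewrite ltr0n.
have mR : 0 < m%:R :> R by rewrite ltr0n.
have [l0 l1] := andP l01; have t3' := t3; have t0' := t0.
have lt1 : tau < l.
  have : l * (1 - l) <= l by rewrite ler_piMr //; lra.
  lra.
have : (1 - l - tau) * m%:R * ((l - tau) * n%:R) <= #|C|%:R * ((l - tau) * n%:R).
  by rewrite ler_wpM2r // mulr_ge0 //; lra.
move=> h1 h2; have := le_trans h1 (le_trans h2 tot1).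
have mn0 : 0 < m%:R * n%:R :> R by apply: mulr_gt0.
(* The count gives (1 - l - tau)(l - tau) <= 2 tau, contrary to 3 tau < l (1 - l). *)
rewrite -[2 * tau * m%:R * n%:R]mulrA mulrACA ler_pM2r // => h3.
have := sqr_ge0 tau; lra.
Qed.

(** Descent on the excess, starting from the graph in which row j occupies its first s_j columns. *)
Lemma bclass_nonempty : bclass s t != set0.
Proof.
have [l0 l1] := andP l01; have t3' := t3; have t0' := t0.
have sle j : (s j <= n)%N.
  have lt1 : tau < 1 - l.
    have : l * (1 - l) <= 1 - l by rewrite ler_piMl //; lra.
    lra.
  have := sn j; rewrite ler_norml -(ler_nat R) => /andP[_ h].
  have : (l + tau) * n%:R <= 1 * n%:R by rewrite ler_wpM2r //; lra.
  lra.
have cs (i k : nat) : (\sum_(x < i) (x < k) = minn i k)%N.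
  elim: i => [|i IH]; first by rewrite big_ord0 min0n.
  by rewrite big_ord_recr IH /=; lia.
have : forall N G, (excess G <= N)%N -> (forall j, degu G j = s j) -> exists G', G' \in bclass s t.
  elim=> [|N IH] G EN ds; last first.
    have [/eqP E0|E0] := boolP (excess G == 0%N); first by apply: (IH G) => //; rewrite E0.
    have [//|G' ds' EG] := excess_decr ds _; first by rewrite lt0n.
    by apply: (IH G') => //; rewrite -ltnS; apply: leq_trans EN.
  exists G; rewrite inE; apply/andP; split; first by apply/forallP => j; rewrite ds.
  have le k : (degv G k <= t k)%N.
    move: EN; rewrite leqn0 sum_nat_eq0 => /forallP/(_ k); by rewrite subn_eq0.
  have tot : (\sum_k degv G k = \sum_k t k)%N.
    by rewrite sum_degv -sum_degu (eq_bigr _ (fun j _ => ds j)).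
  have [_ h] := @leqif_sum _ xpredT _ _ _ (fun k _ => leqif_eq (le k)).
  by apply/forallP => k; move/eqP: tot; rewrite h => /forallP/(_ k).
case/(_ _ [set e : 'I_m * 'I_n | (e.2 < s e.1)%N] (leqnn _)).
  move=> j; rewrite degu_sum -[RHS](minn_idPr (sle j)) -cs.
  by apply: eq_bigr => k _; rewrite inE.
by move=> G GB; apply/set0Pn; exists G.
Qed.
End Existence.

From mathcomp Require Import all_classical all_reals all_analysis.
From mathcomp Require Import fintype finset.
Import Order.TTheory GRing.Theory Num.Theory.
Import numFieldNormedType.Exports.

(** * Logarithms and telescoping *)

Section LnTaylor.
Variable R : realType.

Let f (x : R) : R := ln x - (x - 1) + (x - 1) ^+ 2 / 2.
Let df (x : R) : R := x^-1 * (x - 1) ^+ 2.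

Let f_derive (x : R) : 0 < x -> is_derive x 1 f (df x).
Proof.
move=> x0; rewrite /f.
have d1 := is_derive1_ln x0.
have -> : (fun x => ln x - (x - 1) + (x - 1) ^+ 2 / 2) = (@ln R) - (id - cst 1) + (2^-1 \*: ((id - cst 1) ^+ 2)) :> (R -> R).
  apply/funext => y; rewrite !fctE /= mulrC; congr (_ + _ * _).
apply: is_derive_eq.
rewrite /df /= !fctE /= subr0 /GRing.scale /= !mulr1.
by field; rewrite gt_eqF.
Qed.

(** Mean value theorem for the remainder [f], whose derivative (x - 1)^2 / x is at most 2 y^2
    between 1 and 1 - y. *)
Lemma ln_taylor3 (y : R) : `|y| <= 1 / 2 -> `|ln (1 - y) - (- y - y ^+ 2 / 2)| <= 2 * `|y| ^+ 3.
Proof.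
move=> y2.
have E : ln (1 - y) - (- y - y ^+ 2 / 2) = f (1 - y) - f 1.
  by rewrite /f ln1; ring.
have key (c : R) : `|c - 1| <= `|y| -> `|df c| <= 2 * `|y| ^+ 2.
  move=> cy; have c2 : 1 / 2 <= c by move: (le_trans cy y2); rewrite ler_norml => /andP[]; lra.
  rewrite /df normrM normfV normrX ler_pM ?invr_ge0 ?exprn_ge0 //.
    rewrite ger0_norm; last by lra.
    by rewrite -[2]invrK lef_pV2 ?posrE ?invr_gt0 //; lra.
  by rewrite ler_sqr ?nnegrE.
have ct a b : 0 < a -> {within `[a, b], continuous f}%classic.
  move=> a0; apply: derivable_within_continuous => x; rewrite in_itv /= => /andP[ax _].
  by have [] := f_derive (lt_le_trans a0 ax).
rewrite E; move: y2; rewrite ler_norml => /andP[y2 y2'].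
case: (ltgtP y 0) => [yn|yp|->]; last by rewrite subr0 subrr !normr0 expr0n mulr0.
- have [] := @MVT_segment R f df 1 (1 - y) _ _ (ct _ _ _); first by lra.
  + by move=> x; rewrite in_itv /= => /andP[x1 _]; apply: f_derive; lra.
  + by [].
  move=> c; rewrite in_itv /= => /andP[c1 c2] ->.
  rewrite normrM (_ : 1 - y - 1 = - y); last by ring.
  rewrite normrN exprSr mulrA ler_wpM2r // key //.
  by rewrite ger0_norm ?ltr0_norm //; lra.
- have [] := @MVT_segment R f df (1 - y) 1 _ _ (ct _ _ _); first by lra.
  + by move=> x; rewrite in_itv /= => /andP[x1 _]; apply: f_derive; lra.
  + lra.
  move=> c; rewrite in_itv /= => /andP[c1 c2] D.
  rewrite distrC D normrM (_ : 1 - (1 - y) = y); last by ring.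
  rewrite exprSr mulrA ler_wpM2r // key //.
  by rewrite distrC ger0_norm ?gtr0_norm //; lra.
Qed.
End LnTaylor.

Section LogIncrement.
Variable R : realType.
Variables (l w o u v x y g p q i i' P : R).
Local Notation ell := (l * (1 - l)).
Local Notation z := (ell^-1).
Hypotheses (l01 : 0 < l < 1) (w0 : 0 < w) (wo : w <= ell ^+ 2 * o) (o1 : o <= 1 / 200).
Hypotheses (hu : `|u| <= w) (hv : `|v| <= w) (hx : `|x| <= w) (hy : `|y| <= w)
  (hg : `|g| <= w ^+ 2) (hp : `|p| <= w ^+ 2) (hq : `|q| <= w ^+ 2)
  (hi : `|i| <= w ^+ 2) (hi' : `|i'| <= w ^+ 2).
Hypotheses (hP : `|P - (l + u + v - g + u * x + v * y + kap l * u * v + p + q)| <= 45 * 100 * o ^+ 3)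
  (hP1 : `|P - l| <= 45 * (w * z)).

(** 1 - P is (1 - l)(1 - y1) with y1 = (P - l)/(1 - l). The crude bound keeps y1 below 45 o, in the
    range of the expansion, and y1 differs from its prediction [y0] by a third order error; dividing
    by 1 - l costs the factor z. *)
Lemma ln_inc : 1 - P > 0 /\ `|ln (1 - P) - ln (1 - l) - INC l u v x y g p q i i'| <= z * (100 * o) ^+ 3.
Proof.
have [l0 l1] := andP l01; have [e0 e1] := ell_bounds l01.
have ez : ell * z = 1 by rewrite divff // gt_eqF.
have [q1 q2 q3 q4] := sizes l01 ez w0 wo o1; have z4 := z_ge4 l01 ez; have w0' := w0; have o1' := o1.
have ip := inc_poly l01 w0 wo o1 hu hv hx hy hg hp hq hi hi'.
have nA := nA l01 w0 wo o1 hu hv hx hy hg hp hq.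
set A := u + v - g + u * x + v * y + kap l * u * v + p + q in ip nA.
have hPA : `|P - l - A| <= 45 * 100 * o ^+ 3 by rewrite (_ : P - l - A = P - (l + u + v - g + u * x + v * y + kap l * u * v + p + q)) // /A; ring.
have s1z := ns1 l01.
have s0 : 0 < (1 - l)^-1 by rewrite invr_gt0 subr_gt0.
have ls : (1 - l) * (1 - l)^-1 = 1 by rewrite divff // gt_eqF ?subr_gt0.
set s1 := (1 - l)^-1 in ip s1z s0 ls; set y0 := A * s1 in ip.
pose y1 := (P - l) * s1.
have es : ell * s1 <= 1 by rewrite -mulrA ls mulr1 ltW.
have wzs : w * z * s1 <= o.
  apply: (@le_trans _ _ (ell * o * s1)); first by rewrite ler_wpM2r // ltW.
  by rewrite mulrAC; apply: ler_piMl => //; exact: ltW.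
have wz0 : 0 <= w * z by apply: mulr_ge0; [exact: ltW|exact: le_trans z4].
have n1 : `|y1| <= 45 * o.
  rewrite /y1 normrM (gtr0_norm s0).
  have : `|P - l| * s1 <= 45 * (w * z) * s1 by rewrite ler_wpM2r // ltW.
  lra.
have n0 : `|y0| <= o.
  rewrite /y0 normrM (gtr0_norm s0).
  have : `|A| * s1 <= w * z * s1.
    rewrite ler_wpM2r ?(ltW s0) //; apply: le_trans nA _.
    have : 0 <= w * (z - 4) by apply: gap_ge0 => //; apply: ltW.
    lra.
  lra.
have b0 : 0 <= o ^+ 3 by rewrite exprn_ge0 // ltW.
have nd : `|y1 - y0| <= 45 * 100 * o ^+ 3 * z.
  by rewrite /y1 /y0 -mulrBl; apply: nbM => //; rewrite gtr0_norm.
have pE : 1 - P = (1 - l) * (1 - y1).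
  by rewrite /y1; transitivity ((1 - l) - (P - l) * ((1 - l) * s1)); [rewrite ls|]; ring.
have y14 : `|y1| <= 1 / 2 by lra.
have y1' : 0 < 1 - y1 by move: y14; rewrite ler_norml; lra.
split; first by rewrite pE mulr_gt0 // subr_gt0.
rewrite pE lnM ?posrE ?subr_gt0 //; last by lra.
have T := ln_taylor3 y14.
have nT : 2 * `|y1| ^+ 3 <= 2 * (45 * o) ^+ 3.
  by rewrite ler_wpM2l // lerXn2r ?nnegrE //; lra.
have nsq : `|y1 ^+ 2 / 2 - y0 ^+ 2 / 2| <= 45 * 100 * o ^+ 3 * z / 2.
  rewrite (_ : y1 ^+ 2 / 2 - y0 ^+ 2 / 2 = (y1 - y0) * ((y1 + y0) / 2)); last by field.
  apply: le_trans (nbM nd (_ : _ <= 1 / 2)) _; last by lra.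
  by move: n1 n0; rewrite !ler_norml; lra.
rewrite (_ : ln (1 - l) + ln (1 - y1) - ln (1 - l) - INC l u v x y g p q i i' =
  (ln (1 - y1) - (- y1 - y1 ^+ 2 / 2)) - (y1 - y0) - (y1 ^+ 2 / 2 - y0 ^+ 2 / 2)
   + (- y0 - y0 ^+ 2 / 2 - INC l u v x y g p q i i')); last by ring.
apply: le_trans (nbD (nbD (nbD (le_trans T nT) (nbN nd)) (nbN nsq)) ip) _.
have -> : (45 * o) ^+ 3 = 45 * (45 * (45 * o ^+ 3)) by ring.
have -> : (100 * o) ^+ 3 = 100 * (100 * (100 * o ^+ 3)) by ring.
have zb : 4 * o ^+ 3 <= o ^+ 3 * z by rewrite mulrC ler_wpM2l.
set c := o ^+ 3 in b0 zb *.
have -> : z * (100 * (100 * (100 * c))) = 100 * (100 * (100 * (c * z))) by ring.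
have -> : 45 * 100 * c * z = 45 * (100 * (c * z)) by ring.
set d := c * z in zb *.
lra.
Qed.
End LogIncrement.

(** * Revealing the edges of H one by one *)

Section Telescope.
Variables (R : realType) (m n : nat) (s : 'I_m -> nat) (t : 'I_n -> nat).
Variables (l w o h v : R) (K : nat).
Local Notation ell := (l * (1 - l)).
Local Notation z := (ell^-1).
Local Notation s0 := (@set0 ('I_m * 'I_n)%type).
Implicit Types (S H : {set 'I_m * 'I_n}).
Hypotheses (l01 : 0 < l < 1) (w0 : 0 < w) (wo : w <= ell ^+ 2 * o) (o1 : o <= 1 / 200)
  (hw : h <= w ^+ 2) (o2 : 44 * o <= 1 / 20) (o3 : 1100 * o <= 1 / 4) (oe : o <= l * (1 - l) / 100).
Hypotheses (n0 : (0 < n)%N) (m0 : (0 < m)%N) (st : (\sum_j s j = \sum_k t k)%N)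
  (hm : 1 <= h * m%:R) (hn : 1 <= h * n%:R).
Hypotheses (Ko : 3 <= o * K%:R) (v0 : 0 <= v) (vw : v + (4 * (K + K)%:R + 6) * h <= w).
Hypothesis ls : (\sum_j s j)%N%:R = l * (m%:R * n%:R).

Let nR : n%:R != 0 :> R. Proof. by rewrite pnatr_eq0 -lt0n. Qed.
Let mR : m%:R != 0 :> R. Proof. by rewrite pnatr_eq0 -lt0n. Qed.
Definition row_dev j : R := (s j)%:R - l * n%:R.
Definition col_dev k : R := (t k)%:R - l * m%:R.
Local Notation b := row_dev.
Local Notation c := col_dev.

Lemma le_of_eq (x y : R) : x = y -> x <= y. Proof. by move->. Qed.
Lemma degu0 j : degu s0 j = 0%N. Proof. by rewrite degu_sum big1 // => k _; rewrite inE. Qed.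
Lemma degv0 k : degv s0 k = 0%N. Proof. by rewrite degv_sum big1 // => k' _; rewrite inE. Qed.

Lemma uu_miss S j : uu s l s0 S j = (b j + l * (degu S j)%:R) / n%:R.
Proof. by rewrite /uu set0U degu0 /b subr0; congr (_ / _); ring. Qed.
Lemma vv_miss S k : vv t l s0 S k = (c k + l * (degv S k)%:R) / m%:R.
Proof. by rewrite /vv set0U degv0 /c subr0; congr (_ / _); ring. Qed.
(** Up to sign this is the excess for avoiding S in the complementary problem, with density 1 - l
    and negated deviations. So containing and avoiding share one increment formula. *)
Lemma uu_hit S j : uu s l S s0 j = - ((- b j + (1 - l) * (degu S j)%:R) / n%:R).
Proof. by rewrite /uu setU0 /b -[RHS]mulNr; congr (_ / _); ring. Qed.
Lemma vv_hit S k : vv t l S s0 k = - ((- c k + (1 - l) * (degv S k)%:R) / m%:R).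
Proof. by rewrite /vv setU0 /c -[RHS]mulNr; congr (_ / _); ring. Qed.
Lemma sg_miss S : sg s l s0 S = l * #|S|%:R / (m%:R * n%:R).
Proof. by rewrite sgE // ls set0U cards0 subr0; congr (_ / _); ring. Qed.
Lemma sg_hit S : sg s l S s0 = - ((1 - l) * #|S|%:R / (m%:R * n%:R)).
Proof. by rewrite sgE // ls setU0 -[RHS]mulNr; congr (_ / _); ring. Qed.

Let h0' : 0 < h. Proof. exact: (h_gt0 n0 hn). Qed.
Let vw2 : v + h + h <= w.
Proof.
apply: le_trans vw; rewrite -addrA lerD2l.
have : 0 <= (K + K)%:R * h by rewrite mulr_ge0 // ltW.
have h0 := h0'; lra.
Qed.
Let vw1 : v <= w. Proof. have h0 := h0'; have vw2' := vw2; lra. Qed.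

Let nph I O j : good s t l w I O -> `|ph t l I O j| <= w ^+ 2.
Proof.
move=> g; rewrite /ph normrM normfV (@ger0_norm _ n%:R) //.
have n1 : 0 < n%:R :> R by rewrite ltr0n.
rewrite ler_pdivrMr //; apply: le_trans (ler_norm_sum _ _ _) _.
apply: (@le_trans _ _ (\sum_(k | (j, k) \in I :|: O) w)); first by apply: ler_sum => k _; apply: g_v g k.
rewrite sumr_const -[w *+ _]mulr_natr expr2 -mulrA ler_wpM2l ?(ltW w0) //.
have := g_x g j; rewrite /xi ler_pdivrMr // => H; apply: le_trans H.
by rewrite /degu ler_nat; apply: eq_leq; apply: eq_card => k; rewrite in_set.
Qed.
Let nth_ I O k : good s t l w I O -> `|th s l I O k| <= w ^+ 2.
Proof.
move=> g; rewrite /th normrM normfV (@ger0_norm _ m%:R) //.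
have n1 : 0 < m%:R :> R by rewrite ltr0n.
rewrite ler_pdivrMr //; apply: le_trans (ler_norm_sum _ _ _) _.
apply: (@le_trans _ _ (\sum_(j | (j, k) \in I :|: O) w)); first by apply: ler_sum => j _; apply: g_u g j.
rewrite sumr_const -[w *+ _]mulr_natr expr2 -mulrA ler_wpM2l ?(ltW w0) //.
have := g_z g k; rewrite /ze ler_pdivrMr // => H; apply: le_trans H.
by rewrite /degv ler_nat; apply: eq_leq; apply: eq_card => j; rewrite in_set.
Qed.

Let hin : `|n%:R^-1 : R| <= w ^+ 2.
Proof. by rewrite ger0_norm ?invr_ge0 //; apply: le_trans hw; exact: h_n. Qed.
Let him : `|m%:R^-1 : R| <= w ^+ 2.
Proof. by rewrite ger0_norm ?invr_ge0 //; apply: le_trans hw; exact: h_m. Qed.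

Lemma miss_step S j k : good s t l v s0 S -> 0 < cnt R s t s0 S -> (j, k) \notin S ->
  0 < cnt R s t s0 ((j, k) |: S) /\
  `|ln (cnt R s t s0 ((j, k) |: S) / cnt R s t s0 S) - ln (1 - l)
    - (MF l b c ((j, k) |: S) - MF l b c S)| <= z * (100 * o) ^+ 3.
Proof.
move=> g c0 e; have e' : (j, k) \notin s0 :|: S by rewrite set0U.
have hP := pr_approx l01 w0 wo o1 hw o2 o3 oe n0 m0 st hm hn Ko v0 vw g c0 e'.
have hP1 := crude_pr n0 m0 st l01 w0 wo o1 hm hn hw v0 vw2 g c0 e'.
have gw := good_le v0 vw1 g.
have nx : `|xi R s0 S j| <= w by rewrite ger0_norm ?(g_x gw) // divr_ge0.
have nz' : `|ze R s0 S k| <= w by rewrite ger0_norm ?(g_z gw) // divr_ge0.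
have [p0 hL] := ln_inc l01 w0 wo o1 (g_u gw j) (g_v gw k) nx nz' (g_sg gw) (nph j gw) (nth_ k gw) hin him hP hP1.
rewrite pr_out // in p0 hL; split; first by move: p0; rewrite pmulr_lgt0 // invr_gt0.
rewrite MF_inc //; move: hL.
rewrite uu_miss vv_miss sg_miss /xi /ze /ph /th !set0U.
rewrite (eq_bigr (fun k' => (c k' + l * (degv S k')%:R) / m%:R)); last by move=> k' _; rewrite vv_miss.
by rewrite (eq_bigr (fun k' => (b k' + l * (degu S k')%:R) / n%:R)) // => k' _; rewrite uu_miss.
Qed.

Lemma hit_step S j k : good s t l v S s0 -> 0 < cnt R s t S s0 -> (j, k) \notin S ->
  0 < cnt R s t ((j, k) |: S) s0 /\
  `|ln (cnt R s t ((j, k) |: S) s0 / cnt R s t S s0) - ln l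
    - (MF (1 - l) (fun j => - b j) (fun k => - c k) ((j, k) |: S) - MF (1 - l) (fun j => - b j) (fun k => - c k) S)| <= z * (100 * o) ^+ 3.
Proof.
move=> g c0 e; have e' : (j, k) \notin S :|: s0 by rewrite setU0.
have hP := pr_approx l01 w0 wo o1 hw o2 o3 oe n0 m0 st hm hn Ko v0 vw g c0 e'.
have hP1 := crude_pr n0 m0 st l01 w0 wo o1 hm hn hw v0 vw2 g c0 e'.
have gw := good_le v0 vw1 g.
have nx : `|xi R S s0 j| <= w by rewrite ger0_norm ?(g_x gw) // divr_ge0.
have nz' : `|ze R S s0 k| <= w by rewrite ger0_norm ?(g_z gw) // divr_ge0.
have eE : (1 - l) * (1 - (1 - l)) = ell by ring.
have l01' : 0 < 1 - l < 1 by have [a1 a2] := andP l01; apply/andP; split; lra.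
have wo' : w <= ((1 - l) * (1 - (1 - l))) ^+ 2 * o by rewrite eE.
set P := pr R s t S s0 (j, k) in hP hP1.
have N (x a : R) : `|x| <= a -> `|- x| <= a by rewrite normrN.
(* [phi] is compatible with complementation: the excesses and their sums change sign, [xi] and [ze]
   do not, and [kap] changes sign, as the product term requires. *)
have hP' : `|1 - P - (1 - l + - uu s l S s0 j + - vv t l S s0 k - - sg s l S s0
    + - uu s l S s0 j * xi R S s0 j + - vv t l S s0 k * ze R S s0 k
    + kap (1 - l) * - uu s l S s0 j * - vv t l S s0 k + - ph t l S s0 j + - th s l S s0 k)| <= 45 * 100 * o ^+ 3.
  apply: le_trans hP; apply: le_of_eq; rewrite -normrN; congr `|_|; rewrite /phi.
  have -> : kap (1 - l) = - kap l by rewrite /kap eE -[RHS]mulNr; congr (_ / _); ring.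
  ring.
have hP1' : `|1 - P - (1 - l)| <= 45 * (w * ((1 - l) * (1 - (1 - l)))^-1).
  by rewrite eE; apply: le_trans hP1; apply: le_of_eq; rewrite -normrN; congr `|_|; ring.
have [p0 hL] := ln_inc l01' w0 wo' o1 (N _ _ (g_u gw j)) (N _ _ (g_v gw k)) nx nz' (N _ _ (g_sg gw))
   (N _ _ (nph j gw)) (N _ _ (nth_ k gw)) hin him hP' hP1'.
have E1 (x : R) : 1 - (1 - x) = x by ring.
rewrite E1 /P prE in p0; rewrite eE !E1 /P prE in hL; split; first by move: p0; rewrite pmulr_lgt0 // invr_gt0.
rewrite MF_inc //; move: hL.
rewrite uu_hit vv_hit sg_hit /xi /ze /ph /th !setU0.
rewrite (eq_bigr (fun k' => - ((- c k' + (1 - l) * (degv S k')%:R) / m%:R))); last by move=> k' _; rewrite vv_hit.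
rewrite (eq_bigr (fun k' => - ((- b k' + (1 - l) * (degu S k')%:R) / n%:R))); last by move=> k' _; rewrite uu_hit.
by rewrite !sumrN !mulNr !opprK.
Qed.

(** Induction on the number of edges. The states passed on the way have subsets of S revealed, so
    all of these have to be [good]. *)
Lemma miss_ln S : (forall S', S' \subset S -> good s t l v s0 S') -> 0 < cnt R s t s0 s0 ->
  0 < cnt R s t s0 S /\
  `|ln (cnt R s t s0 S / cnt R s t s0 s0) - #|S|%:R * ln (1 - l) - MF l b c S| <= #|S|%:R * (z * (100 * o) ^+ 3).
Proof.
move=> g c0; elim: {S}_.+1 {-2}S (ltnSn #|S|) g => // N IH S SN g.
have [->|[e eS]] := set_0Vmem S.
  by split=> //; rewrite cards0 MF0 divff ?gt_eqF // ln1 !mul0r !subr0 normr0.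
case: e eS => j k eS; set S' := S :\ (j, k).
have SE : S = (j, k) |: S' by rewrite setD1K.
have nS' : (j, k) \notin S' by rewrite setD11.
have cS : #|S| = #|S'|.+1 by rewrite {1}SE cardsU1 nS'.
have sub : S' \subset S by rewrite subD1set.
have [|//|c1 B1] := IH S'; first by rewrite -ltnS -cS.
  by move=> S2 S2S; apply: g; apply: subset_trans sub.
have [c2 B2] := miss_step (g _ sub) c1 nS'.
rewrite -SE in c2 B2; split=> //.
have -> : cnt R s t s0 S / cnt R s t s0 s0 = cnt R s t s0 S' / cnt R s t s0 s0 * (cnt R s t s0 S / cnt R s t s0 S').
  by field; rewrite !gt_eqF.
rewrite lnM ?posrE ?divr_gt0 //.
rewrite cS -[(#|S'|.+1)%:R]natr1 [leRHS]mulrDl mul1r.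
apply: le_trans (nbD B1 B2); apply: le_of_eq; congr `|_|; ring.
Qed.
Lemma hit_ln S : (forall S', S' \subset S -> good s t l v S' s0) -> 0 < cnt R s t s0 s0 ->
  0 < cnt R s t S s0 /\
  `|ln (cnt R s t S s0 / cnt R s t s0 s0) - #|S|%:R * ln l - MF (1 - l) (fun j => - b j) (fun k => - c k) S| <= #|S|%:R * (z * (100 * o) ^+ 3).
Proof.
move=> g c0; elim: {S}_.+1 {-2}S (ltnSn #|S|) g => // N IH S SN g.
have [->|[e eS]] := set_0Vmem S.
  by split=> //; rewrite cards0 MF0 divff ?gt_eqF // ln1 !mul0r !subr0 normr0.
case: e eS => j k eS; set S' := S :\ (j, k).
have SE : S = (j, k) |: S' by rewrite setD1K.
have nS' : (j, k) \notin S' by rewrite setD11.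
have cS : #|S| = #|S'|.+1 by rewrite {1}SE cardsU1 nS'.
have sub : S' \subset S by rewrite subD1set.
have [|//|c1 B1] := IH S'; first by rewrite -ltnS -cS.
  by move=> S2 S2S; apply: g; apply: subset_trans sub.
have [c2 B2] := hit_step (g _ sub) c1 nS'.
rewrite -SE in c2 B2; split=> //.
have -> : cnt R s t S s0 / cnt R s t s0 s0 = cnt R s t S' s0 / cnt R s t s0 s0 * (cnt R s t S s0 / cnt R s t S' s0).
  by field; rewrite !gt_eqF.
rewrite lnM ?posrE ?divr_gt0 //.
rewrite cS -[(#|S'|.+1)%:R]natr1 [leRHS]mulrDl mul1r.
apply: le_trans (nbD B1 B2); apply: le_of_eq; congr `|_|; ring.
Qed.
End Telescope.

(** * The two exponents as values of [MF] *)

Section MainTermDefs.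
Variables (R : realType) (m n : nat) (s : 'I_m -> nat) (t : 'I_n -> nat)
  (H : {set 'I_m * 'I_n}).
Local Notation l := (lam R n s).
Local Notation b := (fun j => (s j)%:R - savg R s).
Local Notation c := (fun k => (t k)%:R - tavg R t).
Hypotheses (n0 : (0 < n)%N) (m0 : (0 < m)%N) (l01 : 0 < l < 1).

Let XrE : Xr R H = #|H|%:R. Proof. by rewrite /Xr /Xn sum_degu. Qed.

Lemma miss_main_MF : miss_main R s t H = MF l b c H.
Proof. by rewrite /miss_main /MF XrE. Qed.

Let nR : n%:R != 0 :> R. Proof. by rewrite pnatr_eq0 -lt0n. Qed.
Let mR : m%:R != 0 :> R. Proof. by rewrite pnatr_eq0 -lt0n. Qed.

Let dE j : - ((s j)%:R - savg R s) + (1 - l) * (degu H j)%:R = (degu H j)%:R - dlt R s H j.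
Proof. by rewrite /dlt /xd; ring. Qed.
Let eE k : - ((t k)%:R - tavg R t) + (1 - l) * (degv H k)%:R = (degv H k)%:R - Defs.eta R s t H k.
Proof. by rewrite /Defs.eta /yd; ring. Qed.

(** Complementation turns delta into x - delta and eta into y - eta. Expanding the powers of these
    differences produces the coefficients of [hit_main] and the combination of Y, [Y01], [Y10] and
    [Y11]. *)
Lemma hit_main_MF : hit_main R s t H = MF (1 - l) (fun j => - b j) (fun k => - c k) H.
Proof.
pose rs' F := rs F (1 - l) (fun j => - b j) H; pose cs' F := cs F (1 - l) (fun k => - c k) H.
have r (F : R -> R -> R) : rs' F = \sum_j F ((degu H j)%:R - dlt R s H j) (degu H j)%:R.
  by apply: eq_bigr => j _; rewrite dE.
have k (F : R -> R -> R) : cs' F = \sum_j F ((degv H j)%:R - Defs.eta R s t H j) (degv H j)%:R.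
  by apply: eq_bigr => j _; rewrite eE.
pose R_ := @Rhl R m n s H; pose C_ := @Chl R m n s t H.
have r11 : rs' (fun d x => d ^+ 1 * x ^+ 1) = R_ 0%N 2%N - R_ 1%N 1%N.
  by rewrite r -sumrB; apply: eq_bigr => j _; rewrite /xd; ring.
have r02 : rs' (fun d x => d ^+ 0 * x ^+ 2) = R_ 0%N 2%N.
  by rewrite r; apply: eq_bigr => j _.
have r03 : rs' (fun d x => d ^+ 0 * x ^+ 3) = R_ 0%N 3%N.
  by rewrite r; apply: eq_bigr => j _.
have r12 : rs' (fun d x => d ^+ 1 * x ^+ 2) = R_ 0%N 3%N - R_ 1%N 2%N.
  by rewrite r -sumrB; apply: eq_bigr => j _; rewrite /xd; ring.
have r21 : rs' (fun d x => d ^+ 2 * x ^+ 1) = R_ 0%N 3%N - 2 * R_ 1%N 2%N + R_ 2%N 1%N.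
  by rewrite r mulr_sumr -sumrB -big_split; apply: eq_bigr => j _; rewrite /xd /=; ring.
have c11 : cs' (fun d x => d ^+ 1 * x ^+ 1) = C_ 0%N 2%N - C_ 1%N 1%N.
  by rewrite k -sumrB; apply: eq_bigr => j _; rewrite /yd; ring.
have c02 : cs' (fun d x => d ^+ 0 * x ^+ 2) = C_ 0%N 2%N.
  by rewrite k; apply: eq_bigr => j _.
have c03 : cs' (fun d x => d ^+ 0 * x ^+ 3) = C_ 0%N 3%N.
  by rewrite k; apply: eq_bigr => j _.
have c12 : cs' (fun d x => d ^+ 1 * x ^+ 2) = C_ 0%N 3%N - C_ 1%N 2%N.
  by rewrite k -sumrB; apply: eq_bigr => j _; rewrite /yd; ring.
have c21 : cs' (fun d x => d ^+ 2 * x ^+ 1) = C_ 0%N 3%N - 2 * C_ 1%N 2%N + C_ 2%N 1%N.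
  by rewrite k mulr_sumr -sumrB -big_split; apply: eq_bigr => j _; rewrite /yd /=; ring.
have y : ys (1 - l) (fun j => - b j) (fun k => - c k) H = Ysum R s t H - Y01 R s H - Y10 R s t H + Y11 R H.
  by rewrite -!sumrB -big_split; apply: eq_bigr => e _; rewrite dE eE /xd /yd /=; ring.
rewrite /hit_main /MF XrE y -![rs _ _ _ _]/(rs' _) -![cs _ _ _ _]/(cs' _).
rewrite r11 r02 r03 r12 r21 c11 c02 c03 c12 c21 -/R_ -/C_.
have [l0 l1] := andP l01.
have lR : l != 0 by rewrite gt_eqF.
have lR' : 1 - l != 0 by rewrite gt_eqF // subr_gt0.
move: nR mR lR lR'; move: (n%:R) (m%:R) (lam R n s) (R_ 1%N 1%N) (R_ 0%N 2%N) (R_ 0%N 3%N) (R_ 1%N 2%N) (R_ 2%N 1%N)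
  (C_ 1%N 1%N) (C_ 0%N 2%N) (C_ 0%N 3%N) (C_ 1%N 2%N) (C_ 2%N 1%N) (#|H|%:R) (Y11 R H) (Y01 R s H) (Y10 R s t H) (Ysum R s t H).
move=> nr mr l' *; field.
have -> : 1 - (1 - l') = l' by ring.
by apply/and4P.
Qed.
End MainTermDefs.

(** * The estimate for fixed parameters *)

Section Finite.
Variables (R : realType) (m n : nat) (s : 'I_m -> nat) (t : 'I_n -> nat) (H : {set 'I_m * 'I_n}).
Implicit Types (S : {set 'I_m * 'I_n}).
Variable v : R.
Local Notation l := (lam R n s).
Local Notation ell := (l * (1 - l)).
Local Notation s0 := (@set0 ('I_m * 'I_n)%type).
Hypotheses (n0 : (0 < n)%N) (m0 : (0 < m)%N) (st : (\sum_j s j = \sum_k t k)%N) (l01 : 0 < l < 1).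
Hypotheses (v0 : 0 < v) (vl : v <= ell ^+ 3 / (11 * 200)) (vm : 1 <= v ^+ 2 * m%:R) (vn : 1 <= v ^+ 2 * n%:R).
Hypotheses (hs : forall j, `|(s j)%:R - savg R s| <= v / 2 * n%:R)
  (ht : forall k, `|(t k)%:R - tavg R t| <= v / 2 * m%:R)
  (hx : forall j, (degu H j)%:R <= v / 2 * n%:R) (hy : forall k, (degv H k)%:R <= v / 2 * m%:R)
  (hX : #|H|%:R <= v ^+ 2 * (m%:R * n%:R)).

Let nR : n%:R != 0 :> R. Proof. by rewrite pnatr_eq0 -lt0n. Qed.
Let mR : m%:R != 0 :> R. Proof. by rewrite pnatr_eq0 -lt0n. Qed.
Let n1 : 0 < n%:R :> R. Proof. by rewrite ltr0n. Qed.
Let m1 : 0 < m%:R :> R. Proof. by rewrite ltr0n. Qed.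

Let savgE : savg R s = l * n%:R. Proof. by rewrite /lam divfK. Qed.
Let tavgE : tavg R t = l * m%:R.
Proof. by rewrite /lam /savg /tavg -!natr_sum st; field; rewrite nR mR. Qed.
Let ls : (\sum_j s j)%N%:R = l * (m%:R * n%:R).
Proof. by rewrite /lam /savg -natr_sum; field; rewrite nR mR. Qed.

Let bnd (b c x N : R) : 0 < N -> `|b| <= v / 2 * N -> 0 <= c <= 1 -> 0 <= x <= v / 2 * N -> `|(b + c * x) / N| <= v.
Proof.
move=> N0 hb /andP[c0 c1] /andP[x0 xN]; rewrite normrM normfV (gtr0_norm N0) ler_pdivrMr //.
apply: le_trans (ler_normD _ _) _; rewrite (ger0_norm (x := c * x)) ?mulr_ge0 //.
have : c * x <= x by rewrite ler_piMl.
lra.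
Qed.

Let degu_le S j : S \subset H -> (0 : R) <= (degu S j)%:R <= v / 2 * n%:R.
Proof.
move=> /subsetP SH; rewrite ler0n /=; apply: le_trans (hx j); rewrite ler_nat.
by apply: subset_leq_card; apply/subsetP => k; rewrite !in_set; apply: SH.
Qed.
Let degv_le S k : S \subset H -> (0 : R) <= (degv S k)%:R <= v / 2 * m%:R.
Proof.
move=> /subsetP SH; rewrite ler0n /=; apply: le_trans (hy k); rewrite ler_nat.
by apply: subset_leq_card; apply/subsetP => j; rewrite !in_set; apply: SH.
Qed.
Let card_le S : S \subset H -> #|S|%:R <= v ^+ 2 * (m%:R * n%:R).
Proof. by move=> SH; apply: le_trans hX; rewrite ler_nat subset_leq_card. Qed.

Let xb (x N : R) : 0 < N -> 0 <= x <= v / 2 * N -> x / N <= v.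
Proof. by move=> N0 /andP[_ xN]; rewrite ler_pdivrMr //; have := mulr_gt0 v0 N0; lra. Qed.

Let sgb (c X : R) : 0 <= c <= 1 -> 0 <= X -> X <= v ^+ 2 * (m%:R * n%:R) -> `|c * X / (m%:R * n%:R)| <= v ^+ 2.
Proof.
move=> /andP[c0 c1] X0 Xv; have mn : 0 < m%:R * n%:R :> R by rewrite mulr_gt0.
rewrite ger0_norm ?divr_ge0 ?mulr_ge0 // ler_pdivrMr //; apply: le_trans Xv.
by rewrite ler_piMl.
Qed.

Let l0 : 0 <= l <= 1. Proof. by have [a b] := andP l01; apply/andP; split; lra. Qed.
Let l1 : 0 <= 1 - l <= 1. Proof. by have [a b] := andP l01; apply/andP; split; lra. Qed.

Let good_miss S : S \subset H -> good s t l v s0 S.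
Proof.
move=> SH; split.
- by rewrite -setI_eq0 set0I.
- by move=> j; rewrite uu_miss; apply: bnd => //; [rewrite /row_dev -savgE|apply: degu_le].
- by move=> j; rewrite /xi set0U; apply: xb => //; apply: degu_le.
- by move=> k; rewrite vv_miss; apply: bnd => //; [rewrite /col_dev -tavgE|apply: degv_le].
- by move=> k; rewrite /ze set0U; apply: xb => //; apply: degv_le.
- by rewrite (sg_miss n0 m0 ls); apply: sgb => //; apply: card_le.
- by rewrite set0U card_le.
Qed.

Let good_hit S : S \subset H -> good s t l v S s0.
Proof.
move=> SH; split.
- by rewrite -setI_eq0 setI0.
- by move=> j; rewrite uu_hit normrN; apply: bnd => //; [rewrite /row_dev -savgE normrN|apply: degu_le].
- by move=> j; rewrite /xi setU0; apply: xb => //; apply: degu_le.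
- by move=> k; rewrite vv_hit normrN; apply: bnd => //; [rewrite /col_dev -tavgE normrN|apply: degv_le].
- by move=> k; rewrite /ze setU0; apply: xb => //; apply: degv_le.
- by rewrite (sg_hit n0 m0 ls) normrN; apply: sgb => //; apply: card_le.
- by rewrite setU0 card_le.
Qed.

(** The general estimates are used with [w = 2 * v] and [h = v ^+ 2]; [o] turns the condition on w
    into an equality, and [K] is the least convenient number of rounds of order 3/o. *)
Let o := 2 * v / ell ^+ 2.
Let K := (Num.truncn (3 / o)).+1.

Let e0 : 0 < ell /\ ell <= 1 / 4. Proof. exact: ell_bounds. Qed.
Let o0 : 0 < o. Proof. by have [a _] := e0; rewrite divr_gt0 ?exprn_gt0 // mulr_gt0. Qed.
Let oe : o <= ell / 1100.
Proof.
have [a _] := e0; rewrite ler_pdivrMr ?exprn_gt0 //.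
have := vl; rewrite (_ : ell / 1100 * ell ^+ 2 = 2 * (ell ^+ 3 / (11 * 200))); last by field.
by lra.
Qed.

Let o1 : o <= 1 / 200. Proof. by have := oe; have [_] := e0; lra. Qed.
Let o2 : 44 * o <= 1 / 20. Proof. by have := oe; have [_] := e0; lra. Qed.
Let o3 : 1100 * o <= 1 / 4. Proof. by have := oe; have [_] := e0; lra. Qed.
Let o4 : o <= ell / 100. Proof. by have := oe; have [] := e0; lra. Qed.
Let w0 : 0 < 2 * v. Proof. by rewrite mulr_gt0. Qed.
Let wE : 2 * v = ell ^+ 2 * o.
Proof. by have [a _] := e0; rewrite /o; field; have [b c] := andP l01; rewrite !gt_eqF ?subr_gt0. Qed.
Let wo : 2 * v <= ell ^+ 2 * o. Proof. by rewrite -wE. Qed.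
Let hw : v ^+ 2 <= (2 * v) ^+ 2. Proof. by have := sqr_ge0 v; rewrite exprMn; lra. Qed.

Let o3K : K%:R <= 3 / o + 1 /\ 3 / o <= K%:R.
Proof.
have o0' := o0; have /andP[h1 h2] := Num.Theory.truncn_itv (divr_ge0 (ler0n R 3) (ltW o0')).
by split; [rewrite -[K%:R]natr1 lerD2r|exact: ltW].
Qed.

Let Ko : 3 <= o * K%:R.
Proof. by have [_] := o3K; have o0' := o0; rewrite ler_pdivrMr // mulrC. Qed.

(** The 2K rounds cost 8 K v^2. Since v is at most o/32 and o K at most 3 + o, this is less than v,
    so the sizes never exceed 2 v. *)
Let vw : v + (4 * (K + K)%:R + 6) * v ^+ 2 <= 2 * v.
Proof.
have o0' := o0; have v0' := v0; have [a b] := e0; have o1' := o1; have [K2 _] := o3K.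
have oK : o * K%:R <= 3 + o.
  have : o * K%:R <= o * (3 / o + 1) by rewrite ler_wpM2l // ltW.
  by rewrite mulrDr mulr1 mulrCA divff ?gt_eqF // mulr1.
have ee : ell ^+ 2 <= 1 / 16.
  have : ell * ell <= 1 / 4 * (1 / 4) by apply: ler_pM => //; exact: ltW.
  by rewrite expr2; lra.
have vo : v <= o / 32.
  have : ell ^+ 2 * o <= 1 / 16 * o by rewrite ler_wpM2r // ltW.
  by have := wE; lra.
have KK : (K + K)%:R = 2 * K%:R :> R by rewrite natrD; ring.
have vK : v * K%:R <= (o * K%:R) / 32.
  have : v * K%:R <= o / 32 * K%:R by rewrite ler_wpM2r.
  by move: (K%:R) => k; lra.
have : v * (8 * (v * K%:R) + 6 * v) <= v * 1.
  rewrite ler_wpM2l ?(ltW v0) //; move: (v * K%:R) (o * K%:R) vK oK => x y; lra.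
rewrite KK; move: (K%:R) => k; lra.
Qed.

Let h3v (e : R) : ell / 3 = e -> v < e.
Proof.
move=> <-; have [a b] := e0; have vl' := vl; have ee : ell ^+ 3 <= ell.
  by rewrite exprS ler_piMr ?(ltW a) // exprn_ile1 ?(ltW a) //; lra.
lra.
Qed.

Lemma Om00 : Om s t s0 s0 = bclass s t.
Proof. by apply/setP => G; rewrite in_set sub0set -setI_eq0 setI0 eqxx !andbT. Qed.

(** Without a graph of the given degrees both probabilities would be 0/0 = 0. Existence holds
    because all degrees are within a proportion v of regular ones, and 3 v < ell. *)
Let c0 : 0 < cnt R s t s0 s0.
Proof.
rewrite /cnt ltr0n card_gt0 Om00.
have v0' := v0; have v3 : 3 * v < ell by have := h3v erefl; lra.
have vb N : v / 2 * N%:R <= v * N%:R by rewrite ler_wpM2r //; lra.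
apply: (bclass_nonempty l01 v0 v3 n0 m0 st) => [j|k].
  by rewrite -savgE; apply: le_trans (vb _).
by rewrite -tavgE; apply: le_trans (vb _).
Qed.

Let prob_exp (p x M : R) (c : R) (X : nat) : 0 < p -> 0 < x -> `|ln p - X%:R * ln x - M| <= c ->
  exists e : R, `|e| <= c /\ p = x ^+ X * expR (M + e).
Proof.
move=> p0 x0 h; exists (ln p - X%:R * ln x - M); split=> //.
rewrite -[in LHS](lnK (x := p)) ?posrE // -[x in x ^+ X](lnK (x := x)) ?posrE // -expRM_natl -expRD.
by congr expR; ring.
Qed.

Lemma prob_disjointE : prob_disjoint R s t H = cnt R s t s0 H / cnt R s t s0 s0.
Proof.
rewrite /prob_disjoint /cnt Om00; congr (_%:R / _); apply: eq_card => G.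
by rewrite [LHS]in_set [RHS]in_set sub0set.
Qed.
Lemma prob_containsE : prob_contains R s t H = cnt R s t H s0 / cnt R s t s0 s0.
Proof.
rewrite /prob_contains /cnt Om00; congr (_%:R / _); apply: eq_card => G.
by rewrite [LHS]in_set [RHS]in_set -setI_eq0 setI0 eqxx andbT.
Qed.

Theorem finite_estimate (c := #|H|%:R * (ell^-1 * (100 * (2 * v / ell ^+ 2)) ^+ 3)) :
  (exists e : R, `|e| <= c /\ prob_disjoint R s t H = (1 - l) ^+ #|H| * expR (miss_main R s t H + e)) /\
  (exists e : R, `|e| <= c /\ prob_contains R s t H = l ^+ #|H| * expR (hit_main R s t H + e)).
Proof.
have [a b] := andP l01.
have bE : row_dev n s l = (fun j => (s j)%:R - savg R s) by apply: funext => j; rewrite savgE.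
have cE : col_dev m t l = (fun k => (t k)%:R - tavg R t) by apply: funext => k; rewrite tavgE.
have v0' := ltW v0.
split.
  have [c1] := miss_ln l01 w0 wo o1 hw o2 o3 o4 n0 m0 st vm vn Ko v0' vw ls good_miss c0.
  rewrite bE cE -miss_main_MF prob_disjointE => B.
  by apply: prob_exp B; [rewrite divr_gt0|rewrite subr_gt0].
have [c1] := hit_ln l01 w0 wo o1 hw o2 o3 o4 n0 m0 st vm vn Ko v0' vw ls good_hit c0.
rewrite bE cE -hit_main_MF // prob_containsE => B.
by apply: prob_exp B; first by rewrite divr_gt0.
Qed.
End Finite.

(** * Asymptotics *)

Lemma powR_large (R : realType) (M d : R) : 0 < d ->
  exists N0 : nat, forall N, (N0 <= N)%N -> M <= N%:R `^ d.
Proof.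
move=> d0; exists (Num.bound ((`|M| + 1) `^ d^-1)) => N BN.
have M1 : 0 <= `|M| + 1 by rewrite addr_ge0.
have B0 := archi_boundP (powR_ge0 (`|M| + 1) d^-1).
apply: (@le_trans _ _ (`|M| + 1)); first by have := ler_norm M; lra.
have E : ((`|M| + 1) `^ d^-1) `^ d = `|M| + 1 by rewrite -powRrM mulVf ?gt_eqF // powRr1.
rewrite -[leLHS]E; apply: ge0_ler_powR; rewrite ?nnegrE ?powR_ge0 //; first exact: ltW.
by apply: le_trans (ltW B0) _; rewrite ler_nat.
Qed.

Section Large.
Variables (R : realType) (m n : nat) (s : 'I_m -> nat) (t : 'I_n -> nat) (H : {set 'I_m * 'I_n}).
Variables (a b C eps M : R).
Local Notation l := (lam R n s).
Local Notation ell := (l * (1 - l)).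
Local Notation q e := ((n%:R : R) `^ e).
Hypotheses (a0 : 0 < a) (eps0 : 0 < eps) (epsb : eps < (2^-1 - b) / 18) (b0 : 0 < b) (C0 : 0 <= C).
Hypotheses (m0 : (0 < m)%N) (n0 : (0 < n)%N) (st : (\sum_j s j = \sum_k t k)%N).
Hypotheses (hs : forall j, `|(s j)%:R - savg R s| <= C * q (2^-1 + eps))
  (hx : forall j, (degu H j)%:R <= C * q (2^-1 + eps))
  (ht : forall k, `|(t k)%:R - tavg R t| <= C * q (2^-1 + eps))
  (hy : forall k, (degv H k)%:R <= C * q (2^-1 + eps))
  (hX : #|H|%:R <= C * q (1 + 2 * eps))
  (nm : n%:R <= (m%:R : R) `^ (1 + eps))
  (A0 : 0 < Aconst R n s)
  (hA : (1 - 2 * l) ^+ 2 / (8 * Aconst R n s) * (1 + 5 * m%:R / (6 * n%:R) + 5 * n%:R / (6 * m%:R)) <= a * ln n%:R).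
Hypotheses (M1 : 2 * C <= q (eps / 2)) (M2 : 4 * (1 + 2 * a / eps) <= q (eps / 2)) (M3 : 11 * 200 <= q (eps / 2)).

Let n1 : 1 <= n%:R :> R. Proof. by rewrite ler1n. Qed.
Let m1 : 1 <= m%:R :> R. Proof. by rewrite ler1n. Qed.
Let qD e f : q (e + f) = q e * q f.
Proof. by rewrite powRD // pnatr_eq0 -lt0n n0 implybT. Qed.
Let q0 e : 0 < q e. Proof. by rewrite powR_gt0 // ltr0n. Qed.
Let q1 : q 1 = n%:R. Proof. exact: powRr1. Qed.
Let qle e f : e <= f -> q e <= q f. Proof. exact: ler_powR. Qed.
Let qone e : 0 <= e -> 1 <= q e. Proof. by move=> e0; rewrite -[leLHS](powRr0 n%:R); exact: qle. Qed.

Let l01 : 0 < l < 1.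
Proof.
have l0 : 0 <= l by rewrite /lam /savg !divr_ge0 // sumr_ge0.
have : 0 < l * (1 - l) by move: A0; rewrite /Aconst -mulrA pmulr_rgt0 // invr_gt0.
move=> h; have l1 : 0 < l by rewrite lt_neqAle l0 andbT; apply: contraTneq h => <-; rewrite mul0r ltxx.
by rewrite l1; move: h; rewrite pmulr_rgt0 // subr_gt0.
Qed.
Let e0 : 0 < ell /\ ell <= 1 / 4. Proof. exact: ell_bounds. Qed.

(** Raise n <= m^(1 + eps) to the power 1 - eps and use (1 + eps)(1 - eps) <= 1. *)
Let mq : q (1 - eps) <= m%:R.
Proof.
have [h1 h2] : 0 <= 1 - eps /\ 1 - eps <= 1 by have := eps0; have := b0; have := epsb; lra.
have : q (1 - eps) <= (m%:R `^ (1 + eps)) `^ (1 - eps).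
  by rewrite ge0_ler_powR ?nnegrE ?powR_ge0.
rewrite -powRrM => h; apply: le_trans h _; apply: ler1_powR => //.
have := sqr_ge0 eps; lra.
Qed.

(** As (1 - 2 l)^2 = 1 - 4 ell and the bracket in [hA] is at least 1, the hypothesis gives 1/ell <=
    4 (1 + a ln n). The logarithm is at most a multiple of n^(eps/2), and another n^(eps/2) absorbs
    the constants. *)
Let zq : ell^-1 <= q eps.
Proof.
have [l0 l1] := e0; have eps0' := eps0; have a0' := a0.
have lnq : ln n%:R <= 2 / eps * q (eps / 2).
  have := ln_sublinear (q0 (eps / 2)); rewrite ln_powR => h.
  rewrite -(@ler_pM2l _ (eps / 2)) ?divr_gt0 // mulrA (_ : eps / 2 * (2 / eps) = 1); last by field; rewrite gt_eqF.
  by rewrite mul1r ltW.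
have ln0 : 0 <= ln n%:R :> R by exact: ln_ge0.
have AE : 8 * Aconst R n s = 4 * ell by rewrite /Aconst; field.
have F1 : 1 <= 1 + 5 * m%:R / (6 * n%:R) + 5 * n%:R / (6 * m%:R) :> R.
  have : 0 <= 5 * m%:R / (6 * n%:R) :> R by rewrite divr_ge0 // mulr_ge0.
  have : 0 <= 5 * n%:R / (6 * m%:R) :> R by rewrite divr_ge0 // mulr_ge0.
  lra.
have h : (1 - 2 * l) ^+ 2 / (4 * ell) <= a * ln n%:R.
  apply: le_trans hA; rewrite AE -[leLHS]mulr1 ler_wpM2l //.
  by rewrite divr_ge0 ?sqr_ge0 // mulr_ge0 // ltW.
have zle : ell^-1 <= 4 * (1 + a * ln n%:R).
  rewrite (_ : ell^-1 = 4 * (1 + (1 - 2 * l) ^+ 2 / (4 * ell))); first by rewrite ler_wpM2l // lerD2l.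
  by field; have [p r] := andP l01; rewrite !gt_eqF ?subr_gt0.
apply: le_trans zle _.
have -> : q eps = q (eps / 2) * q (eps / 2) by rewrite -qD; congr (_ `^ _); field.
have p1 : 1 <= q (eps / 2) by apply: qone; rewrite divr_ge0 // ltW.
apply: (@le_trans _ _ (4 * (1 + 2 * a / eps) * q (eps / 2))); last by rewrite ler_wpM2r // ltW.
have : a * ln n%:R <= a * (2 / eps * q (eps / 2)) by rewrite ler_wpM2l // ltW.
have -> : a * (2 / eps * q (eps / 2)) = (2 * a / eps) * q (eps / 2) by field; rewrite gt_eqF.
lra.
Qed.

(* The exponent 3 eps absorbs the constant C and the ratios n / m <= n^eps and 1 / ell <= n^eps. *)
Let v := q (- 2^-1 + 3 * eps).
Let v0 : 0 < v. Proof. exact: q0. Qed.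
Let Mq c e : c <= q (eps / 2) -> eps / 2 <= e -> c <= q e.
Proof. by move=> h1 h2; apply: le_trans h1 (qle h2). Qed.

Let eb : 18 * eps < 2^-1 - b. Proof. by have := epsb; lra. Qed.

Let vl : v <= ell ^+ 3 / (11 * 200).
Proof.
have [l0 l1] := e0; have eps0' := eps0; have b0' := b0; have eb' := eb.
have i0 : 0 < ell ^+ 3 by rewrite exprn_gt0.
have zz : (ell ^+ 3)^-1 <= q (3 * eps).
  rewrite -exprVn (_ : q (3 * eps) = q eps ^+ 3); last first.
    by rewrite !exprS expr0 mulr1 -!qD; congr (_ `^ _); ring.
  by rewrite lerXn2r ?nnegrE ?invr_ge0 ?(ltW l0) ?(ltW (q0 _)) ?zq.
have h1 : v * q (3 * eps) * q (eps / 2) <= 1.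
  by rewrite -!qD -[leRHS](powRr0 n%:R); apply: qle; lra.
have key T : T <= q (eps / 2) -> v * (ell ^+ 3)^-1 * T <= 1.
  move=> Tq; apply: le_trans h1; have i1 : 0 <= v * (ell ^+ 3)^-1 by rewrite mulr_ge0 ?invr_ge0 // ltW.
  apply: (@le_trans _ _ (v * (ell ^+ 3)^-1 * q (eps / 2))); first by rewrite ler_wpM2l.
  by rewrite ler_wpM2r ?ler_wpM2l // ltW.
have := key _ M3; have : 0 < 11 * 200 :> R by rewrite mulr_gt0 ?ltr0n.
move: (11 * 200) => T T0 h2; rewrite ler_pdivlMr //; rewrite mulrAC ler_pdivrMr // in h2.
by rewrite mul1r in h2.
Qed.

Let vx c : c <= C * q (2^-1 + eps) -> c <= v / 2 * n%:R.
Proof.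
move=> h; apply: le_trans h _; have eps0' := eps0.
have -> : v / 2 * n%:R = q (2 * eps) / 2 * q (2^-1 + eps).
  by rewrite [LHS]mulrAC [RHS]mulrAC -[X in v * X]q1 /v -!qD; congr (_ `^ _ / _); field.
rewrite ler_wpM2r ?(ltW (q0 _)) // ler_pdivlMr // mulrC.
by apply: Mq => //; lra.
Qed.
Let vy c : c <= C * q (2^-1 + eps) -> c <= v / 2 * m%:R.
Proof.
move=> h; apply: le_trans h _; have eps0' := eps0.
apply: (@le_trans _ _ (v / 2 * q (1 - eps))); last by rewrite ler_wpM2l ?divr_ge0 ?(ltW v0).
have -> : v / 2 * q (1 - eps) = q eps / 2 * q (2^-1 + eps).
  by rewrite [LHS]mulrAC [RHS]mulrAC /v -!qD; congr (_ `^ _ / _); field.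
rewrite ler_wpM2r ?(ltW (q0 _)) // ler_pdivlMr // mulrC.
by apply: Mq => //; lra.
Qed.
Let v2 : v ^+ 2 = q (- 1 + 6 * eps).
Proof. by rewrite expr2 /v -qD; congr (_ `^ _); field. Qed.
Let vn : 1 <= v ^+ 2 * n%:R.
Proof. by rewrite v2 -[X in _ * X]q1 -qD qone //; have := eps0; lra. Qed.
Let vm5 : q (5 * eps) <= v ^+ 2 * m%:R.
Proof.
rewrite v2; apply: (@le_trans _ _ (q (-1 + 6 * eps) * q (1 - eps))); last by rewrite ler_wpM2l ?(ltW (q0 _)).
by rewrite -qD; apply: qle; lra.
Qed.
Let vm : 1 <= v ^+ 2 * m%:R.
Proof. by apply: le_trans vm5; apply: qone; have := eps0; lra. Qed.
Let vX : #|H|%:R <= v ^+ 2 * (m%:R * n%:R).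
Proof.
have eps0' := eps0; apply: le_trans hX _; rewrite mulrA.
apply: (@le_trans _ _ (q (5 * eps) * q 1)); last by rewrite q1 ler_wpM2r.
have -> : q (5 * eps) * q 1 = q (3 * eps) * q (1 + 2 * eps) by rewrite -!qD; congr (_ `^ _); ring.
rewrite ler_wpM2r ?(ltW (q0 _)) //; apply: (@Mq _ (3 * eps)); last by lra.
by have C0' := C0; apply: le_trans M1; lra.
Qed.

(** Counting exponents: 1 + 2 eps from the edges of H, -3/2 + 9 eps from v^3, and 7 eps from
    ell^(-7), in total -1/2 + 18 eps. *)
Let err : #|H|%:R * (ell^-1 * (100 * (2 * v / ell ^+ 2)) ^+ 3) <= C * 200 ^+ 3 * q (- b).
Proof.
have [l0 l1] := e0; have eb' := eb; have z0 : 0 <= ell^-1 by rewrite invr_ge0 ltW.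
have -> : ell^-1 * (100 * (2 * v / ell ^+ 2)) ^+ 3 = 200 ^+ 3 * (v ^+ 3 * ell^-1 ^+ 7).
  rewrite (_ : 100 * (2 * v / ell ^+ 2) = 200 * (v * ell^-1 ^+ 2)); last by rewrite exprVn; ring.
  by move: (ell^-1) => z; rewrite [(200 * _) ^+ 3]exprMn; ring.
have h7 : ell^-1 ^+ 7 <= q (7 * eps).
  have -> : q (7 * eps) = q eps ^+ 7 by rewrite !exprS expr0 mulr1 -!qD; congr (_ `^ _); ring.
  by rewrite lerXn2r ?nnegrE // (ltW (q0 _)).
have h3 : v ^+ 3 = q (- (3 / 2) + 9 * eps).
  by rewrite !exprS expr0 mulr1 /v -!qD; congr (_ `^ _); field.
have h : v ^+ 3 * ell^-1 ^+ 7 <= q (- (3 / 2) + 16 * eps).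
  apply: (@le_trans _ _ (v ^+ 3 * q (7 * eps))); first by rewrite ler_wpM2l // exprn_ge0 // ltW.
  by rewrite h3 -qD; apply: qle; lra.
have : 0 <= 200 ^+ 3 :> R by rewrite exprn_ge0 // ler0n.
move: (200 ^+ 3) => T T0.
apply: (@le_trans _ _ (C * q (1 + 2 * eps) * (T * q (- (3 / 2) + 16 * eps)))).
  apply: ler_pM => //; last by rewrite ler_wpM2l.
  by rewrite mulr_ge0 // mulr_ge0 ?exprn_ge0 // ltW.
rewrite mulrACA ler_wpM2l ?mulr_ge0 // -qD; apply: qle; lra.
Qed.

Lemma large_estimate :
  (exists e : R, `|e| <= C * 200 ^+ 3 * q (- b) /\
     prob_disjoint R s t H = (1 - l) ^+ Xn H * expR (miss_main R s t H + e)) /\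
  (exists e : R, `|e| <= C * 200 ^+ 3 * q (- b) /\
     prob_contains R s t H = l ^+ Xn H * expR (hit_main R s t H + e)).
Proof.
rewrite /Xn sum_degu.
have [] := finite_estimate n0 m0 st l01 v0 vl vm vn (fun j => vx (hs j)) (fun k => vy (ht k))
  (fun j => vx (hx j)) (fun k => vy (hy k)) vX.
move=> [e1 [n_e1 E1]] [e2 [n_e2 E2]]; split; [exists e1|exists e2]; split=> //; exact: le_trans err.
Qed.
End Large.

Theorem theorem2p2 (R : realType) (a b : R) :
  0 < a -> 0 < b -> a + b < 2^-1 ->
  exists eps0 : R, 0 < eps0 /\
  forall eps : R, 0 < eps -> eps < eps0 ->
  forall (m n : nat -> nat)
         (s : forall N, 'I_(m N) -> nat) (t : forall N, 'I_(n N) -> nat)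
         (H : forall N, {set 'I_(m N) * 'I_(n N)}),
  (* the data: positive integer degrees with equal sums *)
  (forall N j, (0 < s N j)%N) ->
  (forall N k, (0 < t N k)%N) ->
  (forall N, (\sum_(j < m N) s N j = \sum_(k < n N) t N k)%N) ->
  (* m, n -> infinity *)
  (forall M : nat, exists N0 : nat, forall N, (N0 <= N)%N -> (M <= m N)%N) ->
  (forall M : nat, exists N0 : nat, forall N, (N0 <= N)%N -> (M <= n N)%N) ->
  (* uniform O-bounds *)
  (exists (C : R) (N0 : nat), forall N, (N0 <= N)%N ->
     (forall j, `|(s N j)%:R - savg R (s N)| <= C * (n N)%:R `^ (2^-1 + eps))
  /\ (forall j, ((xd (H N) j)%:R : R) <= C * (n N)%:R `^ (2^-1 + eps))
  /\ (forall k, `|(t N k)%:R - tavg R (t N)| <= C * (n N)%:R `^ (2^-1 + eps))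
  /\ (forall k, ((yd (H N) k)%:R : R) <= C * (n N)%:R `^ (2^-1 + eps))
  /\ Xr R (H N) <= C * (n N)%:R `^ (1 + 2 * eps)) ->
  (* n = o(m^(1+eps)), m = o(n^(1+eps)) *)
  (forall d : R, 0 < d -> exists N0 : nat, forall N, (N0 <= N)%N ->
     ((n N)%:R : R) <= d * (m N)%:R `^ (1 + eps)) ->
  (forall d : R, 0 < d -> exists N0 : nat, forall N, (N0 <= N)%N ->
     ((m N)%:R : R) <= d * (n N)%:R `^ (1 + eps)) ->
  (* (1-2 lambda)^2/(8A) (1 + 5m/(6n) + 5n/(6m)) <= a log n, with A > 0 *)
  (exists N0 : nat, forall N, (N0 <= N)%N ->
     0 < Aconst R (n N) (s N) /\
     (1 - 2 * lam R (n N) (s N)) ^+ 2 / (8 * Aconst R (n N) (s N)) *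
       (1 + 5 * (m N)%:R / (6 * (n N)%:R) + 5 * (n N)%:R / (6 * (m N)%:R))
       <= a * ln ((n N)%:R)) ->
  exists (K : R) (N0 : nat), forall N, (N0 <= N)%N ->
    (exists e : R, `|e| <= K * (n N)%:R `^ (- b) /\
       prob_disjoint R (s N) (t N) (H N)
       = (1 - lam R (n N) (s N)) ^+ Xn (H N) *
         expR (miss_main R (s N) (t N) (H N) + e))
 /\ (exists e : R, `|e| <= K * (n N)%:R `^ (- b) /\
       prob_contains R (s N) (t N) (H N)
       = lam R (n N) (s N) ^+ Xn (H N) *
         expR (hit_main R (s N) (t N) (H N) + e)).
Proof.
(* With this choice the exponent -1/2 + 18 eps of the total error stays below -b. *)
move=> a0 b0 ab; exists ((2^-1 - b) / 18); split; first by rewrite divr_gt0 //; lra.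
move=> eps eps0 epsb m n s t H _ _ st m_oo n_oo [C [N1 hC]] /(_ 1 ltr01) [N2 nm] _ [N3 hA].
have [N4 m1] := m_oo 1%N; have [N5 n1] := n_oo 1%N.
(* The constant C comes without a sign, so its absolute value is used in its place. *)
have C0 : 0 <= `|C| by [].
have d0 : 0 < eps / 2 by rewrite divr_gt0.
(* One threshold above all three constants that a factor n^(eps/2) has to absorb. *)
have [B large] := powR_large (11 * 200 + (4 * `|C| + 4 * (1 + 2 * a / eps))) d0.
have [N6 nB] := n_oo B.
exists (`|C| * 200 ^+ 3), (N1 + N2 + N3 + N4 + N5 + N6)%N => N NN.
have le i : (i <= N1 + N2 + N3 + N4 + N5 + N6)%N -> (i <= N)%N by move/leq_trans; apply.
have i1 : (N1 <= N)%N by apply: le; rewrite -!addnA leq_addr.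
have i2 : (N2 <= N)%N by apply: le; rewrite -!addnA; lia.
have i3 : (N3 <= N)%N by apply: le; rewrite -!addnA; lia.
have i4 : (N4 <= N)%N by apply: le; rewrite -!addnA; lia.
have i5 : (N5 <= N)%N by apply: le; rewrite -!addnA; lia.
have i6 : (N6 <= N)%N by apply: le; rewrite -!addnA; lia.
have [hs [hx [ht [hy hX]]]] := hC _ i1; have [A0 hA'] := hA _ i3.
have CC e : C * (n N)%:R `^ e <= `|C| * (n N)%:R `^ e by rewrite ler_wpM2r ?powR_ge0 // ler_norm.
have L := large _ (nB _ i6).
have ae : 0 <= 2 * a / eps by rewrite divr_ge0 ?mulr_ge0 // ltW.
have nm' : (n N)%:R <= (m N)%:R `^ (1 + eps) :> R by have := nm _ i2; rewrite mul1r.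
have t22 : 0 <= 11 * 200 :> R := mulr_ge0 (ler0n R 11) (ler0n R 200).
apply: (@large_estimate _ _ _ _ _ _ a b `|C| eps) => //.
- exact: m1.
- exact: n1.
- by move=> j; apply: le_trans (CC _).
- by move=> j; apply: le_trans (CC _).
- by move=> j; apply: le_trans (CC _).
- by move=> j; apply: le_trans (CC _).
- by rewrite -sum_degu; apply: le_trans (CC _).
- by apply: le_trans L; move: (11 * 200) t22 => x; lra.
- by apply: le_trans L; move: (11 * 200) t22 => x; lra.
- by apply: le_trans L; rewrite lerDl addr_ge0 ?mulr_ge0 // addr_ge0.
Qed.
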